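(* Let $E_1,\dots,E_n$ be Banach spaces with shrinking Schauder bases and let $F$ be a Banach space such that $F''$ has the bounded approximation property. Then $$(E_1'\widetilde\otimes\cdots\widetilde\otimes E_n'\widetilde\otimes F,\pi)=\mathcal N(E_1,\dots,E_n;F)=P\mathcal I(E_1,\dots,E_n;F)=G\mathcal I(E_1,\dots,E_n;F)$$ isometrically (the first identification via the canonical mapping), where $\mathcal N$, $P\mathcal I$, $G\mathcal I$ are the ideals of nuclear, Pietsch integral and Grothendieck integral $n$-linear operators and $\pi$ is the projective tensor norm. In particular, if $F$ also has a Schauder basis $(f_l)_l$, then the monomials $\big(e_{j_1}'(\cdot)\cdots e_{j_n}'(\cdot)\cdot f_l\big)_{j_1,\dots,j_n,l}$ (with the square ordering), where $(e'_{j_k})_{j_k}$ are the coordinate functionals of the basis of $E_k$, form a Schauder basis of $G\mathcal I(E_1,\dots,E_n;F)$.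
   Context: Banach spaces are over $\mathbb K=\mathbb R$ or $\mathbb C$; $E'$ is the dual of $E$, $B_E$ its closed unit ball. $\mathcal L(E_1,\dots,E_n;F)$ is the space of continuous $n$-linear operators. $\widetilde\otimes$ denotes completed tensor product. The canonical mapping is determined by $x_1'\otimes\cdots\otimes x_n'\otimes f\mapsto x_1'(\cdot)\cdots x_n'(\cdot)f$. $T\in\mathcal L(E_1,\dots,E_n;F)$ is Pietsch integral (respectively Grothendieck integral) if there is a regular $F$-valued (respectively $F''$-valued) Borel measure $\mu$ of bounded variation on $(B_{E_1'}\times\cdots\times B_{E_n'},w^* )$ with $T(x_1,\dots,x_n)=\int x_1'(x_1)\cdots x_n'(x_n)\,d\mu(x_1',\dots,x_n')$ for all $x_k\in E_k$; its norm in $P\mathcal I(E_1,\dots,E_n;F)$ (respectively $G\mathcal I(E_1,\dots,E_n;F)$) is the infimum of $\|\mu\|$ (total variation) over all such $\mu$. $T$ is nuclear if $T(x_1,\dots,x_n)=\sum_{j\in\mathbb N}\lambda_j(x_1^j)'(x_1)\cdots(x_n^j)'(x_n)f_j$ with $\lambda_j\in\mathbb K$, $(x_k^j)'\in E_k'$, $f_j\in F$ and $\sum_j|\lambda_j|\,\|(x_1^j)'\|\cdots\|(x_n^j)'\|\,\|f_j\|<\infty$; $\|T\|_{\mathcal N}$ is the infimum of these sums over all representations. Square ordering (of Gelbaum–Gil de Lamadrid): on $\mathbb N^2$, enumerate by blocks $k=1,2,\dots$, the $k$-th block being $(1,k),(2,k),\dots,(k,k),(k,k-1),\dots,(k,1)$.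 On $\mathbb N^{m}$ it is defined recursively: enumerate $\mathbb N^{m-1}$ by its square ordering, thereby identify $\mathbb N^{m}=\mathbb N^{m-1}\times\mathbb N$ with $\mathbb N\times\mathbb N$, and use the ordering of $\mathbb N^2$. *)

(* Defs.v *)
From HB Require Import structures.
From mathcomp Require Import all_boot all_order all_algebra.
From mathcomp Require Import all_classical all_reals all_analysis.
From mathcomp Require Import complex lra.

Set Implicit Arguments.
Unset Strict Implicit.
Unset Printing Implicit Defensive.

Import Order.TTheory GRing.Theory Num.Theory numFieldNormedType.Exports.

Local Open Scope classical_set_scope.
Local Open Scope ring_scope.

Variant ground := RealGround | ComplexGround.

Definition scalars (R : realType) (k : ground) : numFieldType :=
  match k with RealGround => R | ComplexGround => complex R end.

Definition re_part (R : realType) (k : ground) : scalars R k -> R :=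
  match k with RealGround => id | ComplexGround => @complex.Re R end.

Definition of_real (R : realType) (k : ground) : R -> scalars R k :=
  match k with RealGround => id | ComplexGround => real_complex R end.
Arguments of_real {R} k.

(* The library norm of a module over [K] takes its values in [K] itself; this is
   the same norm with values in [R], where infima and suprema are available. *)
Definition rnorm (R : realType) (k : ground) (V : normedModType (scalars R k))
  (x : V) : R := re_part `|x|.

Section RealNormTheory.
Variables (R : realType) (k : ground).
Local Notation K := (scalars R k).

Lemma of_realK (r : R) : re_part (of_real k r) = r.
Proof. by case: k. Qed.

Lemma of_real_inj : injective (@of_real R k).
Proof. exact: can_inj of_realK. Qed.

Lemma re_partK (c : K) : 0 <= c -> of_real k (re_part c) = c.
Proof. by case: k c => //= c c0; rewrite RRe_real// ger0_real. Qed.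

Lemma re_partD (c d : K) : re_part (c + d) = re_part c + re_part d.
Proof. by case: k c d => //= -[? ?] [? ?]. Qed.

Lemma of_realD (r s : R) : of_real k (r + s) = of_real k r + of_real k s.
Proof. by case: k => //=; rewrite rmorphD. Qed.

Lemma of_realM (r s : R) : of_real k (r * s) = of_real k r * of_real k s.
Proof. by case: k => //=; rewrite rmorphM. Qed.

Lemma of_real0 : of_real k 0 = 0 :> K.
Proof. by case: k. Qed.

Lemma of_real_le (r s : R) : (of_real k r <= of_real k s) = (r <= s).
Proof. by case: k => //=; rewrite lecR. Qed.

Lemma of_real_lt (r s : R) : (of_real k r < of_real k s) = (r < s).
Proof. by case: k => //=; rewrite ltcR. Qed.

Lemma re_part_le (c d : K) : c <= d -> re_part c <= re_part d.
Proof. by case: k c d => //= c d; rewrite lecE => /andP[]. Qed.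

Lemma rnormE (V : normedModType K) (x : V) : of_real k (rnorm x) = `|x|.
Proof. exact: re_partK. Qed.

Lemma rnorm_ge0 (V : normedModType K) (x : V) : 0 <= rnorm x.
Proof. by rewrite -(of_real_le) rnormE of_real0. Qed.

Lemma rnorm0 (V : normedModType K) : rnorm (0 : V) = 0.
Proof. by rewrite /rnorm normr0 -of_real0 of_realK. Qed.

Lemma rnormD (V : normedModType K) (x y : V) : rnorm (x + y) <= rnorm x + rnorm y.
Proof. by rewrite -of_real_le of_realD !rnormE ler_normD. Qed.

Lemma rnormZ (V : normedModType K) (a : K) (x : V) : rnorm (a *: x) = rnorm (a : K^o) * rnorm x.
Proof. by apply: of_real_inj; rewrite of_realM (rnormE (a : K^o)) !rnormE; exact: normrZ. Qed.

Lemma rnorm_eq0 (V : normedModType K) (x : V) : rnorm x = 0 -> x = 0.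
Proof. by move=> x0; apply/eqP; rewrite -normr_eq0 -rnormE x0 of_real0. Qed.

Lemma rnormN (V : normedModType K) (x : V) : rnorm (- x) = rnorm x.
Proof. by rewrite /rnorm normrN. Qed.

Lemma rnorm_of_real (r : R) : 0 <= r -> rnorm (of_real k r : K^o) = r.
Proof.
by move=> r0; rewrite /rnorm ger0_norm ?of_realK// -of_real0 of_real_le.
Qed.

Lemma rnorm1 : rnorm (1 : K^o) = 1.
Proof. by rewrite /rnorm normr1; case: k. Qed.

Lemma rnormV (a : K) : a != 0 -> rnorm (a^-1 : K^o) = (rnorm (a : K^o))^-1.
Proof.
move=> a0; have := rnormZ (a : K) (a^-1 : K^o).
rewrite -[_ *: _]/(a * a^-1 : K^o) divff// rnorm1 => /esym aV.
have na0 : rnorm (a : K^o) != 0 by apply: contra a0 => /eqP/rnorm_eq0 ->.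
by apply: (mulfI na0); rewrite aV divff.
Qed.
End RealNormTheory.

Section Dual.
Variables (R : realType) (k : ground) (E : normedModType (scalars R k)).
Local Notation K := (scalars R k).

Definition dual_pred : {pred E -> K^o} :=
  fun f => `[< linear f /\ continuous f >].

Fact dual_submod : submod_closed dual_pred.
Proof.
split=> [|a f g /asboolP[fl fc] /asboolP[gl gc]]; apply/asboolP; split.
- by move=> b x y; rewrite /= scaler0 addr0.
- exact: cst_continuous.
- move=> b x y.
  rewrite -[LHS]/(a *: f (b *: x + y) + g (b *: x + y)).
  rewrite -[RHS]/(b *: (a *: f x + g x) + (a *: f y + g y)).
  by rewrite fl gl !scalerDr !scalerA (mulrC a b) addrACA.
- move=> x; rewrite -[X in continuous_at _ X]/(fun z => a *: f z + g z).
  by apply: cvgD; [apply: cvgZr; exact: fc|exact: gc].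
Qed.
HB.instance Definition _ :=
  GRing.isSubmodClosed.Build K (E -> K^o) dual_pred dual_submod.

Record dual := Dual { dual_fun :> E -> K^o; dual_funP : dual_fun \in dual_pred }.

HB.instance Definition _ := [isSub for dual_fun].
HB.instance Definition _ := [Choice of dual by <:].
HB.instance Definition _ := [SubChoice_isSubLmodule of dual by <:].

Implicit Types f g : dual.

Lemma dual_linear f : linear f.
Proof. by have /asboolP[] := dual_funP f. Qed.

Lemma dual_continuous f : continuous f.
Proof. by have /asboolP[] := dual_funP f. Qed.

HB.instance Definition _ f := GRing.isLinear.Build K E K^o *:%R f (dual_linear f).

Lemma dualDE f g x : (f + g) x = f x + g x. Proof. by []. Qed.

Lemma dualZE a f x : (a *: f) x = a *: f x. Proof. by []. Qed.

Definition dual_rnorm (f : dual) : R :=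
  sup [set rnorm (f x) | x in [set x : E | rnorm x <= 1]].

Lemma dual_bounded f :
  exists M : R, forall x, rnorm (f x) <= M * rnorm x.
Proof.
have /continuous_linear_bounded/linear_boundedP : {for 0, continuous f}.
  exact: dual_continuous.
move=> /pinfty_ex_gt0[M M0 fM]; exists (re_part M) => x.
by rewrite -(of_real_le k) of_realM rnormE (rnormE x) re_partK ?(ltW M0)//; exact: fM.
Qed.

Lemma dual_has_sup f :
  has_sup [set rnorm (f x) | x in [set x : E | rnorm x <= 1]].
Proof.
split; first by exists (rnorm (f 0)), 0; rewrite //= rnorm0.
have [M fM] := dual_bounded f; exists (Num.max M 0) => _ [x /= x1 <-].
apply: le_trans (fM x) _; rewrite le_max.
have [M0|M0] := leP M 0.
  by rewrite mulr_le0_ge0 ?rnorm_ge0// orbT.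
by rewrite ler_piMr// ltW.
Qed.

Lemma dual_rnorm_ge0 f : 0 <= dual_rnorm f.
Proof.
apply: (ub_le_sup (dual_has_sup f).2); exists 0; rewrite /= ?rnorm0//.
by rewrite linear0 rnorm0.
Qed.

Lemma dual_rnorm_ball f x : rnorm x <= 1 -> rnorm (f x) <= dual_rnorm f.
Proof. by move=> x1; apply: (ub_le_sup (dual_has_sup f).2); exists x. Qed.

Lemma dual_rnorm_le f (M : R) :
  (forall x, rnorm x <= 1 -> rnorm (f x) <= M) -> dual_rnorm f <= M.
Proof.
by move=> fM; apply: ge_sup (dual_has_sup f).1 _ => _ [x /= x1 <-]; exact: fM.
Qed.

Lemma dual_rnorm_op f x : rnorm (f x) <= dual_rnorm f * rnorm x.
Proof.
have [->|x0] := eqVneq x 0; first by rewrite linear0 !rnorm0 mulr0.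
have nx0 : 0 < rnorm x.
  rewrite lt_neqAle rnorm_ge0 andbT eq_sym; apply: contra x0 => /eqP/rnorm_eq0 ->.
  exact: eqxx.
rewrite -ler_pdivrMr// mulrC.
have nV : rnorm (of_real k (rnorm x)^-1 : K^o) = (rnorm x)^-1.
  by rewrite rnorm_of_real// invr_ge0 ltW.
rewrite -nV -rnormZ -linearZ; apply: dual_rnorm_ball.
by rewrite rnormZ nV mulVf// gt_eqF.
Qed.

Definition dual_norm (f : dual) : K := of_real k (dual_rnorm f).

Fact dual_normD f g : dual_norm (f + g) <= dual_norm f + dual_norm g.
Proof.
rewrite -of_realD of_real_le; apply: dual_rnorm_le => x x1; rewrite dualDE.
by apply: le_trans (rnormD _ _) _; apply: lerD; exact: dual_rnorm_ball.
Qed.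

Fact dual_normZ (a : K) f : dual_norm (a *: f) = `|a| * dual_norm f.
Proof.
rewrite /dual_norm -[`|a|]/(`|a : K^o|) -rnormE -of_realM; congr of_real.
apply/eqP; rewrite eq_le; apply/andP; split.
  apply: dual_rnorm_le => x x1; rewrite dualZE rnormZ ler_wpM2l ?rnorm_ge0//.
  exact: dual_rnorm_ball.
have [a0|a0] := eqVneq (rnorm (a : K^o)) 0.
  by rewrite a0 mul0r dual_rnorm_ge0.
have na0 : 0 < rnorm (a : K^o) by rewrite lt_neqAle rnorm_ge0 andbT eq_sym.
rewrite mulrC -ler_pdivlMr//; apply: dual_rnorm_le => x x1.
by rewrite ler_pdivlMr// mulrC -rnormZ -dualZE; exact: dual_rnorm_ball.
Qed.

Fact dual_norm0_eq0 f : dual_norm f = 0 -> f = 0.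
Proof.
move=> /(congr1 (@re_part R k)); rewrite -(of_real0 R k) !of_realK => f0.
apply/val_inj/funext => x; apply: rnorm_eq0; apply/eqP.
by rewrite eq_le rnorm_ge0 andbT (le_trans (dual_rnorm_op f x))// f0 mul0r.
Qed.

HB.instance Definition _ :=
  Lmodule_isNormed.Build K dual dual_normD dual_normZ dual_norm0_eq0.

Lemma rnorm_dualE f : rnorm f = dual_rnorm f.
Proof. exact: of_realK. Qed.

End Dual.

Section Bidual.
Variables (R : realType) (k : ground) (F : normedModType (scalars R k)).
Local Notation K := (scalars R k).

Definition bidual : normedModType K := dual (dual F).

Fact bidual_emb_subproof (y : F) :
  (fun f : dual F => f y : K^o) \in @dual_pred R k (dual F).
Proof.
have l : linear (fun f : dual F => f y : K^o) by [].
apply/asboolP; split=> //.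
pose ev := GRing.isLinear.Build K (dual F) K^o *:%R _ l.
pose h : {linear dual F -> K^o} := HB.pack (fun f : dual F => f y : K^o) ev.
apply: (@bounded_linear_continuous _ _ _ h); apply/linear_boundedP.
near=> r => f; rewrite -!rnormE.
apply: (@le_trans _ _ (of_real k (rnorm y) * of_real k (rnorm f))).
  by rewrite -of_realM of_real_le mulrC rnorm_dualE dual_rnorm_op.
rewrite ler_wpM2r//; first by rewrite -(of_real0 R k) of_real_le rnorm_ge0.
by near: r; apply: nbhs_pinfty_ge; rewrite rnormE normr_real.
Unshelve. all: by end_near. Qed.

Definition bidual_emb (y : F) : bidual := Dual (bidual_emb_subproof y).
End Bidual.

(* A Schauder basis of the subspace [S] of [V] normed by [nu]. *)
Definition schauder_basis_of (R : realType) (k : ground)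
    (V : lmodType (scalars R k)) (S : set V) (nu : V -> R) (b : nat -> V) : Prop :=
  (forall j, S (b j)) /\
  forall v, S v -> exists! a : nat -> scalars R k,
    (fun m => nu (v - \sum_(j < m) a j *: b j)) @ \oo --> (0 : R).

Section Bases.
Variables (R : realType) (k : ground).
Local Notation K := (scalars R k).

Definition schauder_basis (V : normedModType K) (e : nat -> V) : Prop :=
  schauder_basis_of setT (@rnorm R k V) e.

(* For a Schauder basis [e] this determines [e'] uniquely. *)
Definition coordinate_functionals (V : normedModType K)
    (e : nat -> V) (e' : nat -> dual V) : Prop :=
  forall x, (fun m => rnorm (x - \sum_(j < m) e' j x *: e j)) @ \oo --> (0 : R).

Definition shrinking (V : normedModType K) (e : nat -> V) : Prop :=
  exists e' : nat -> dual V, coordinate_functionals e e' /\ schauder_basis e'.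

Definition finite_rank (V W : lmodType K) (S : V -> W) : Prop :=
  exists (m : nat) (w : 'I_m -> W),
    forall x, exists c : 'I_m -> K, S x = \sum_i c i *: w i.

Definition bounded_approximation_property (V : normedModType K) : Prop :=
  exists lambda : R, forall (C : set V) (eps : R), compact C -> 0 < eps ->
    exists S : {linear V -> V},
      [/\ finite_rank S,
          forall x, rnorm (S x) <= lambda * rnorm x &
          forall x, C x -> rnorm (S x - x) <= eps].
End Bases.

(* The square ordering, with indices starting at 0: the block
   (0,q), ..., (q,q), (q,q-1), ..., (q,0) is followed by (0,q+1). *)
Definition square_next (p : nat * nat) : nat * nat :=
  if (p.1 < p.2)%N then (p.1.+1, p.2)
  else if p.2 is q.+1 then (p.1, q) else (0%N, p.1.+1).

Definition square_pair (i : nat) : nat * nat := iter i square_next (0%N, 0%N).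

(* The [i]-th element of [N^m], as a sequence of length [m]. *)
Fixpoint square_enum (m i : nat) : seq nat :=
  match m with
  | 0 => [::]
  | 1 => [:: i]
  | m'.+1 => rcons (square_enum m' (square_pair i).1) (square_pair i).2
  end.

Section Multilinear.
Variables (R : realType) (k : ground).
Local Notation K := (scalars R k).

Definition multilinear (I : eqType) (G : I -> lmodType K) (W : lmodType K)
    (B : (forall i, G i) -> W) : Prop :=
  forall (x : forall i, G i) (i : I) (a : K) (u v : G i),
    B (dfwith x i (a *: u + v)) = a *: B (dfwith x i u) + B (dfwith x i v).

(* [L(E_1, ..., E_n; F)] *)
Definition multilinear_operators (n : nat) (E : 'I_n -> normedModType K)
    (F : normedModType K) : set ((forall i, E i) -> F) :=
  [set T | @multilinear _ (fun i => E i) F T /\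
           continuous (T : prod_topology (fun i => E i) -> F)].

(* x_1'(.) ... x_n'(.) f *)
Definition rank_one (n : nat) (E : 'I_n -> normedModType K)
    (F : normedModType K) (x' : forall i, dual (E i)) (f : F) :
    (forall i, E i) -> F :=
  fun x => (\prod_(i < n) x' i (x i)) *: f.
End Multilinear.

Section ProjectiveTensor.
Variables (R : realType) (k : ground).
Local Notation K := (scalars R k).
Variables (I : finType) (G : I -> normedModType K).

(* For nonempty [I], every element of the algebraic tensor product of the [G i] is
   a finite sum of elementary tensors; [s] stands for the sum of the elementary
   tensors of its entries.  By the universal property, two such sums are the same
   tensor when no multilinear map separates them. *)
Definition same_tensor (s s' : seq (forall i, G i)) : Prop :=
  forall (W : lmodType K) (B : (forall i, G i) -> W),
    @multilinear R k I (fun i => G i) W B ->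
    \sum_(x <- s) B x = \sum_(x <- s') B x.

Definition projective_norm (s : seq (forall i, G i)) : R :=
  inf [set \sum_(x <- s') \prod_i rnorm (x i) | s' in same_tensor s].

(* [X], with the elementary tensors given by [t], is the completion of the
   algebraic tensor product of the [G i] for the projective norm; the last two
   clauses say that the linearization of [t] is isometric with dense range.  Such
   a completion exists by [projective_completion_exists] below. *)
Definition projective_completion (X : completeNormedModType K)
    (t : (forall i, G i) -> X) : Prop :=
  [/\ @multilinear R k I (fun i => G i) X t,
      forall s, rnorm (\sum_(x <- s) t x) = projective_norm s &
      closure [set \sum_(x <- s) t x | s in setT] = [set: X]].
End ProjectiveTensor.

Section SeminormCompletion.
Variables (R : realType) (k : ground) (V : lmodType (scalars R k)).
Local Notation K := (scalars R k).

Record seminorm := Seminorm {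
  seminorm_fun :> V -> R;
  seminormD : forall x y, seminorm_fun (x + y) <= seminorm_fun x + seminorm_fun y;
  seminormZ_le : forall (a : K) x,
    seminorm_fun (a *: x) <= rnorm (a : K^o) * seminorm_fun x }.

Variable p : seminorm.

Lemma seminorm0 : p 0 = 0.
Proof.
apply/eqP; rewrite eq_le; apply/andP; split.
  by have := seminormZ_le p 0 0; rewrite scale0r (@rnorm0 _ _ K^o) mul0r.
by have := seminormD p 0 0; rewrite addr0 -lerBlDr subrr.
Qed.

Lemma seminormN x : p (- x) = p x.
Proof.
have h y : p (- y) <= p y.
  have := seminormZ_le p (-1) y; rewrite scaleN1r (@rnormN _ _ K^o).
  by rewrite rnorm1 mul1r.
by apply/eqP; rewrite eq_le h/= -{1}(opprK x) h.
Qed.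

Lemma seminormBC x y : p (x - y) = p (y - x).
Proof. by rewrite -seminormN opprB. Qed.

Lemma seminorm_ge0 x : 0 <= p x.
Proof.
have := seminormD p x (- x); rewrite subrr seminorm0 seminormN -mulr2n.
by rewrite pmulrn_lge0.
Qed.

Lemma seminormZ (a : K) x : p (a *: x) = rnorm (a : K^o) * p x.
Proof.
apply/eqP; rewrite eq_le seminormZ_le/=.
have [->|a0] := eqVneq a 0; first by rewrite (@rnorm0 _ _ K^o) mul0r seminorm_ge0.
have na0 : 0 < rnorm (a : K^o).
  by rewrite lt_neqAle rnorm_ge0 eq_sym andbT; apply: contra a0 => /eqP/rnorm_eq0 ->.
rewrite mulrC -ler_pdivlMr// mulrC -rnormV//.
by rewrite -{1}[x](scalerK a0) seminormZ_le.
Qed.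

Lemma seminorm_dist x y : `|p x - p y| <= p (x - y).
Proof.
rewrite ler_norml lerNl opprB !lerBlDr; apply/andP; split.
  by have := seminormD p (y - x) x; rewrite subrK seminormBC.
by have := seminormD p (x - y) y; rewrite subrK.
Qed.

Definition cauchy_pred : {pred nat -> V} := fun u =>
  `[< forall eps : R, 0 < eps -> exists N, forall i j, (N <= i)%N -> (N <= j)%N ->
        p (u i - u j) <= eps >].

Fact cauchy_submod : submod_closed cauchy_pred.
Proof.
split=> [|a u v /asboolP uC /asboolP vC]; apply/asboolP => eps e0.
  by exists 0%N => i j _ _; rewrite subrr seminorm0 ltW.
have a0 : 0 < rnorm (a : K^o) + 1 by rewrite ltr_wpDl// rnorm_ge0.
have [N1 uN] := uC (eps / 2 / (rnorm (a : K^o) + 1)) (divr_gt0 (divr_gt0 e0 (ltr0Sn R 1)) a0).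
have [N2 vN] := vC (eps / 2) (divr_gt0 e0 (ltr0Sn R 1)).
exists (maxn N1 N2) => i j; rewrite !geq_max => /andP[i1 i2] /andP[j1 j2].
rewrite -[u' in p (u' - _)]/(a *: u i + v i) -[u' in p (_ - u')]/(a *: u j + v j).
rewrite opprD addrACA -scalerBr (le_trans (seminormD _ _ _))//.
rewrite [leRHS]splitr; apply: lerD; last exact: vN.
rewrite seminormZ; apply: (@le_trans _ _ ((rnorm (a : K^o) + 1) * p (u i - u j))).
  by rewrite ler_wpM2r ?seminorm_ge0// lerDl.
by rewrite mulrC -ler_pdivlMr//; exact: uN.
Qed.
HB.instance Definition _ :=
  GRing.isSubmodClosed.Build K (nat -> V) cauchy_pred cauchy_submod.

Record cauchy_seq := CauchySeq {
  cauchy_fun :> nat -> V; cauchy_funP : cauchy_fun \in cauchy_pred }.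
HB.instance Definition _ := [isSub for cauchy_fun].
HB.instance Definition _ := [Choice of cauchy_seq by <:].
HB.instance Definition _ := [SubChoice_isSubLmodule of cauchy_seq by <:].

Implicit Types u v : cauchy_seq.

Lemma cauchy_seqP u (eps : R) : 0 < eps ->
  exists N, forall i j, (N <= i)%N -> (N <= j)%N -> p (u i - u j) <= eps.
Proof. by have /asboolP := cauchy_funP u; apply. Qed.

Lemma cauchy_seq_cvg u : cvgn (p \o u).
Proof.
apply: cauchy_cvg; apply: cauchy_exP => eps e0.
have [N uN] := cauchy_seqP u (divr_gt0 e0 (ltr0Sn R 1)).
exists (p (u N)); exists N => // i /= Ni.
rewrite /ball/= (le_lt_trans (seminorm_dist _ _))// (le_lt_trans (uN _ _ _ _))//.
by rewrite ltr_pdivrMr// ltr_pMr// ltr1n.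
Qed.

Definition cauchy_norm u : R := limn (p \o u).

Lemma cauchy_norm_ge0 u : 0 <= cauchy_norm u.
Proof.
apply: limr_ge; first exact: cauchy_seq_cvg.
by apply: nearW => i; exact: seminorm_ge0.
Qed.

Lemma cauchy_normD u v : cauchy_norm (u + v) <= cauchy_norm u + cauchy_norm v.
Proof.
rewrite /cauchy_norm -limD; [|exact: cauchy_seq_cvg|exact: cauchy_seq_cvg].
apply: ler_lim; first exact: cauchy_seq_cvg.
  by apply: is_cvgD; exact: cauchy_seq_cvg.
by apply: nearW => i; exact: seminormD.
Qed.

Lemma cauchy_normZ (a : K) u : cauchy_norm (a *: u) = rnorm (a : K^o) * cauchy_norm u.
Proof.
rewrite /cauchy_norm (_ : p \o (a *: u) = (fun i => rnorm (a : K^o) * (p \o u) i)).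
  by apply: cvg_lim => //; apply: cvgMr; exact: cauchy_seq_cvg.
by apply/funext => i; rewrite /= -seminormZ.
Qed.

Lemma cauchy_norm0 : cauchy_norm 0 = 0.
Proof. by rewrite -(scale0r 0) cauchy_normZ (@rnorm0 _ _ K^o) mul0r. Qed.

Lemma cauchy_normN u : cauchy_norm (- u) = cauchy_norm u.
Proof. by rewrite -scaleN1r cauchy_normZ (@rnormN _ _ K^o) rnorm1 mul1r. Qed.

Definition null_pred : {pred cauchy_seq} := fun u => cauchy_norm u == 0.

Fact null_zmod : zmod_closed null_pred.
Proof.
split=> [|u v /eqP u0 /eqP v0]; apply/eqP; first exact: cauchy_norm0.
apply/eqP; rewrite eq_le cauchy_norm_ge0 andbT.
by rewrite (le_trans (cauchy_normD _ _))// cauchy_normN u0 v0 addr0.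
Qed.
HB.instance Definition _ := GRing.isZmodClosed.Build cauchy_seq null_pred null_zmod.

Definition completion : Type := Quotient.quot null_pred.
HB.instance Definition _ := GRing.Zmodule.on completion.
HB.instance Definition _ := EqQuotient.on completion.

Local Open Scope quotient_scope.

Lemma completion_eq u v :
  (\pi_completion u = \pi_completion v :> completion) <-> cauchy_norm (u - v) = 0.
Proof.
split=> [/eqmodP|uv]; first by rewrite /= => /eqP.
by apply/eqmodP/eqP.
Qed.

Lemma completionD u v :
  \pi_completion (u + v) = \pi_completion u + \pi_completion v :> completion.
Proof. exact: Quotient.pi_add. Qed.

Lemma completionB u v :
  \pi_completion (u - v) = \pi_completion u - \pi_completion v :> completion.
Proof. by rewrite completionD; congr (_ + _); exact: Quotient.pi_opp. Qed.

Lemma completion0 : \pi_completion 0 = 0 :> completion.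
Proof. by rewrite -(subrr 0) completionB subrr. Qed.

Definition completion_scale (a : K) (x : completion) : completion :=
  \pi_completion (a *: repr x).

Lemma cauchy_norm_repr u : cauchy_norm (repr (\pi_completion u) - u) = 0.
Proof. by apply/completion_eq; rewrite reprK. Qed.

Lemma completion_scaleE a u :
  completion_scale a (\pi_completion u) = \pi_completion (a *: u).
Proof.
by apply/completion_eq; rewrite -scalerBr cauchy_normZ cauchy_norm_repr mulr0.
Qed.

Fact completion_scaleA a b (x : completion) :
  completion_scale a (completion_scale b x) = completion_scale (a * b) x.
Proof. by rewrite -[x]reprK (completion_scaleE b) !completion_scaleE scalerA. Qed.

Fact completion_scale1 : left_id 1 completion_scale.
Proof. by move=> x; rewrite -[x]reprK !completion_scaleE scale1r. Qed.

Fact completion_scaleDr : right_distributive completion_scale +%R.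
Proof.
move=> a x y; rewrite -[x]reprK -[y]reprK -completionD !completion_scaleE.
by rewrite -completionD scalerDr.
Qed.

Fact completion_scaleDl (x : completion) :
  {morph completion_scale^~ x : a b / a + b}.
Proof.
by move=> a b; rewrite -[x]reprK !completion_scaleE -completionD scalerDl.
Qed.

HB.instance Definition _ := GRing.Zmodule_isLmodule.Build K completion
  completion_scaleA completion_scale1 completion_scaleDr completion_scaleDl.

Definition completion_rnorm (x : completion) : R := cauchy_norm (repr x).

Lemma completion_rnormE u : completion_rnorm (\pi_completion u) = cauchy_norm u.
Proof.
have h v w : cauchy_norm (v - w) = 0 -> cauchy_norm v <= cauchy_norm w.
  move=> vw; rewrite -{1}(subrK w v) (le_trans (cauchy_normD _ _))//.
  by rewrite vw add0r.
apply/eqP; rewrite eq_le !h//; last exact: cauchy_norm_repr.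
by rewrite -opprB cauchy_normN cauchy_norm_repr.
Qed.

Definition completion_norm (x : completion) : K := of_real k (completion_rnorm x).

Fact completion_normD x y :
  completion_norm (x + y) <= completion_norm x + completion_norm y.
Proof.
rewrite -of_realD of_real_le -[x]reprK -[y]reprK -completionD !completion_rnormE.
exact: cauchy_normD.
Qed.

Fact completion_normZ (a : K) x :
  completion_norm (a *: x) = `|a| * completion_norm x.
Proof.
rewrite /completion_norm -[`|a|]/(`|a : K^o|) -rnormE -of_realM; congr of_real.
by rewrite completion_rnormE cauchy_normZ.
Qed.

Fact completion_norm0_eq0 x : completion_norm x = 0 -> x = 0.
Proof.
move=> /(congr1 (@re_part R k)); rewrite -(of_real0 R k) !of_realK => x0.
by rewrite -completion0 -[x]reprK; apply/completion_eq; rewrite subr0.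
Qed.

HB.instance Definition _ := Lmodule_isNormed.Build K completion
  completion_normD completion_normZ completion_norm0_eq0.

Lemma rnorm_completionE (x : completion) : rnorm x = completion_rnorm x.
Proof. exact: of_realK. Qed.

Fact cst_cauchy (x : V) : (fun=> x) \in cauchy_pred.
Proof.
by apply/asboolP => eps e0; exists 0%N => i j _ _; rewrite subrr seminorm0 ltW.
Qed.

Definition completion_emb (x : V) : completion :=
  \pi_completion (CauchySeq (cst_cauchy x)).

Fact completion_emb_linear : linear completion_emb.
Proof.
move=> a x y; apply: esym.
rewrite -[LHS]/(completion_scale a (completion_emb x) + completion_emb y).
rewrite /completion_emb completion_scaleE -completionD.
by congr (\pi_completion _); exact/val_inj.
Qed.
HB.instance Definition _ :=
  GRing.isLinear.Build K V completion *:%R completion_emb completion_emb_linear.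

Lemma rnorm_completion_emb x : rnorm (completion_emb x) = p x.
Proof.
rewrite rnorm_completionE completion_rnormE /cauchy_norm.
by rewrite (_ : p \o _ = fun=> p x) ?lim_cst.
Qed.

(* A class is the limit of its representatives. *)
Lemma completion_emb_dist u (eps : R) (N : nat) :
  (forall i, (N <= i)%N -> p (u i - u N) <= eps) ->
  rnorm (\pi_completion u - completion_emb (u N)) <= eps.
Proof.
move=> uN; rewrite /completion_emb -completionB rnorm_completionE completion_rnormE.
apply: limr_le; first exact: cauchy_seq_cvg.
by exists N => // i /= Ni; exact: uN.
Qed.

Lemma completion_emb_dense x (eps : R) : 0 < eps ->
  exists y, rnorm (x - completion_emb y) <= eps.
Proof.
move=> e0; have [N uN] := cauchy_seqP (repr x) e0.
exists (repr x N); rewrite -{1}[x]reprK; apply: completion_emb_dist => i Ni.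
exact: uN.
Qed.

Fact completion_complete (FF : set_system completion) :
  ProperFilter FF -> cauchy FF -> cvg FF.
Proof.
move=> FFp /cauchyP Fc.
pose r i : R := i.+1%:R^-1.
have r0 i : 0 < r i by rewrite invr_gt0.
have Fx i : exists x, FF [set y | rnorm (x - y) <= r i].
  have [|x Fx] := Fc (of_real k (r i)); first by rewrite -(of_real0 R k) of_real_lt.
  exists x; apply: filterS Fx => y; rewrite -ball_normE/= -rnormE of_real_lt.
  exact: ltW.
have [x xP] := choice Fx.
have [v vP] := choice (fun i => completion_emb_dense (x i) (r0 i)).
have xx i j : rnorm (x i - x j) <= r i + r j.
  have [z [/= xz yz]] := filter_ex (filterI (xP i) (xP j)).
  rewrite -(subrK z (x i)) -addrA (le_trans (rnormD _ _))// lerD//.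
  by rewrite -opprB rnormN.
have vv i j : p (v i - v j) <= r i + (r i + r j) + r j.
  rewrite -rnorm_completion_emb linearB.
  have -> : completion_emb (v i) - completion_emb (v j) =
      - (x i - completion_emb (v i)) + (x i - x j) + (x j - completion_emb (v j)).
    by rewrite opprB !addrA !subrK.
  rewrite (le_trans (rnormD _ _))//; apply: lerD => //.
  by rewrite (le_trans (rnormD _ _))// rnormN; apply: lerD.
have rsmall (eps : R) : 0 < eps -> exists N, forall i, (N <= i)%N -> r i <= eps.
  move=> e0; have /cvgrPdist_le/(_ _ e0)[N _ rN] := @cvg_harmonic R.
  exists N => i /rN; rewrite sub0r normrN; apply: le_trans; exact: ler_norm.
have vC : v \in cauchy_pred.
  apply/asboolP => eps e0.
  have [N rN] := rsmall (eps / 4) (divr_gt0 e0 (ltr0Sn R 3)).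
  exists N => i j /rN ri /rN rj; apply: le_trans (vv i j) _; lra.
pose w := CauchySeq vC.
apply/cvg_ex; exists (\pi_completion w); apply/cvgrPdist_le => _ /posnumP[eps].
have e0 : 0 < re_part eps%:num.
  by rewrite -(of_real_lt k) of_real0 re_partK.
have [N rN] := rsmall (re_part eps%:num / 8) (divr_gt0 e0 (ltr0Sn R 7)).
apply: filterS (xP N) => y /= xy.
rewrite -rnormE -(re_partK (ltW (gt0 eps))) of_real_le.
have wN : rnorm (\pi_completion w - completion_emb (w N)) <= re_part eps%:num / 2.
  apply: completion_emb_dist => i Ni; apply: le_trans (vv i N) _.
  by have := rN i Ni; have := rN N (leqnn N); lra.
have -> : \pi_completion w - y = (\pi_completion w - completion_emb (w N))
    - (x N - completion_emb (w N)) + (x N - y).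
  by rewrite opprB !addrA !subrK.
rewrite (le_trans (rnormD _ _))// (le_trans (lerD (rnormD _ _) xy))// rnormN.
by have := vP N; have := rN N (leqnn N); move: wN => /=; lra.
Qed.
HB.instance Definition _ := Uniform_isComplete.Build completion completion_complete.

Lemma seminorm_completion_exists : exists (X : completeNormedModType K)
    (j : {linear V -> X}),
  (forall x, rnorm (j x) = p x) /\ closure (range j) = [set: X].
Proof.
exists completion, completion_emb; split; first exact: rnorm_completion_emb.
apply/seteqP; split=> // x _ U /nbhs_normP[_ /posnumP[eps] epsU].
have e0 : 0 < re_part eps%:num / 2.
  by rewrite divr_gt0// -(of_real_lt k) of_real0 re_partK.
have [y xy] := completion_emb_dense x e0.
exists (completion_emb y); split; first by exists y.
apply: epsU => /=; rewrite -rnormE -(re_partK (ltW (gt0 eps))) of_real_lt.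
by apply: le_lt_trans xy _; move: e0; lra.
Qed.

End SeminormCompletion.

Section ProjectiveExistence.
Variables (R : realType) (k : ground).
Local Notation K := (scalars R k).
Variables (I : finType) (G : I -> normedModType K) (i0 : I).
Local Notation T := (forall i, G i).
Local Notation multilin := (@multilinear R k I (fun i => G i)).
Local Open Scope quotient_scope.

Let scale1 (a : K) (x : T) : T := dfwith x i0 (a *: x i0).

Lemma dfwith_id (x : T) : dfwith x i0 (x i0) = x.
Proof. by apply/functional_extensionality_dep => j; case: dfwithP. Qed.

Lemma multilinear_scale1 (W : lmodType K) (B : T -> W) : multilin B ->
  forall a x, B (scale1 a x) = a *: B x.
Proof.
move=> Bm a x.
have B0 : B (dfwith x i0 0) = 0.
  have := Bm x i0 1 0 0; rewrite scaler0 addr0 scale1r => h.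
  by apply: (@addrI _ (B (dfwith x i0 0))); rewrite -h addr0.
by have := Bm x i0 a (x i0) 0; rewrite addr0 B0 addr0 dfwith_id.
Qed.

Definition formal_sum : Type := seq T.
HB.instance Definition _ := gen_eqMixin formal_sum.
HB.instance Definition _ := gen_choiceMixin formal_sum.

Definition same_tensorb (s s' : formal_sum) : bool := `[< same_tensor s s' >].

Fact same_tensorb_equiv : equiv_class_of same_tensorb.
Proof.
split=> [s|s s'|s s' s'']; first exact/asboolP.
  by apply/asboolP/asboolP => h W B Bm; rewrite h.
by move=> /asboolP h /asboolP h'; apply/asboolP => W B Bm; rewrite h// h'.
Qed.
Canonical same_tensor_equiv := EquivRelPack same_tensorb_equiv.
Canonical same_tensor_encModRel := defaultEncModRel same_tensorb.

Definition algebraic_tensor := {eq_quot same_tensorb}.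
HB.instance Definition _ := Choice.on algebraic_tensor.
HB.instance Definition _ := EqQuotient.on algebraic_tensor.

Definition tensor_eval (W : lmodType K) (B : T -> W) (z : algebraic_tensor) : W :=
  \sum_(x <- (repr z : seq T)) B x.

Lemma tensor_evalE (W : lmodType K) (B : T -> W) (s : formal_sum) : multilin B ->
  tensor_eval B (\pi_algebraic_tensor s) = \sum_(x <- (s : seq T)) B x.
Proof.
move=> Bm; have /eqmodP/asboolP h :
  \pi_algebraic_tensor (repr (\pi_algebraic_tensor s)) = \pi_algebraic_tensor s.
  by rewrite reprK.
exact: h.
Qed.

Lemma tensor_ext (y z : algebraic_tensor) :
  (forall (W : lmodType K) (B : T -> W), multilin B ->
    tensor_eval B y = tensor_eval B z) -> y = z.
Proof.
by move=> h; rewrite -[y]reprK -[z]reprK; apply/eqmodP/asboolP => W B /h.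
Qed.

Definition tensor_zero : algebraic_tensor := \pi_algebraic_tensor ([::] : formal_sum).
Definition tensor_add (y z : algebraic_tensor) : algebraic_tensor :=
  \pi_algebraic_tensor ((repr y : seq T) ++ (repr z : seq T) : formal_sum).
Definition tensor_scale (a : K) (z : algebraic_tensor) : algebraic_tensor :=
  \pi_algebraic_tensor (map (scale1 a) (repr z : seq T) : formal_sum).

Lemma tensor_eval0 (W : lmodType K) (B : T -> W) : multilin B ->
  tensor_eval B tensor_zero = 0.
Proof. by move=> Bm; rewrite tensor_evalE// big_nil. Qed.

Lemma tensor_evalD (W : lmodType K) (B : T -> W) y z : multilin B ->
  tensor_eval B (tensor_add y z) = tensor_eval B y + tensor_eval B z.
Proof. by move=> Bm; rewrite tensor_evalE// big_cat. Qed.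

Lemma tensor_evalZ (W : lmodType K) (B : T -> W) a z : multilin B ->
  tensor_eval B (tensor_scale a z) = a *: tensor_eval B z.
Proof.
move=> Bm; rewrite tensor_evalE// big_map scaler_sumr.
by apply: eq_bigr => x _; rewrite multilinear_scale1.
Qed.

Fact tensor_addA : associative tensor_add.
Proof. by move=> x y z; apply: tensor_ext => W B Bm; rewrite !tensor_evalD// addrA. Qed.
Fact tensor_addC : commutative tensor_add.
Proof. by move=> x y; apply: tensor_ext => W B Bm; rewrite !tensor_evalD// addrC. Qed.
Fact tensor_add0 : left_id tensor_zero tensor_add.
Proof.
by move=> x; apply: tensor_ext => W B Bm; rewrite !tensor_evalD// tensor_eval0// add0r.
Qed.
Fact tensor_addN : left_inverse tensor_zero (tensor_scale (-1)) tensor_add.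
Proof.
move=> x; apply: tensor_ext => W B Bm.
by rewrite tensor_evalD// tensor_evalZ// tensor_eval0// scaleN1r addNr.
Qed.
HB.instance Definition _ := GRing.isZmodule.Build algebraic_tensor
  tensor_addA tensor_addC tensor_add0 tensor_addN.

Fact tensor_scaleA a b z : tensor_scale a (tensor_scale b z) = tensor_scale (a * b) z.
Proof. by apply: tensor_ext => W B Bm; rewrite !tensor_evalZ// scalerA. Qed.
Fact tensor_scale1 : left_id 1 tensor_scale.
Proof. by move=> z; apply: tensor_ext => W B Bm; rewrite tensor_evalZ// scale1r. Qed.
Fact tensor_scaleDr : right_distributive tensor_scale +%R.
Proof.
move=> a y z; apply: tensor_ext => W B Bm.
by rewrite tensor_evalZ// !tensor_evalD// !tensor_evalZ// scalerDr.
Qed.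
Fact tensor_scaleDl z : {morph tensor_scale^~ z : a b / a + b}.
Proof.
move=> a b; apply: tensor_ext => W B Bm.
by rewrite tensor_evalZ// tensor_evalD// !tensor_evalZ// scalerDl.
Qed.
HB.instance Definition _ := GRing.Zmodule_isLmodule.Build K algebraic_tensor
  tensor_scaleA tensor_scale1 tensor_scaleDr tensor_scaleDl.

Definition pure (x : T) : algebraic_tensor := \pi_algebraic_tensor ([:: x] : formal_sum).

Lemma tensor_eval_pure (W : lmodType K) (B : T -> W) x : multilin B ->
  tensor_eval B (pure x) = B x.
Proof. by move=> Bm; rewrite tensor_evalE// big_seq1. Qed.

Lemma pure_multilinear : multilin pure.
Proof.
move=> x i a u v; apply: tensor_ext => W B Bm.
by rewrite tensor_evalD// tensor_evalZ// !tensor_eval_pure// Bm.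
Qed.

Lemma sum_pure (s : formal_sum) :
  \sum_(x <- (s : seq T)) pure x = \pi_algebraic_tensor s.
Proof.
apply: tensor_ext => W B Bm; rewrite tensor_evalE//.
elim: (s : seq T) => [|x s' IH]; first by rewrite !big_nil tensor_eval0.
by rewrite !big_cons tensor_evalD// tensor_eval_pure// IH.
Qed.

Definition tensor_norm (z : algebraic_tensor) : R := projective_norm (repr z).

Let cost (s : seq T) : R := \sum_(x <- s) \prod_i rnorm (x i).

Lemma cost_ge0 s : 0 <= cost s.
Proof. by apply: sumr_ge0 => x _; apply: prodr_ge0 => i _; exact: rnorm_ge0. Qed.

Lemma projective_norm_le (s s' : seq T) : same_tensor s s' -> projective_norm s <= cost s'.
Proof.
move=> ss'; apply: ge_inf; last by exists s'.
by exists 0 => _ [s'' _ <-]; exact: cost_ge0.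
Qed.

Lemma le_projective_norm (s : seq T) (r : R) :
  (forall s', same_tensor s s' -> r <= cost s') -> r <= projective_norm s.
Proof.
move=> h; apply: lb_le_inf; first by exists (cost s), s.
by move=> _ [s' /h + <-].
Qed.

Lemma tensor_normE (s : formal_sum) :
  tensor_norm (\pi_algebraic_tensor s) = projective_norm (s : seq T).
Proof.
have h (W : lmodType K) (B : T -> W) (Bm : multilin B) := tensor_evalE s Bm.
apply/eqP; rewrite eq_le; apply/andP; split; apply: le_projective_norm => s' ss';
  apply: projective_norm_le => W B Bm.
- by rewrite -(ss' W B Bm); exact: h.
- by rewrite -(ss' W B Bm); apply: esym; exact: h.
Qed.

Fact tensor_normD y z : tensor_norm (y + z) <= tensor_norm y + tensor_norm z.
Proof.
rewrite -lerBlDr; apply: le_projective_norm => s ys.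
rewrite lerBlDr -lerBlDl; apply: le_projective_norm => s' zs.
rewrite lerBlDl -[leRHS]big_cat -[y + z]/(tensor_add y z) tensor_normE.
apply: projective_norm_le => W B Bm.
by rewrite !big_cat/= (ys W B Bm) (zs W B Bm).
Qed.

Fact tensor_normZ_le (a : K) z : tensor_norm (a *: z) <= rnorm (a : K^o) * tensor_norm z.
Proof.
rewrite -[a *: z]/(tensor_scale a z) tensor_normE.
have le_cost s' : same_tensor (repr z : seq T) s' ->
    projective_norm (map (scale1 a) (repr z : seq T)) <= rnorm (a : K^o) * cost s'.
  move=> zs; have -> : rnorm (a : K^o) * cost s' = cost (map (scale1 a) s').
    rewrite /cost big_map mulr_sumr; apply: eq_bigr => x _.
    rewrite (bigD1 i0)//= [in RHS](bigD1 i0)//= mulrA -rnormZ; congr (_ * _).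
      by rewrite /scale1 dfwithin.
    by apply: eq_bigr => i ii0; rewrite /scale1 dfwithout// eq_sym.
  apply: projective_norm_le => W B Bm; rewrite !big_map.
  under eq_bigr do rewrite multilinear_scale1//.
  under [RHS]eq_bigr do rewrite multilinear_scale1//.
  by rewrite -!scaler_sumr (zs W B Bm).
have [a0|a0] := eqVneq (rnorm (a : K^o)) 0.
  by have := le_cost _ (fun W B Bm => erefl); rewrite a0 !mul0r.
have {}a0 : 0 < rnorm (a : K^o) by rewrite lt_neqAle rnorm_ge0 eq_sym andbT.
rewrite mulrC -ler_pdivrMr//; apply: le_projective_norm => s' zs.
by rewrite ler_pdivrMr// mulrC; exact: le_cost.
Qed.

Lemma projective_completion_exists :
  exists (X : completeNormedModType K) (t : T -> X), projective_completion t.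
Proof.
have [X [j [jp jd]]] :=
  seminorm_completion_exists (Seminorm tensor_normD tensor_normZ_le).
have jE s : \sum_(x <- s) j (pure x) = j (\pi_algebraic_tensor (s : formal_sum)).
  by rewrite -sum_pure linear_sum.
exists X, (j \o pure); split.
- by move=> x i a u v /=; rewrite pure_multilinear linearP.
- by move=> s; rewrite jE jp /= tensor_normE.
- rewrite -jd; congr closure; apply/seteqP; split => [_ [s _ <-]|_ [z _ <-]].
    by rewrite jE; exists (\pi_algebraic_tensor (s : formal_sum)).
  by exists (repr z : seq T) => //; rewrite jE reprK.
Qed.
End ProjectiveExistence.

(* The factors [E_1', ..., E_n', F], the last one having index [None]. *)
Definition dual_factors (R : realType) (k : ground) (n : nat)
    (E : 'I_n -> normedModType (scalars R k)) (F : normedModType (scalars R k))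
    (o : option 'I_n) : normedModType (scalars R k) :=
  if o is Some i then dual (E i) else F.

Definition dual_tuple (R : realType) (k : ground) (n : nat)
    (E : 'I_n -> normedModType (scalars R k)) (F : normedModType (scalars R k))
    (x' : forall i, dual (E i)) (f : F) : forall o, dual_factors E F o :=
  fun o => match o with Some i => x' i | None => f end.

Section Nuclear.
Variables (R : realType) (k : ground).
Local Notation K := (scalars R k).
Variables (n : nat) (E : 'I_n -> normedModType K) (F : normedModType K).
Implicit Type T : (forall i, E i) -> F.

Definition nuclear_representation T (lambda : nat -> K)
    (x' : nat -> forall i, dual (E i)) (f : nat -> F) (s : R) : Prop :=
  (series (fun j => rnorm (lambda j : K^o) * (\prod_i rnorm (x' j i))
                    * rnorm (f j)) @ \oo --> s) /\
  forall x, series (fun j => lambda j *: rank_one (x' j) (f j) x) @ \oo --> T x.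

Definition nuclear : set ((forall i, E i) -> F) :=
  [set T | multilinear_operators T /\
           exists lambda x' f s, nuclear_representation T lambda x' f s].

Definition nuclear_norm T : R :=
  inf [set s | exists lambda x' f, nuclear_representation T lambda x' f s].
End Nuclear.
Arguments nuclear {R k n} E F _.
Arguments nuclear_norm {R k n} E F _.

Section VectorMeasure.
Variables (R : realType) (k : ground).
Local Notation K := (scalars R k).
Variables (Omega : topologicalType) (V : normedModType K).
Implicit Types (A : set Omega) (mu : set Omega -> V).

Definition borel : set (set Omega) := <<s (open : set (set Omega)) >>.

(* Only the values of [mu] on Borel sets matter. *)
Definition vector_measure mu : Prop :=
  forall A : nat -> set Omega, (forall j, borel (A j)) -> trivIset setT A ->
    series (mu \o A) @ \oo --> mu (\bigcup_j A j).

Definition variation mu A : \bar R :=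
  ereal_sup [set z | exists (m : nat) (B : 'I_m -> set Omega),
    [/\ forall j, borel (B j), trivIset setT B, \bigcup_j B j = A &
        z = (\sum_j rnorm (mu (B j)))%:E]].

Definition bounded_variation mu : Prop := (variation mu setT < +oo)%E.

Definition total_variation mu : R := fine (variation mu setT).

(* The variation of a measure of bounded variation is a finite positive measure;
   regularity of [mu] is that of its variation. *)
Definition regular mu : Prop :=
  forall A (eps : R), borel A -> 0 < eps ->
    exists C U : set Omega, [/\ compact C, open U, C `<=` A, A `<=` U &
      (variation mu (U `\` C) < eps%:E)%E].

Record simple_function := SimpleFunction {
  simple_size : nat;
  simple_coef : 'I_simple_size -> K;
  simple_set : 'I_simple_size -> set Omega;
  simple_borel : forall j, borel (simple_set j) }.

Definition simple_eval (s : simple_function) (w : Omega) : K :=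
  \sum_(j < simple_size s) simple_coef j * (w \in simple_set j)%:R.

Definition simple_integral mu (s : simple_function) : V :=
  \sum_(j < simple_size s) simple_coef j *: mu (simple_set j).

(* [y] is the integral of the bounded function [phi], i.e. the limit of the
   integrals of simple functions converging uniformly to [phi]. *)
Definition is_integral mu (phi : Omega -> K) (y : V) : Prop :=
  exists s : nat -> simple_function,
    (forall eps : R, 0 < eps -> \forall j \near \oo,
       forall w, rnorm (phi w - simple_eval (s j) w : K^o) <= eps) /\
    (fun j => simple_integral mu (s j)) @ \oo --> y.
End VectorMeasure.

Section Integral.
Variables (R : realType) (k : ground).
Local Notation K := (scalars R k).

Definition dual_ball (E : normedModType K) : set (dual E) :=
  [set x' | rnorm x' <= 1].

Definition eval_ball (E : normedModType K) (x' : set_type (@dual_ball E)) :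
  prod_topology (fun _ : E => K^o) := fun x => (val x' : dual E) x.

(* The closed unit ball of [E'] with the weak-star topology. *)
Definition weak_star_ball (E : normedModType K) : topologicalType :=
  initial_topology (@eval_ball E).

Variables (n : nat) (E : 'I_n -> normedModType K) (F : normedModType K).
Implicit Type T : (forall i, E i) -> F.

Definition ball_product : topologicalType :=
  prod_topology (fun i => weak_star_ball (E i)).

Definition eval_product (x : forall i, E i) (w : ball_product) : K :=
  \prod_(i < n) eval_ball (w i) (x i).

Definition represents (V : normedModType K) (mu : set ball_product -> V)
    (T : (forall i, E i) -> V) : Prop :=
  [/\ vector_measure mu, bounded_variation mu, regular mu &
      forall x, is_integral mu (eval_product x) (T x)].

Definition pietsch_integral : set ((forall i, E i) -> F) :=
  [set T | multilinear_operators T /\ exists mu, represents mu T].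

Definition pietsch_norm T : R :=
  inf [set total_variation mu | mu in [set mu | represents mu T]].

Definition grothendieck_integral : set ((forall i, E i) -> F) :=
  [set T | multilinear_operators T /\
           exists mu, represents mu (@bidual_emb R k F \o T)].

Definition grothendieck_norm T : R :=
  inf [set total_variation mu |
        mu in [set mu | represents mu (@bidual_emb R k F \o T)]].
End Integral.
Arguments pietsch_integral {R k n} E F _.
Arguments pietsch_norm {R k n} E F _.
Arguments grothendieck_integral {R k n} E F _.
Arguments grothendieck_norm {R k n} E F _.

(* The monomials e'_{j_1}(.) ... e'_{j_n}(.) f_l, where (j_1, ..., j_n, l) runs
   through [N^(n+1)] in the square ordering. *)
Definition square_monomials (R : realType) (k : ground) (n : nat)
    (E : 'I_n -> normedModType (scalars R k)) (F : normedModType (scalars R k))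
    (e' : forall i, nat -> dual (E i)) (f : nat -> F) (j : nat) :
    (forall i, E i) -> F :=
  rank_one (fun i : 'I_n => e' i (nth 0%N (square_enum n.+1 j) i))
           (f (nth 0%N (square_enum n.+1 j) n)).

(* Main.v *)
Require Import Defs.
From HB Require Import structures.
From mathcomp Require Import all_boot all_order all_algebra.
From mathcomp Require Import all_classical all_reals all_analysis.
From mathcomp Require Import complex ring lra zify.
Import Order.TTheory GRing.Theory Num.Theory numFieldNormedType.Exports.
Local Open Scope classical_set_scope.
Local Open Scope ring_scope.

Set Implicit Arguments.
Unset Strict Implicit.
Unset Printing Implicit Defensive.

(** The three ideals are identified with the completed tensor product [X] of
    E_1', ..., E_n' and F through one linear map [J], which sends the elementary
    tensor of x_1', ..., x_n', f to x_1'(.) ... x_n'(.) f.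

    In one direction, every [u] in [X] is a series of elementary tensors of total
    cost at most [rnorm u + eps] ([projective_series]), so [J u] is nuclear with
    norm at most [rnorm u].  Normalising the functionals turns a nuclear
    representation into a discrete measure on the product of the dual balls
    ([nuclear_measure]), and an F-valued measure is also F''-valued
    ([pietsch_grothendieck]).  Hence nuclear operators are Pietsch integral, Pietsch
    integral operators are Grothendieck integral, and the norms decrease.

    The point is to close the cycle: if S is represented by an F''-valued measure mu,
    then S = J u for some u with norm at most the variation of mu
    ([grothendieck_tensor]).  Shrinking means that the partial sum operators P_m of
    the basis e'_i of E_i' converge pointwise in norm.  Put

      u_m = sum over a_1, ..., a_n < m of
              e'_{1,a_1} (x) ... (x) e'_{n,a_n} (x) S(e_{1,a_1}, ..., e_{n,a_n}).

    Inserting the integral for S, u_m is formally the integral of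
    P_m x_1' (x) ... (x) P_m x_n' against mu.  As in Egorov's theorem, the points at
    which P_l x_i' is close to x_i' for all l >= M fill the product of the balls up to
    a set of small variation.  So, for large m and l, both u_m and u_l are close to one
    Riemann sum sum_i x'(w_i) (x) mu(A_i), which has norm at most the variation of mu
    ([section_sum_estimate]).  Thus (u_m) is Cauchy, with limit of norm at most the
    variation of mu.  The measure has values in F'', while
    u_m is built over F; the estimates are therefore tested on functionals of [X],
    each of which extends, without increase of norm, to a form on
    E_1' x ... x E_n' x F'' ([norming_functional], [bidual_form]).  Applied to
    S = J u, the same sums converge to u, so that [J] is injective
    ([tensor_operator_inj]) and the three norms of J u agree with [rnorm u].

    For the basis, an initial segment of the square ordering of N^(d+1) is a signed
    sum of 3^d boxes ([seq_rank_boxes]).  A partial sum operator of the tensor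
    monomials is thus a signed sum of 3^d tensor products of partial sum operators of
    the given bases.  The latter are uniformly bounded by the Banach-Steinhaus type
    theorem [expansion_bounded], hence so are the former, and the tensor monomials
    form a basis of [X] ([tensor_monomial_basis]) that [J] carries to the operators. *)

(** * Convergence in the real-valued norm *)
Section Convergence.
Variables (R : realType) (k : ground).
Local Notation K := (scalars R k).
Implicit Types V W : normedModType K.

Lemma cvgr0P (r : nat -> R) : (forall m, 0 <= r m) ->
  (r @ \oo --> (0 : R)) <->
  forall eps : R, 0 < eps -> exists N, forall m, (N <= m)%N -> r m <= eps.
Proof.
move=> r0; split=> [/cvgrPdist_le rc eps e0|rc].
  have [N _ rN] := rc _ e0; exists N => m Nm.
  by have := rN m Nm; rewrite /= sub0r normrN ger0_norm.
apply/cvgrPdist_le => eps e0; have [N rN] := rc _ e0; exists N => // m /= Nm.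
by rewrite sub0r normrN ger0_norm ?rN.
Qed.

(** The library convergence is stated with balls of radius in the scalars; this form has
    real radii, so that estimates can be left to linear arithmetic. *)
Definition tends V (u : nat -> V) (l : V) : Prop :=
  forall eps : R, 0 < eps -> exists N, forall m, (N <= m)%N -> rnorm (u m - l) <= eps.

Lemma rnormBC V (x y : V) : rnorm (x - y) = rnorm (y - x).
Proof. by rewrite -opprB rnormN. Qed.

Lemma tendsP V (u : nat -> V) (l : V) : (u @ \oo --> l) <-> tends u l.
Proof.
split=> [/cvgrPdist_le uc eps e0|uc].
  have [|N _ uN] := uc (of_real k eps); first by rewrite -(of_real0 R k) of_real_lt.
  exists N => m Nm; have := uN m Nm => /=.
  by rewrite -rnormE of_real_le rnormBC.
apply/cvgrPdist_le => eps e0.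
have e1 : 0 < re_part eps by rewrite -(of_real_lt k) of_real0 re_partK// ltW.
have [N uN] := uc _ e1; exists N => // m /= Nm.
by rewrite -rnormE -(re_partK (ltW e0)) of_real_le rnormBC uN.
Qed.

Lemma tends_rnorm V (u : nat -> V) (l : V) :
  ((fun m => rnorm (l - u m)) @ \oo --> (0 : R)) <-> tends u l.
Proof.
split=> [/cvgr0P uc eps e0|uc].
  have [N uN] := uc (fun m => rnorm_ge0 _) _ e0; exists N => m Nm.
  by rewrite rnormBC uN.
apply/cvgr0P => [m|eps e0]; first exact: rnorm_ge0.
by have [N uN] := uc _ e0; exists N => m Nm; rewrite rnormBC uN.
Qed.

Lemma rnorm_sum V (I : Type) (r : seq I) (P : pred I) (F : I -> V) :
  rnorm (\sum_(i <- r | P i) F i) <= \sum_(i <- r | P i) rnorm (F i).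
Proof.
elim/big_ind2: _ => //=; first by rewrite rnorm0.
by move=> x a y b xa yb; rewrite (le_trans (rnormD _ _))// lerD.
Qed.

Lemma rnorm_dist V (x y z : V) : rnorm (x - z) <= rnorm (x - y) + rnorm (y - z).
Proof. by rewrite -{1}(subrK y x) -addrA rnormD. Qed.

Lemma rnorm_leD V (x y : V) : rnorm x <= rnorm y + rnorm (x - y).
Proof. by rewrite -{1}(subrK y x) addrC (le_trans (rnormD _ _)). Qed.

Lemma rnorm_gt0 V (x : V) : x != 0 -> 0 < rnorm x.
Proof.
move=> x0; rewrite lt_neqAle rnorm_ge0 andbT eq_sym; apply: contra x0.
by move=> /eqP/rnorm_eq0 ->.
Qed.

Lemma rnormM (a b : K) : rnorm (a * b : K^o) = rnorm (a : K^o) * rnorm (b : K^o).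
Proof. exact: (@rnormZ R k K^o a b). Qed.

Lemma rnorm_prod (I : Type) (r : seq I) (P : pred I) (F : I -> K) :
  rnorm (\prod_(i <- r | P i) F i : K^o) = \prod_(i <- r | P i) rnorm (F i : K^o).
Proof.
elim/big_ind2: _ => //=; first exact: rnorm1.
by move=> x a y b <- <-; rewrite rnormM.
Qed.

Lemma rnorm_eps0 V (x : V) : (forall eps : R, 0 < eps -> rnorm x <= eps) -> x = 0.
Proof.
move=> h; apply: rnorm_eq0; apply/eqP; rewrite eq_le rnorm_ge0 andbT.
by apply/ler_addgt0Pr => eps /h; rewrite add0r.
Qed.

Lemma tends_unique V (u : nat -> V) (l l' : V) : tends u l -> tends u l' -> l = l'.
Proof.
move=> ul ul'; apply/eqP; rewrite -subr_eq0; apply/eqP/rnorm_eps0 => eps e0.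
have [N uN] := ul _ (divr_gt0 e0 (ltr0Sn R 1)).
have [M uM] := ul' _ (divr_gt0 e0 (ltr0Sn R 1)).
have := uN (maxn N M) (leq_maxl _ _); have := uM (maxn N M) (leq_maxr _ _).
by have := rnorm_dist l (u (maxn N M)) l'; rewrite (rnormBC l (u _)); lra.
Qed.

Lemma tends_cst V (l : V) : tends (fun=> l) l.
Proof. by move=> eps e0; exists 0%N => m _; rewrite subrr rnorm0 ltW. Qed.

Lemma tendsD V (u v : nat -> V) (l l' : V) :
  tends u l -> tends v l' -> tends (fun m => u m + v m) (l + l').
Proof.
move=> ul vl eps e0.
have [N uN] := ul _ (divr_gt0 e0 (ltr0Sn R 1)).
have [M vM] := vl _ (divr_gt0 e0 (ltr0Sn R 1)).
exists (maxn N M) => m; rewrite geq_max => /andP[/uN um /vM vm].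
by rewrite opprD addrACA (le_trans (rnormD _ _))//; lra.
Qed.

Lemma tends_lipschitz V W (L : V -> W) (c : R) (u : nat -> V) (l : V) :
  (forall x y, rnorm (L x - L y) <= c * rnorm (x - y)) ->
  tends u l -> tends (L \o u) (L l).
Proof.
move=> Lc ul eps e0.
have c0 : 0 < `|c| + 1 by rewrite ltr_wpDl.
have [N uN] := ul _ (divr_gt0 e0 c0).
exists N => m /uN; rewrite ler_pdivlMr// => um.
apply: (le_trans (Lc _ _)); apply: le_trans um; rewrite mulrC.
by rewrite ler_wpM2l ?rnorm_ge0// (le_trans (ler_norm c))// lerDl.
Qed.

Lemma tends_linear V W (L : {linear V -> W}) (c : R) (u : nat -> V) (l : V) :
  (forall x, rnorm (L x) <= c * rnorm x) -> tends u l -> tends (L \o u) (L l).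
Proof. by move=> Lc; apply: (@tends_lipschitz _ _ _ c) => x y; rewrite -linearB. Qed.

Lemma tendsZ V (a : K) (u : nat -> V) (l : V) :
  tends u l -> tends (fun m => a *: u m) (a *: l).
Proof.
apply: (@tends_lipschitz _ _ (fun x => a *: x) (rnorm (a : K^o))) => x y.
by rewrite -scalerBr rnormZ.
Qed.

Lemma tendsB V (u v : nat -> V) (l l' : V) :
  tends u l -> tends v l' -> tends (fun m => u m - v m) (l - l').
Proof.
move=> ul /(tendsZ (-1)); rewrite scaleN1r => vl.
have := tendsD ul vl; congr tends; apply/funext => m; by rewrite scaleN1r.
Qed.

Lemma tends_le V (u : nat -> V) (l : V) (N : nat) (c : R) :
  (forall m, (N <= m)%N -> rnorm (u m) <= c) -> tends u l -> rnorm l <= c.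
Proof.
move=> uc ul; apply/ler_addgt0Pr => eps e0; have [M uM] := ul _ e0.
have := uc (maxn N M) (leq_maxl _ _); have := uM (maxn N M) (leq_maxr _ _).
by rewrite rnormBC; have := rnorm_leD l (u (maxn N M)); lra.
Qed.

Lemma tends_dist V (u v : nat -> V) (l l' : V) (N : nat) (c : R) :
  (forall m, (N <= m)%N -> rnorm (u m - v m) <= c) -> tends u l -> tends v l' ->
  rnorm (l - l') <= c.
Proof. by move=> uc ul vl; apply: (tends_le uc); exact: tendsB. Qed.

Lemma tends_sum V (I : Type) (r : seq I) (u : I -> nat -> V) (l : I -> V) :
  (forall i, tends (u i) (l i)) ->
  tends (fun m => \sum_(i <- r) u i m) (\sum_(i <- r) l i).
Proof.
move=> ul; elim: r => [|i r IH].
  rewrite big_nil (_ : (fun _ => _) = fun=> 0); first exact: tends_cst.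
  by apply/funext => m; rewrite big_nil.
rewrite big_cons (_ : (fun _ => _) = fun m => u i m + \sum_(i <- r) u i m).
  exact: tendsD.
by apply/funext => m; rewrite big_cons.
Qed.

Lemma tends_sub V (u : nat -> V) (l : V) (g : nat -> nat) :
  (forall m, (m <= g m)%N) -> tends u l -> tends (u \o g) l.
Proof.
move=> gm ul eps /ul[N uN]; exists N => m Nm; apply: uN.
exact: leq_trans (gm m).
Qed.

Lemma tends_eventually V (u v : nat -> V) (l : V) (N : nat) :
  (forall m, (N <= m)%N -> u m = v m) -> tends u l -> tends v l.
Proof.
move=> uv ul eps /ul[M uM]; exists (maxn N M) => m; rewrite geq_max => /andP[Nm Mm].
by rewrite -uv// uM.
Qed.

Definition rcauchy V (u : nat -> V) : Prop :=
  forall eps : R, 0 < eps -> exists N, forall i j,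
    (N <= i)%N -> (N <= j)%N -> rnorm (u i - u j) <= eps.

Definition rcomplete V : Prop := forall u : nat -> V, rcauchy u -> exists l, tends u l.

Lemma tends_rcauchy V (u : nat -> V) (l : V) : tends u l -> rcauchy u.
Proof.
move=> ul eps e0; have [N uN] := ul _ (divr_gt0 e0 (ltr0Sn R 1)).
exists N => i j /uN ui /uN uj.
by have := rnorm_dist (u i) l (u j); rewrite (rnormBC l (u j)); lra.
Qed.

Lemma complete_rcomplete (V : completeNormedModType K) : rcomplete V.
Proof.
move=> u uc; have : cvgn u.
  apply: cauchy_cvg; apply: cauchy_exP => eps e0.
  have e1 : 0 < re_part eps / 2.
    by rewrite divr_gt0// -(of_real_lt k) of_real0 re_partK// ltW.
  have [N uN] := uc _ e1; exists (u N); exists N => // i /= Ni.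
  rewrite -ball_normE/= -rnormE -(re_partK (ltW e0)) of_real_lt.
  by apply: le_lt_trans (uN _ _ (leqnn _) Ni) _; move: e1; lra.
by case/cvg_ex => l /tendsP ul; exists l.
Qed.

End Convergence.

(** * Completeness of the scalars and of dual spaces *)
Section ScalarComplete.
Variable R : realType.

Lemma real_cauchy (u : nat -> R) :
  (forall eps : R, 0 < eps -> exists N, forall i j,
    (N <= i)%N -> (N <= j)%N -> `|u i - u j| <= eps) ->
  exists l, forall eps : R, 0 < eps -> exists N, forall m, (N <= m)%N -> `|u m - l| <= eps.
Proof.
move=> uc; have : cvgn u.
  apply: cauchy_cvg; apply: cauchy_exP => eps e0.
  have [N uN] := uc _ (divr_gt0 e0 (ltr0Sn R 1)).
  exists (u N); exists N => // i /= Ni; rewrite -ball_normE/=.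
  by apply: le_lt_trans (uN _ _ (leqnn _) Ni) _; move: e0; lra.
move=> /cvg_ex[l /cvgrPdist_le ul]; exists l => eps e0.
by have [N _ uN] := ul _ e0; exists N => m Nm; rewrite distrC; exact: (uN m Nm).
Qed.

Lemma normc_le (z : R[i]) :
  [/\ `|complex.Re z| <= complex.Re `|z|, `|complex.Im z| <= complex.Re `|z| &
      complex.Re `|z| <= `|complex.Re z| + `|complex.Im z|].
Proof.
case: z => a b /=; split.
- by rewrite -sqrtr_sqr ler_wsqrtr// lerDl sqr_ge0.
- by rewrite -sqrtr_sqr ler_wsqrtr// lerDr sqr_ge0.
- rewrite -[leRHS]ger0_norm ?addr_ge0// -sqrtr_sqr ler_wsqrtr//.
  rewrite sqrrD !real_normK ?num_real// lerD2r lerDl.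
  by rewrite mulrn_wge0// mulr_ge0.
Qed.

Lemma scalars_rcomplete (k : ground) : rcomplete (scalars R k)^o.
Proof.
case: k => u uc; first exact: real_cauchy.
have nB (x y : R[i]) : complex.Re (x - y) = complex.Re x - complex.Re y
    /\ complex.Im (x - y) = complex.Im x - complex.Im y.
  by case: x y => ? ? [].
have [eps|a ua] := @real_cauchy (fun m => complex.Re (u m)).
  move=> /uc[N uN]; exists N => i j Ni Nj.
  have := uN i j Ni Nj; apply: le_trans; have [+ _ _] := normc_le (u i - u j).
  by rewrite (nB _ _).1.
have [eps|b ub] := @real_cauchy (fun m => complex.Im (u m)).
  move=> /uc[N uN]; exists N => i j Ni Nj.
  have := uN i j Ni Nj; apply: le_trans; have [_ + _] := normc_le (u i - u j).
  by rewrite (nB _ _).2.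
exists (a +i* b)%C => eps e0.
have [N uN] := ua _ (divr_gt0 e0 (ltr0Sn R 1)).
have [M uM] := ub _ (divr_gt0 e0 (ltr0Sn R 1)).
exists (maxn N M) => m; rewrite geq_max => /andP[/uN um /uM vm].
have [_ _] := normc_le (u m - (a +i* b)%C).
rewrite (nB _ _).1 (nB _ _).2 => /le_trans; apply.
by move: um vm => /=; lra.
Qed.
End ScalarComplete.

Section DualTools.
Variables (R : realType) (k : ground).
Local Notation K := (scalars R k).

Lemma bounded_dual_pred (V : normedModType K) (f : V -> K^o) (c : R) :
  linear f -> (forall x, rnorm (f x) <= c * rnorm x) -> f \in @dual_pred R k V.
Proof.
move=> fl fc; apply/asboolP; split=> //.
pose h : {linear V -> K^o} := HB.pack f (GRing.isLinear.Build K V K^o *:%R _ fl).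
apply: (@bounded_linear_continuous _ _ _ h); apply/linear_boundedP.
near=> r => x; rewrite -!rnormE.
apply: (@le_trans _ _ (of_real k c * of_real k (rnorm x))).
  by rewrite -of_realM of_real_le; exact: fc.
rewrite ler_wpM2r//; first by rewrite -(of_real0 R k) of_real_le rnorm_ge0.
near: r; apply: nbhs_pinfty_ge.
by case: k {h f fl fc V} => /=; rewrite ?num_real// complex_real.
Unshelve. all: by end_near. Qed.

Lemma rnorm_dual_le (V : normedModType K) (f : dual V) (c : R) : 0 <= c ->
  (forall x, rnorm (f x) <= c * rnorm x) -> rnorm f <= c.
Proof.
move=> c0 fc; rewrite rnorm_dualE; apply: dual_rnorm_le => x x1.
by apply: le_trans (fc x) _; rewrite ler_piMr.
Qed.

Lemma rnorm_dual_apply (V : normedModType K) (f : dual V) x : rnorm (f x) <= rnorm f * rnorm x.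
Proof. by rewrite rnorm_dualE dual_rnorm_op. Qed.

Lemma dualBE (V : normedModType K) (f g : dual V) x : (f - g) x = f x - g x.
Proof. by rewrite -scaleN1r dualDE dualZE scaleN1r. Qed.

Lemma dual_sumE (V : normedModType K) (I : Type) (r : seq I) (P : pred I)
    (f : I -> dual V) x :
  (\sum_(i <- r | P i) f i) x = \sum_(i <- r | P i) f i x.
Proof. by elim/big_ind2: _ => // f1 y f2 z <- <-. Qed.

(** The limit is the pointwise limit: the Cauchy estimate in norm passes to the limit at
    each point of the unit ball with the same constant. *)
Lemma dual_rcomplete (V : normedModType K) : rcomplete (dual V).
Proof.
move=> u uc.
have /choice[f fP] : forall x, exists l : K^o, tends (fun m => u m x : K^o) l.
  move=> x; apply: scalars_rcomplete => eps e0.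
  have x0 : 0 < rnorm x + 1 by rewrite ltr_wpDl// rnorm_ge0.
  have [N uN] := uc _ (divr_gt0 e0 x0); exists N => i j Ni Nj.
  rewrite -dualBE (le_trans (rnorm_dual_apply _ _))//.
  rewrite (@le_trans _ _ (rnorm (u i - u j) * (rnorm x + 1)))//.
    by rewrite ler_wpM2l ?rnorm_ge0// lerDl.
  by rewrite -ler_pdivlMr// uN.
have fl : linear (f : V -> K^o).
  move=> a x y; apply: (tends_unique (fP _)).
  have := tendsD (tendsZ a (fP x)) (fP y); congr tends.
  by apply/funext => m; rewrite linearP.
have fN eps : 0 < eps -> exists N, forall m, (N <= m)%N -> forall x,
    rnorm (u m x - f x : K^o) <= eps * rnorm x.
  move=> e0; have [N uN] := uc _ e0; exists N => m Nm x.
  apply: (@tends_dist _ _ _ (fun=> u m x : K^o) (fun m => u m x : K^o) _ _ N).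
  - move=> i Ni; rewrite -dualBE (le_trans (rnorm_dual_apply _ _))//.
    by rewrite ler_wpM2r ?rnorm_ge0// uN.
  - exact: tends_cst.
  - exact: fP.
have [N uN] := fN 1 ltr01.
have fb x : rnorm (f x) <= (rnorm (u N) + 1) * rnorm x.
  have := uN N (leqnn N) x; have := rnorm_dual_apply (u N) x.
  by have := rnorm_leD (f x) (u N x); rewrite (rnormBC (f x)) mulrDl; lra.
exists (Dual (bounded_dual_pred fl fb)) => eps e0.
have [M uM] := fN _ e0; exists M => m Mm; apply: rnorm_dual_le; first exact: ltW.
by move=> x; rewrite dualBE; exact: uM.
Qed.

End DualTools.

(** * Uniform boundedness of the partial sums of a Schauder basis *)
Section SchauderBound.
Variables (R : realType) (k : ground).
Local Notation K := (scalars R k).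
Implicit Types V : normedModType K.

Lemma inv_succ_le (eps : R) : 0 < eps -> exists N, forall i, (N <= i)%N -> i.+1%:R^-1 <= eps.
Proof.
move=> e0; have /cvgrPdist_le/(_ _ e0)[N _ rN] := @cvg_harmonic R.
exists N => i /rN; rewrite sub0r normrN; apply: le_trans; exact: ler_norm.
Qed.

(** Baire's theorem in the form used for open mappings: when countably many sets cover a
    complete space, one of them is dense in some ball.  Otherwise balls can be shrunk one
    after the other so as to avoid each set, with centres converging to an uncovered point. *)
Lemma baire_ball V (C : nat -> set V) :
  rcomplete V -> (forall v, exists M, C M v) ->
  exists M x (r : R), 0 < r /\ forall y, rnorm (y - x) <= r -> forall d : R, 0 < d ->
    exists2 z, C M z & rnorm (y - z) <= d.
Proof.
move=> Vc CV; apply: contrapT => noball.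
have step (q : nat * (V * R)) : exists q' : V * R, 0 < q.2.2 ->
    [/\ 0 < q'.2, q'.2 <= q.2.2 / 2, rnorm (q'.1 - q.2.1) <= q.2.2 / 2 &
        forall z, C q.1 z -> q'.2 < rnorm (q'.1 - z)].
  case: q => M [x r] /=; have [r0|r0] := boolP (0 < r); last by exists (x, r).
  have r2 : 0 < r / 2 by rewrite divr_gt0.
  have /existsNP[y] : ~ forall y, rnorm (y - x) <= r / 2 -> forall d : R, 0 < d ->
      exists2 z, C M z & rnorm (y - z) <= d.
    by move=> h; apply: noball; exists M, x, (r / 2).
  move=> /not_implyP[yx] /existsNP[d] /not_implyP[d0 dz].
  exists (y, Num.min d (r / 2)) => _ /=; split => //.
  - by rewrite lt_min d0.
  - by rewrite ge_min lexx orbT.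
  - move=> z Cz; rewrite gt_min ltNge; apply/orP; left; apply/negP => yz.
    by apply: dz; exists z.
have [g gP] := choice step.
pose fix q i : V * R := if i is j.+1 then g (j, q j) else (0, 1).
have q0 i : 0 < (q i).2.
  by elim: i => [|i IH] //=; have [] := gP (i, q i) IH.
have qS i := gP (i, q i) (q0 i).
have qle i : (q i).2 <= i.+1%:R^-1.
  elim: i => [|i IH]; first by rewrite invr1.
  have [_ + _ _] := qS i => /le_trans; apply.
  rewrite ler_pdivrMr// (le_trans IH)// mulrC ler_pdivlMr// mulrC.
  rewrite ler_pdivrMr ?ltr0n// -natrM ler_nat.
  by rewrite mul2n -addnn addSn ltnS leq_addl.
have qdist i j : rnorm ((q (i + j)%N).1 - (q i).1) <= (q i).2 - (q (i + j)%N).2.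
  elim: j => [|j IH]; first by rewrite addn0 !subrr rnorm0.
  rewrite addnS; have [_ qa qb _] := qS (i + j)%N.
  have := rnorm_dist (q (i + j).+1).1 (q (i + j)%N).1 (q i).1.
  move: qa qb; rewrite -/(q (i + j).+1); lra.
have qc : rcauchy (fun i => (q i).1).
  move=> eps e0; have [N Ne] := inv_succ_le (divr_gt0 e0 (ltr0Sn R 1)).
  exists N => i j /subnKC<- /subnKC<-.
  have := qdist N (i - N)%N; have := qdist N (j - N)%N.
  have := q0 (N + (i - N))%N; have := q0 (N + (j - N))%N.
  have := le_trans (qle N) (Ne N (leqnn _)).
  have := rnorm_dist (q (N + (i - N))%N).1 (q N).1 (q (N + (j - N))%N).1.
  by rewrite (rnormBC (q N).1 (q (N + (j - N))%N).1); lra.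
have [l ql] := Vc _ qc; have [M lM] := CV l.
have [_ _ _ /(_ l lM)] := qS M.
rewrite -/(q M.+1) => /lt_geF/negP; apply; rewrite rnormBC.
apply: (@tends_dist _ _ _ (fun i => (q i).1) (fun=> (q M.+1).1) _ _ M.+1) => //.
  move=> m Mm; rewrite -(subnKC Mm) (le_trans (qdist _ _))//.
  by rewrite lerBlDr lerDl ltW.
exact: tends_cst.
Qed.

Lemma tends_bounded V (u : nat -> V) l : tends u l ->
  exists M : nat, forall m, rnorm (u m) <= M%:R.
Proof.
move=> ul; have [N uN] := ul 1 ltr01.
pose c := \sum_(m < N) rnorm (u m) + rnorm l + 1.
have s0 : 0 <= \sum_(m < N) rnorm (u m) by rewrite sumr_ge0// => ? _; exact: rnorm_ge0.
exists (Num.bound c) => m; have c0 : 0 <= c by rewrite /c !addr_ge0// rnorm_ge0.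
apply: le_trans (ltW (archi_boundP c0)).
rewrite /c; have [Nm|mN] := leqP N m.
  by have := uN m Nm; have := rnorm_leD (u m) l; lra.
have : rnorm (u m) <= \sum_(m < N) rnorm (u m).
  by rewrite (bigD1 (Ordinal mN))//= lerDl sumr_ge0// => ? _; exact: rnorm_ge0.
by have := rnorm_ge0 l; lra.
Qed.

(** [a j v] is the [j]-th coordinate of [v] in the basis [e].  Its linear dependence on [v] is
    a consequence of uniqueness, and its continuity one of completeness. *)
Definition expansion V (e : nat -> V) (a : nat -> V -> K) : Prop :=
  (forall v, tends (fun m => \sum_(j < m) a j v *: e j) v) /\
  (forall v (b : nat -> K), tends (fun m => \sum_(j < m) b j *: e j) v -> forall j, b j = a j v).

Lemma schauder_basis_expansion V (e : nat -> V) :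
  schauder_basis e <-> exists a, expansion e a.
Proof.
split=> [[_ /(_ _ Logic.I) eb]|[a [aP aU]]].
  have /choice[a aP] v := eb v.
  exists (fun j v => a v j); split=> v.
    by apply/tends_rnorm; exact: (aP v).1.
  move=> b bv j; have -> // : a v = b.
  by apply: (aP v).2; apply/tends_rnorm.
split=> // v _; exists (fun j => a j v); split; first exact/tends_rnorm.
by move=> b /tends_rnorm bv; apply/funext => j; rewrite (aU _ _ bv).
Qed.

Section Expansion.
Variables (V : normedModType K) (e : nat -> V) (a : nat -> V -> K).
Hypothesis ea : expansion e a.

Lemma expansion_linear j : linear (a j : V -> K^o).
Proof.
move=> c v w; apply: esym.
apply: (ea.2 _ (fun j => c * a j v + a j w)).
have := tendsD (tendsZ c (ea.1 v)) (ea.1 w); congr tends.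
apply/funext => m; rewrite scaler_sumr -big_split/=; apply: eq_bigr => i _.
by rewrite scalerDl scalerA.
Qed.

Lemma expansion_delta j l : a j (e l) = (j == l)%:R.
Proof.
apply: esym; apply: (ea.2 _ (fun j => (j == l)%:R)).
apply: (tends_eventually (N := l.+1) _ (tends_cst (e l))) => m lm.
rewrite (bigD1 (Ordinal lm))//= eqxx scale1r big1 ?addr0// => i il.
by rewrite -val_eqE/= in il; rewrite (negbTE il) scale0r.
Qed.

Lemma expansion_neq0 j : e j != 0.
Proof.
apply/eqP => ej0; have := expansion_delta j j; rewrite ej0 eqxx.
have h : linear (a j : V -> K^o) := expansion_linear j.
have -> : a j 0 = 0.
  have := h 0 0 0; rewrite scale0r addr0 => ->.
  by rewrite scale0r add0r; have := h (-1) 0 0; rewrite scaler0 addr0 scaleN1r addNr.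
by move/esym/eqP; rewrite oner_eq0.
Qed.

Let S v m := \sum_(j < m) a j v *: e j.

Let SP m : linear (S^~ m).
Proof.
move=> c v w; rewrite /S scaler_sumr -big_split/=; apply: eq_bigr => i _.
have -> : a i (c *: v + w) = c * a i v + a i w by exact: expansion_linear.
by rewrite scalerDl scalerA.
Qed.

Let SB m v w : S (v - w) m = S v m - S w m.
Proof. by have := SP m (-1) w v; rewrite !scaleN1r (addrC (- w)) => ->; rewrite addrC. Qed.

Let SD m v w : S (v + w) m = S v m + S w m.
Proof. by have := SP m 1 v w; rewrite !scale1r. Qed.

Let S0 m : S 0 m = 0.
Proof. by rewrite -[X in S X](subrr 0) SB subrr. Qed.

Let SZ m c v : S (c *: v) m = c *: S v m.
Proof. by have := SP m c v 0; rewrite !addr0 S0 addr0. Qed.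

(** Baire's theorem applied to the sets where all partial sums have norm at most [M]:
    differences of elements dense in a ball are dense in a ball around the origin, and the
    rest follows by scaling. *)
Lemma expansion_almost_bounded : rcomplete V ->
  exists2 A : R, 0 <= A & forall v (d : R), 0 < d ->
    exists2 w, (forall m, rnorm (S w m) <= A * rnorm v) & rnorm (v - w) <= d.
Proof.
move=> Vc.
have [v|M [x [r [r0 ball_r]]]] :=
    @baire_ball V (fun M v => forall m, rnorm (S v m) <= M%:R) Vc.
  by have [M Mv] := tends_bounded (ea.1 v); exists M.
have small v (d : R) : rnorm v <= r -> 0 < d ->
    exists2 w, (forall m, rnorm (S w m) <= M%:R * 2) & rnorm (v - w) <= d.
  move=> vr d0; have d2 := divr_gt0 d0 (ltr0Sn R 1).
  have [|z1 Cz1 xz1] := ball_r (x + v) _ _ d2; first by rewrite addrAC subrr add0r.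
  have [|z2 Cz2 xz2] := ball_r x _ _ d2; first by rewrite subrr rnorm0 ltW.
  exists (z1 - z2) => [m|].
    rewrite SB (le_trans (rnormD _ _))// rnormN.
    by have := Cz1 m; have := Cz2 m; lra.
  have -> : v - (z1 - z2) = (x + v - z1) - (x - z2).
    by rewrite [x + v]addrC [v + x - z1]addrAC addrKA opprK opprB addrA addrAC.
  by rewrite (le_trans (rnormD _ _))// rnormN; lra.
exists (M%:R * 2 / r) => [|v d d0].
  by rewrite divr_ge0 ?mulr_ge0// ltW.
have [->|v0] := eqVneq v 0.
  by exists 0 => [m|]; rewrite ?S0 ?subrr rnorm0 ?mulr0// ltW.
have nv0 := rnorm_gt0 v0.
have c0 : 0 < r / rnorm v by rewrite divr_gt0.
have nc : rnorm (of_real k (r / rnorm v) : K^o) = r / rnorm v.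
  by rewrite rnorm_of_real// ltW.
have cn0 : of_real k (r / rnorm v) != 0.
  apply/eqP => c00; move: c0; rewrite -nc c00.
  by rewrite (@rnorm0 _ _ K^o) ltxx.
have [||w Sw vw] := small (of_real k (r / rnorm v) *: v) (d * (r / rnorm v)).
- by rewrite rnormZ nc divfK// gt_eqF.
- by rewrite mulr_gt0.
exists ((of_real k (r / rnorm v))^-1 *: w) => [m|].
  rewrite SZ rnormZ rnormV// nc -ler_pdivlMl ?invr_gt0// invrK.
  suff -> : r / rnorm v * (M%:R * 2 / r * rnorm v) = M%:R * 2 by [].
  by field; rewrite !gt_eqF.
rewrite -[X in X - _](scalerK cn0) -scalerBr rnormZ rnormV// nc.
by rewrite mulrC ler_pdivrMr.
Qed.

(** The density in [expansion_almost_bounded] is removed by successive approximation, as in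
    the open mapping theorem: [v] is a series of elements whose partial sums are controlled
    by a geometric series.  The coordinates of the partial sums of this series converge, and
    their limits expand [v], so by uniqueness they are the coordinates of [v]. *)
Theorem expansion_bounded : rcomplete V ->
  exists C : R, 1 <= C /\ forall v m, rnorm (\sum_(j < m) a j v *: e j) <= C * rnorm v.
Proof.
move=> Vc; have [A A0 approx] := expansion_almost_bounded Vc.
have /choice[g gP] : forall v, exists w,
    (forall m, rnorm (S w m) <= A * rnorm v) /\ rnorm (v - w) <= rnorm v / 2.
  move=> v; have [->|/rnorm_gt0 v0] := eqVneq v 0.
    by exists 0; split=> [m|]; rewrite ?S0 ?subrr rnorm0 ?mulr0 ?mul0r.
  by have [w Sw vw] := approx v _ (divr_gt0 v0 (ltr0Sn R 1)); exists w.
suff bnd v m : rnorm (S v m) <= (2 * A) * rnorm v.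
  exists (1 + 2 * A); split=> [|v m]; first by rewrite lerDl mulr_ge0.
  by apply: le_trans (bnd v m) _; rewrite ler_wpM2r ?rnorm_ge0// lerDr.
(* [r i] is what remains of [v] after [i] approximations, and [s i] what has been reached. *)
pose r i := iter i (fun v => v - g v) v.
pose s i := v - r i.
have rS i : r i.+1 = r i - g (r i) by [].
have nr i : rnorm (r i) <= rnorm v / 2 ^+ i.
  elim: i => [|i IH]; first by rewrite expr0 divr1.
  rewrite rS (le_trans (gP _).2)// ler_pdivrMr// (le_trans IH)//.
  by rewrite exprS invfM mulrA mulrAC divfK.
pose q i := 2 * A * (rnorm v / 2 ^+ i).
have q0 i : 0 <= q i by rewrite !mulr_ge0 ?invr_ge0 ?rnorm_ge0// exprn_ge0.
have sdist i j l : rnorm (S (s (i + j)%N - s i) l) <= q i - q (i + j)%N.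
  elim: j => [|j IH]; first by rewrite addn0 !subrr S0 rnorm0.
  have -> : s (i + j.+1)%N - s i = g (r (i + j)%N) + (s (i + j)%N - s i).
    by rewrite /s addnS rS opprB addrCA -addrA.
  rewrite SD (le_trans (rnormD _ _))//.
  have gl : rnorm (S (g (r (i + j)%N)) l) <= A * (rnorm v / 2 ^+ (i + j)).
    by apply: le_trans ((gP _).1 l) _; rewrite ler_wpM2l.
  have -> : q (i + j.+1)%N = q (i + j)%N / 2.
    by rewrite /q addnS exprS invfM -!mulrA; congr (_ * (_ * (_ * _))); rewrite mulrC.
  move: IH gl; rewrite /q; lra.
have qto0 (eps : R) : 0 < eps -> exists N, forall i, (N <= i)%N -> q i <= eps /\ rnorm (r i) <= eps.
  move=> e0; pose c := (2 * A + 1) * (rnorm v + 1).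
  have c0 : 0 < c.
    by rewrite mulr_gt0// ltr_wpDl ?mulr_ge0 ?rnorm_ge0.
  have [N Ni] := inv_succ_le (divr_gt0 e0 c0); exists N => i /Ni.
  rewrite ler_pdivlMr// => ie.
  have i2 : (2 ^+ i)^-1 <= i.+1%:R^-1 :> R.
    rewrite lef_pV2 ?posrE ?exprn_gt0 ?ltr0n// -natrX ler_nat.
    exact: ltn_expl.
  have v0 := rnorm_ge0 v.
  have cq : c * (2 ^+ i)^-1 <= eps.
    by apply: le_trans ie; rewrite mulrC ler_wpM2r// ltW.
  have p0 : 0 <= (2 ^+ i)^-1 :> R by rewrite invr_ge0 exprn_ge0.
  split; apply: le_trans cq.
    rewrite /q mulrA ler_wpM2r// /c ler_pM ?mulr_ge0//; lra.
  apply: le_trans (nr i) _; rewrite ler_wpM2r// /c.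
  by rewrite -[leLHS]mul1r ler_pM//; lra.
have rcs l : rcauchy (fun i => S (s i) l).
  move=> eps e0; have [N qN] := qto0 _ (divr_gt0 e0 (ltr0Sn R 1)).
  exists N => i j /subnKC<- /subnKC<-.
  have := sdist N (i - N)%N l; have := sdist N (j - N)%N l.
  have := q0 (N + (i - N))%N; have := q0 (N + (j - N))%N.
  have := (qN N (leqnn N)).1; rewrite ![S (s _ - s _) _]SB.
  have := rnorm_dist (S (s (N + (i - N))%N) l) (S (s N) l) (S (s (N + (j - N))%N) l).
  by rewrite (rnormBC (S (s N) l) (S (s (N + (j - N))%N) l)); lra.
have /choice[b bP] : forall j, exists b : K^o, tends (fun i => a j (s i) : K^o) b.
  move=> j; apply: scalars_rcomplete => eps e0.
  have ej0 := rnorm_gt0 (expansion_neq0 j).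
  have ee0 : 0 < eps * rnorm (e j) / 2 by rewrite divr_gt0// mulr_gt0.
  have [N1 sN1] := rcs j _ ee0; have [N2 sN2] := rcs j.+1 _ ee0.
  exists (maxn N1 N2) => i i'; rewrite !geq_max => /andP[i1 i2] /andP[i1' i2'].
  rewrite -(ler_pM2r ej0) -rnormZ scalerBl.
  have aE w : a j w *: e j = S w j.+1 - S w j.
    by rewrite /S big_ord_recr/= addrAC subrr add0r.
  rewrite !aE opprB [X in _ + X]addrC addrACA [X in _ + X]addrC.
  have := sN1 _ _ i1 i1'; have := sN2 _ _ i2 i2'.
  have := rnormD (S (s i) j.+1 - S (s i') j.+1) (S (s i') j - S (s i) j).
  by rewrite (rnormBC (S (s i') j)); lra.
have Tl l : tends (fun i => S (s i) l) (\sum_(j < l) b j *: e j).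
  apply: tends_sum => j.
  apply: (@tends_lipschitz _ _ K^o V (fun c => c *: e j) (rnorm (e j)) _ _ _ (bP j)).
  by move=> c d; rewrite -scalerBl rnormZ mulrC.
have TS i l : rnorm (\sum_(j < l) b j *: e j - S (s i) l) <= q i.
  apply: (tends_dist (N := i) _ (Tl l) (tends_cst _)) => j /subnKC <-.
  by rewrite -SB (le_trans (sdist _ _ _))// lerBlDr lerDl.
have Tv : tends (fun l => \sum_(j < l) b j *: e j) v.
  move=> eps e0; have e3 : 0 < eps / 3 by rewrite divr_gt0.
  have [N /(_ N (leqnn _))[qN rN]] := qto0 _ e3.
  have [M SM] := ea.1 (s N) _ e3; exists M => l Ml.
  have := SM l Ml; have := TS N l.
  have := rnorm_dist (\sum_(j < l) b j *: e j) (S (s N) l) v.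
  have := rnorm_dist (S (s N) l) (s N) v.
  by rewrite {4}/s addrAC subrr add0r rnormN; rewrite -/(S _ l); lra.
have -> : S v m = \sum_(j < m) b j *: e j.
  by apply: eq_bigr => j _; rewrite (ea.2 _ _ Tv).
have := TS 0%N m; rewrite (_ : s 0%N = 0) ?S0 ?subr0; last exact: subrr.
by rewrite /q expr0 divr1.
Qed.
End Expansion.
End SchauderBound.

(** * Norming functionals *)
Section HahnBanach.
Variables (R : realType) (k : ground) (V : normedModType (scalars R k)) (u : V).
Local Notation K := (scalars R k).
Local Notation rscale r x := (of_real k r *: x).

Lemma rnorm_of_realE (r : R) : rnorm (of_real k r : K^o) = `|r|.
Proof.
have [r0|r0] := leP 0 r; first by rewrite rnorm_of_real// ger0_norm.
have -> : of_real k r = - of_real k (- r).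
  by apply/eqP; rewrite -addr_eq0 -of_realD subrr of_real0.
by rewrite (@rnormN _ _ K^o) rnorm_of_real ?ltr0_norm// oppr_ge0 ltW.
Qed.

Lemma rnorm_rscale r (x : V) : rnorm (rscale r x) = `|r| * rnorm x.
Proof. by rewrite rnormZ rnorm_of_realE. Qed.

Lemma rscale1 (x : V) : rscale 1 x = x.
Proof. by rewrite (_ : of_real k 1 = 1) ?scale1r//; case: (k). Qed.

Lemma rnorm_rscaleD t (x y : V) : 0 < t ->
  t * rnorm (rscale t^-1 x + y) = rnorm (x + rscale t y).
Proof.
move=> t0; rewrite -{1}(gtr0_norm t0) -rnorm_rscale scalerDr scalerA -of_realM.
by rewrite divff ?gt_eqF// rscale1.
Qed.

Lemma rscaleN r (x : V) : rscale (- r) x = - rscale r x.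
Proof.
by apply/eqP; rewrite -addr_eq0 -scalerDl -of_realD addNr of_real0 scale0r.
Qed.

(** Zorn's lemma is applied to graphs of real-linear functionals dominated by the norm,
    which are plain sets of pairs.  The last clause fixes the value at [u]; it is conditional
    so that the empty graph, the union of the empty chain, is admissible. *)
Definition dominated_graph (G : set (V * R)) : Prop :=
  [/\ forall z w, G z -> G w -> G (z.1 + w.1, z.2 + w.2),
      forall r z, G z -> G (rscale r z.1, r * z.2),
      forall z, G z -> z.2 <= rnorm z.1 &
      (exists z, G z) -> G (u, rnorm u)].

(** Domination bounds the value at [y] from both sides.  By the triangle inequality each of
    the lower bounds is at most each of the upper ones, so their supremum is a valid choice. *)
Lemma dominated_graph_extend (A : set (V * R)) (y : V) :
  dominated_graph A -> A (0, 0) ->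
  exists B : set (V * R), [/\ dominated_graph B, A `<=` B & exists r, B (y, r)].
Proof.
move=> [AD AZ Ale Au] A0.
have low z w : A z -> A w -> z.2 - rnorm (z.1 - y) <= rnorm (w.1 + y) - w.2.
  move=> Az Aw; rewrite lerBlDr addrAC lerBrDr.
  apply: le_trans (Ale _ (AD _ _ Az Aw)) _ => /=.
  rewrite [leRHS]addrC (_ : z.1 + w.1 = (w.1 + y) + (z.1 - y)); last first.
    by rewrite addrACA subrr addr0 addrC.
  by rewrite [leRHS]addrC rnormD.
pose L := [set z.2 - rnorm (z.1 - y) | z in A].
have supL : has_sup L.
  split; first by exists (0 - rnorm (0 - y)), (0, 0).
  by exists (rnorm (0 + y) - 0) => _ [z Az <-]; exact: (low z (0, 0)).
pose c := sup L.
have cge z : A z -> z.2 - rnorm (z.1 - y) <= c.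
  by move=> Az; apply: (ub_le_sup supL.2); exists z.
have cle z : A z -> c <= rnorm (z.1 + y) - z.2.
  by move=> Az; apply: ge_sup supL.1 _ => _ [w Aw <-]; exact: low.
exists [set z | exists x r s, A (x, r) /\ z = (x + rscale s y, r + s * c)].
split; last first.
- exists c, 0, 0, 1; split=> //; rewrite add0r mul1r add0r.
  by rewrite rscale1.
- by move=> [x r] Az; exists x, r, 0; rewrite of_real0 scale0r mul0r !addr0.
split.
- move=> _ _ [x [r [s [Az ->]]]] [x' [r' [s' [Aw ->]]]] /=.
  exists (x + x'), (r + r'), (s + s'); split; first exact: (AD _ _ Az Aw).
  by rewrite of_realD scalerDl mulrDl; congr (_, _); rewrite addrACA.
- move=> t _ [x [r [s [Az ->]]]] /=.
  exists (rscale t x), (t * r), (t * s); split; first exact: (AZ t _ Az).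
  by rewrite of_realM scalerDr scalerA mulrDr mulrA.
- move=> _ [x [r [s [Az ->]]]] /=; have [s0|s0|->] := ltgtP s 0.
  + have t0 : 0 < - s by rewrite oppr_gt0.
    have /= := cge _ (AZ (- s)^-1 _ Az); rewrite -(ler_pM2l t0) mulrBr mulrA.
    rewrite divff ?gt_eqF// mul1r rnorm_rscaleD// scalerN rscaleN opprK.
    by rewrite mulNr; lra.
  + have /= := cle _ (AZ s^-1 _ Az); rewrite -(ler_pM2l s0) mulrBr mulrA.
    by rewrite divff ?gt_eqF// mul1r rnorm_rscaleD//; lra.
  + by rewrite of_real0 scale0r mul0r !addr0; exact: (Ale _ Az).
- move=> _; exists u, (rnorm u), 0; rewrite of_real0 scale0r mul0r !addr0.
  by split=> //; apply: Au; exists (0, 0).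
Qed.

Lemma norming_real_functional : exists f : V -> R,
  [/\ forall x y, f (x + y) = f x + f y, forall r x, f (rscale r x) = r * f x,
      forall x, f x <= rnorm x & f u = rnorm u].
Proof.
have [A [[AD AZ Ale Au] Amax]] : exists A, dominated_graph A /\
    forall B, A `<` B -> ~ dominated_graph B.
  apply: Zorn_bigcup => FF FP Ftot; split.
  - move=> z w [G FG Gz] [H FH Hw]; have [GH|HG] := Ftot _ _ FG FH.
      by exists H => //; have [+ _ _ _] := FP _ FH; apply=> //; exact: GH.
    by exists G => //; have [+ _ _ _] := FP _ FG; apply=> //; exact: HG.
  - by move=> r z [G FG Gz]; exists G => //; have [_ + _ _] := FP _ FG; exact.
  - by move=> z [G FG Gz]; have [_ _ + _] := FP _ FG; exact.
  - by move=> [z [G FG Gz]]; exists G => //; have [_ _ _ +] := FP _ FG; apply; exists z.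
have A0 : A (0, 0).
  suff [z Az] : exists z, A z.
    by have := AZ 0 z Az; rewrite of_real0 scale0r mul0r.
  apply: contrapT => noA; pose G := [set (rscale r u, r * rnorm u) | r in [set: R]].
  have : A `<` G.
    split=> [z Az|/(_ (rscale 0 u, 0 * rnorm u))]; first by case: noA; exists z.
    by move=> /(_ (ex_intro2 _ _ 0 Logic.I erefl)) Az; case: noA; eexists; exact: Az.
  move=> /Amax; apply; split.
  - move=> _ _ [r _ <-] [s _ <-]; exists (r + s) => //=.
    by rewrite of_realD scalerDl mulrDl.
  - move=> t _ [r _ <-]; exists (t * r) => //=.
    by rewrite of_realM scalerA mulrA.
  - move=> _ [r _ <-] /=; rewrite rnorm_rscale ler_wpM2r ?rnorm_ge0//.
    exact: ler_norm.
  - move=> _; exists 1 => //; rewrite mul1r.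
    by rewrite rscale1.
have /choice[f fP] : forall x, exists r, A (x, r).
  move=> x; have [B [BP AB [r Bx]]] := dominated_graph_extend x (And4 AD AZ Ale Au) A0.
  exists r; apply: contrapT => Ax; apply: (Amax B) => //; split=> // BA.
  by apply: Ax; exact: BA.
have leA x r s : A (x, r) -> A (x, s) -> r <= s.
  move=> Ar As; have := Ale _ (AD _ _ Ar (AZ (-1) _ As)) => /=.
  by rewrite rscaleN rscale1 subrr rnorm0 mulN1r subr_le0.
have fA x r : A (x, r) -> f x = r.
  by move=> Ar; apply/eqP; rewrite eq_le !(@leA x).
exists f; split.
- by move=> x y; apply: fA; exact: (AD _ _ (fP x) (fP y)).
- by move=> r x; apply: fA; exact: (AZ r _ (fP x)).
- by move=> x; exact: (Ale _ (fP x)).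
- by apply: fA; apply: Au; exists (0, 0).
Qed.
End HahnBanach.

(** Over the complex numbers the functional is x |-> f(x) - i f(ix), for a real-linear [f]
    with f(u) = |u| (Bohnenblust and Sobczyk).  The square of its modulus at x is the value
    of f at cx, where c is the conjugate of its value at x. *)
Theorem norming_functional (R : realType) (k : ground)
    (V : normedModType (scalars R k)) (u : V) :
  exists phi : dual V, rnorm phi <= 1 /\ rnorm u <= rnorm (phi u).
Proof.
have [f [fD fZ fle fu]] := norming_real_functional u.
suff [phi [phil phile phiu]] : exists phi : V -> (scalars R k)^o,
    [/\ linear phi, forall x, rnorm (phi x) <= 1 * rnorm x & rnorm u <= rnorm (phi u)].
  exists (Dual (bounded_dual_pred phil phile)); split=> //.
  exact: rnorm_dual_le.
case: k V u f fD fZ fle fu => V u f fD fZ fle fu.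
  exists f; split.
  - by move=> a x y; rewrite fD fZ.
  - move=> x; rewrite mul1r ler_norml fle andbT lerNl -rnormN.
    by have := fle (- x); rewrite -[- x]scaleN1r (fZ (-1)) mulN1r.
  - by rewrite fu; exact: ler_norm.
pose I := ('i%C : R[i]).
have cE (c : R[i]) (x : V) : c *: x =
    of_real ComplexGround (complex.Re c) *: x +
    of_real ComplexGround (complex.Im c) *: (I *: x).
  rewrite scalerA -scalerDl; congr (_ *: _); case: c => a b.
  by rewrite /= /I; simpc.
have II (x : V) : I *: (I *: x) = - x.
  by rewrite scalerA /I -expr2 sqr_i scaleN1r.
have fN x : f (- x) = - f x.
  have h : of_real ComplexGround (- 1) *: x = - x.
    by rewrite rscaleN scale1r.
  by rewrite -h fZ mulN1r.
pose phi : V -> (scalars R ComplexGround)^o := fun x => Complex (f x) (- f (I *: x)).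
have phil : linear phi.
  move=> c x y; rewrite /phi fD scalerDr fD opprD.
  have -> : f (c *: x) = complex.Re c * f x + complex.Im c * f (I *: x).
    by rewrite (cE c x) fD !fZ.
  have -> : f (I *: (c *: x)) = complex.Re c * f (I *: x) - complex.Im c * f x.
    by rewrite scalerA mulrC -scalerA (cE c) fD !fZ II fN mulrN.
  case: c => a b.
  rewrite -[RHS]/((a +i* b)%C * (f x -i* f (I *: x))%C + (f y -i* f (I *: y))%C).
  by apply/eqP; rewrite eq_complex/=; apply/andP; split; apply/eqP; ring.
exists phi; split=> //.
  move=> x; rewrite mul1r.
  have [->|w0] := eqVneq (phi x) 0; first by rewrite rnorm0 rnorm_ge0.
  have {}w0 := @rnorm_gt0 R ComplexGround (scalars R ComplexGround)^o (phi x) w0.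
  have := fle (((phi x)^*)%C *: x).
  rewrite rnormZ.
  have -> : @rnorm R ComplexGround (scalars R ComplexGround)^o ((phi x)^*)%C = rnorm (phi x).
    by rewrite /rnorm /phi /= sqrrN.
  have -> : f (((phi x)^*)%C *: x) = rnorm (phi x) * rnorm (phi x).
    have -> : rnorm (phi x) = Num.sqrt (f x ^+ 2 + f (I *: x) ^+ 2).
      by rewrite /rnorm /phi /= sqrrN.
    rewrite -expr2 sqr_sqrtr ?addr_ge0 ?sqr_ge0// (cE ((phi x)^*)%C) fD !fZ /phi/=.
    ring.
  by rewrite ler_pM2l.
rewrite -fu; apply: le_trans (ler_norm _) _.
have [+ _ _] := normc_le (phi u); exact.
Qed.

(** * Multilinear maps *)
Section MultilinearAlgebra.
Variables (R : realType) (k : ground).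
Local Notation K := (scalars R k).
Variables (I : finType) (G : I -> lmodType K) (W : lmodType K).
Variable B : (forall i, G i) -> W.
Hypothesis Bm : @multilinear R k I G W B.

Lemma multilinear0 x i : B (dfwith x i 0) = 0.
Proof.
have := @Bm x i 1 0 0; rewrite scaler0 addr0 scale1r => h.
by apply: (@addrI _ (B (dfwith x i 0))); rewrite -h addr0.
Qed.

Lemma multilinearB x i u v :
  B (dfwith x i (u - v)) = B (dfwith x i u) - B (dfwith x i v).
Proof. by have := @Bm x i (-1) v u; rewrite !scaleN1r addrC => ->; rewrite addrC. Qed.

Lemma multilinear_sum x i (J : Type) (r : seq J) (c : J -> K) (v : J -> G i) :
  B (dfwith x i (\sum_(j <- r) c j *: v j)) = \sum_(j <- r) c j *: B (dfwith x i (v j)).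
Proof.
elim: r => [|j r IH]; first by rewrite !big_nil multilinear0.
by rewrite !big_cons Bm IH.
Qed.

(** Factors are expanded one after the other: along the list [s] of the factors that still
    carry the full sum, the indices of the others are prescribed by [b]. *)
Lemma multilinear_expand (M : nat) (c : I -> nat -> K) (v : forall i, nat -> G i) :
  B (fun i => \sum_(j < M) c i j *: v i j) =
  \sum_(alpha : {ffun I -> 'I_M})
    (\prod_i c i (alpha i)) *: B (fun i => v i (alpha i)).
Proof.
pose y (s : seq I) (b : I -> nat) : forall i, G i :=
  fun i => if i \in s then \sum_(j < M) c i j *: v i j else v i (b i).
have eq_fun (f g : forall i, G i) : (forall i, f i = g i) -> f = g.
  by move=> fg; apply/functional_extensionality_dep.
suff main (s : seq I) (b : I -> nat) : uniq s ->
    (forall i, i \notin s -> b i < M)%N ->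
    B (y s b) = \sum_(alpha : {ffun I -> 'I_M} | [forall i, (i \notin s) ==> (alpha i == b i :> nat)])
      (\prod_(i <- s) c i (alpha i)) *: B (fun i => v i (alpha i)).
  have := main (enum I) (fun=> 0%N) (enum_uniq _).
  rewrite (eq_fun (y _ _) (fun i => \sum_(j < M) c i j *: v i j)); last first.
    by move=> i; rewrite /y mem_enum.
  move=> ->; last by move=> i; rewrite mem_enum.
  apply: eq_big => [alpha|alpha _]; last by rewrite big_enum.
  by apply/forallP => i; rewrite mem_enum.
elim: s b => [|i0 s IH] b /=.
  move=> _ bM; pose b' : {ffun I -> 'I_M} := [ffun i => Ordinal (bM i isT)].
  rewrite (big_pred1 b') => [|alpha].
    by rewrite big_nil scale1r; congr B; apply: eq_fun => i; rewrite /y ffunE.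
  apply/forallP/eqP => [ab|-> i]; last by rewrite ffunE.
  by apply/ffunP => i; apply/val_inj; rewrite ffunE; exact/eqP/ab.
move=> /andP[i0s su] bM.
pose b1 j i := if i == i0 then j else b i.
have -> : y (i0 :: s) b = dfwith (y s b) i0 (\sum_(j < M) c i0 j *: v i0 j).
  apply: eq_fun => i; case: dfwithP => [|i' ii']; first by rewrite /y mem_head.
  by rewrite /y in_cons eq_sym (negbTE ii').
rewrite multilinear_sum.
have step (j : 'I_M) : dfwith (y s b) i0 (v i0 j) = y s (b1 j).
  apply: eq_fun => i; case: dfwithP => [|i' ii'].
    by rewrite /y (negbTE i0s) /b1 eqxx.
  by rewrite /y /b1 eq_sym (negbTE ii').
under [LHS]eq_bigr => j _.
  rewrite step IH//; last first.
    move=> i is_; rewrite /b1; case: eqVneq => // ii0.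
    by apply: bM; rewrite in_cons negb_or ii0.
  over.
rewrite [RHS](partition_big (fun alpha : {ffun I -> 'I_M} => alpha i0) predT)//=.
apply: eq_bigr => j _; rewrite scaler_sumr; apply: eq_big => [alpha|alpha].
  apply/forallP/andP => [h|[/forallP h /eqP aj] i].
    split; last by apply/eqP/val_inj/eqP; have := h i0; rewrite i0s /b1 eqxx.
    apply/forallP => i; rewrite in_cons negb_or; apply/implyP => /andP[ii0 is_].
    by have := h i; rewrite is_ /b1 (negbTE ii0).
  apply/implyP => is_; rewrite /b1; have [->|ii0] := eqVneq i i0; first by rewrite aj.
  by have := h i; rewrite in_cons negb_or ii0 is_.
move=> /forallP/(_ i0); rewrite i0s /b1 eqxx /= => /eqP aj.
by rewrite big_cons -scalerA aj.
Qed.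
End MultilinearAlgebra.

Section MultilinearNorm.
Variables (R : realType) (k : ground).
Local Notation K := (scalars R k).
Variables (I : finType) (G : I -> normedModType K) (W : normedModType K).
Variable B : (forall i, G i) -> W.
Hypothesis Bm : @multilinear R k I (fun i => G i) W B.

Lemma dfwith_eta x (i : I) : dfwith x i (x i) = x :> (forall i, G i).
Proof. by apply/functional_extensionality_dep => j; case: dfwithP. Qed.

(** The factors are exchanged one at a time. *)
Lemma multilinear_lipschitz (c M d : R) (x y : forall i, G i) :
  0 <= c -> 1 <= M -> 0 <= d ->
  (forall z, rnorm (B z) <= c * \prod_i rnorm (z i)) ->
  (forall i, rnorm (x i) <= M) -> (forall i, rnorm (y i) <= M) ->
  (forall i, rnorm (x i - y i) <= d) ->
  rnorm (B x - B y) <= c * #|I|%:R * M ^+ #|I| * d.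
Proof.
move=> c0 M1 d0 Bc xM yM xy.
have M0 : 0 <= M by apply: le_trans M1.
pose z (s : seq I) : forall i, G i := fun i => if i \in s then y i else x i.
suff main s : uniq s -> rnorm (B x - B (z s)) <= c * (size s)%:R * M ^+ #|I| * d.
  have := main (enum I) (enum_uniq _); rewrite -cardT.
  suff -> : z (enum I) = y by [].
  by apply/functional_extensionality_dep => i; rewrite /z mem_enum.
elim: s => [_|i0 s IH /= /andP[i0s su]].
  have -> : z [::] = x by apply/functional_extensionality_dep.
  by rewrite subrr rnorm0 mulr0 !mul0r.
apply: le_trans (rnorm_dist _ (B (z s)) _) _.
rewrite -natr1 mulrDr !mulrDl mulr1; apply: lerD; first exact: IH.
have -> : z (i0 :: s) = dfwith (z s) i0 (y i0).
  apply/functional_extensionality_dep => i; case: dfwithP => [|i' ii'].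
    by rewrite /z mem_head.
  by rewrite /z in_cons eq_sym (negbTE ii').
rewrite -{1}(dfwith_eta (z s) i0) {2}/z (negbTE i0s) -multilinearB//.
rewrite (le_trans (Bc _))// -!mulrA ler_wpM2l//.
rewrite (bigD1 i0)//= dfwithin mulrC ler_pM ?rnorm_ge0//.
  by apply: prodr_ge0 => i _; exact: rnorm_ge0.
apply: (@le_trans _ _ (\prod_(i | i != i0) M)).
  apply: ler_prod => i ii0; rewrite rnorm_ge0/= dfwithout 1?eq_sym//.
  by rewrite /z; case: ifP.
rewrite prodr_const ler_weXn2l//.
exact: max_card.
Qed.

Lemma multilinear_bounded_continuous (c : R) : 0 <= c ->
  (forall z, rnorm (B z) <= c * \prod_i rnorm (z i)) ->
  continuous (B : prod_topology (fun i => G i) -> W).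
Proof.
move=> c0 Bc x; have FF := @nbhs_filter (prod_topology (fun i => G i)) x.
apply/cvgrPdist_le => eps e0.
have e1 : 0 < re_part eps by rewrite -(of_real_lt k) of_real0 re_partK// ltW.
pose M : R := 1 + \sum_i rnorm (x i).
have M1 : 1 <= M by rewrite lerDl sumr_ge0// => i _; exact: rnorm_ge0.
have M0 : 0 < M + 1 by move: M1; lra.
pose D := c * #|I|%:R * (M + 1) ^+ #|I| + 1.
have D0 : 0 < D by rewrite ltr_wpDl// !mulr_ge0// exprn_ge0// ltW.
pose d := Num.min 1 (re_part eps / D).
have d0 : 0 < d by rewrite lt_min ltr01 divr_gt0.
have near_x : \forall y \near (x : prod_topology (fun i => G i)), forall i, rnorm (x i - y i) <= d.
  apply: (@filter_forall _ I (fun i (y : forall i, G i) => rnorm (x i - y i) <= d) _ FF) => i.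
  have /(_ x) := @proj_continuous I (fun i => G i) i.
  move=> /cvgrPdist_le/(_ (of_real k d)); rewrite -(of_real0 R k) of_real_lt => /(_ d0).
  by apply: filterS => y; rewrite -rnormE of_real_le.
apply: filterS near_x => y xy; rewrite -rnormE -(re_partK (ltW e0)) of_real_le.
have xM i : rnorm (x i) <= M.
  rewrite /M (bigD1 i)//= addrCA lerDl addr_ge0 ?sumr_ge0// => j _.
  exact: rnorm_ge0.
apply: le_trans (_ : c * #|I|%:R * (M + 1) ^+ #|I| * d <= _).
  apply: multilinear_lipschitz => //.
  - by rewrite (le_trans M1)// lerDl.
  - exact: ltW.
  - by move=> i; rewrite (le_trans (xM i))// lerDl.
  - move=> i; rewrite (le_trans (rnorm_leD _ (x i)))// rnormBC lerD//.
    by rewrite (le_trans (xy i))// ge_min lexx.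
apply: (@le_trans _ _ (D * d)); first by rewrite ler_wpM2r ?(ltW d0)// lerDl.
by rewrite mulrC -ler_pdivlMr// ge_min lexx orbT.
Qed.

Lemma multilinear_continuous_tends (u : nat -> forall i, G i) (x : forall i, G i) :
  continuous (B : prod_topology (fun i => G i) -> W) ->
  (forall i, tends (fun m => u m i) (x i)) -> tends (fun m => B (u m)) (B x).
Proof.
move=> Bc ux; apply/tendsP.
have ucvg : (u : nat -> prod_topology (fun i => G i)) @ \oo --> (x : prod_topology (fun i => G i)).
  apply/cvg_sup => i A [_ [[C Co <-] Cx] CA].
  have /tendsP/(_ C) := ux i.
  have Cn : nbhs (x i) C by apply: open_nbhs_nbhs.
  move=> /(_ Cn) uC; apply: (@filterS _ \oo _ (fun m => C (u m i))) uC => m Cm.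
  exact: CA.
exact: (cvg_comp _ _ ucvg (Bc x)).
Qed.
End MultilinearNorm.

Section DualTuple.
Variables (R : realType) (k : ground).
Local Notation K := (scalars R k).
Variables (n : nat) (E : 'I_n -> normedModType K) (F : normedModType K).
Local Notation T := (forall o, dual_factors E F o).

Lemma dual_tuple_eta (x : T) : dual_tuple (fun i => x (Some i)) (x None) = x.
Proof. by apply/functional_extensionality_dep => -[i|]. Qed.

Lemma dual_tuple_dfwith (x' : forall i, dual (E i)) f i v :
  dual_tuple (dfwith x' i v) f =
  dfwith (dual_tuple x' f : T) (Some i) (v : dual_factors E F (Some i)).
Proof.
apply/functional_extensionality_dep => -[j|] /=; last by rewrite dfwithout.
case: dfwithP => [|j' ij']; first by rewrite dfwithin.
by rewrite dfwithout.
Qed.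

Lemma dual_tuple_dfwithN (x' : forall i, dual (E i)) f g :
  dual_tuple x' g = dfwith (dual_tuple x' f : T) None (g : dual_factors E F None).
Proof.
by apply/functional_extensionality_dep => -[j|] /=; rewrite ?dfwithin// dfwithout.
Qed.

End DualTuple.

Lemma big_option (S : Type) (idx : S) (op : Monoid.com_law idx) (J : finType)
    (f : option J -> S) :
  \big[op/idx]_o f o = op (\big[op/idx]_j f (Some j)) (f None).
Proof.
rewrite (bigD1 None)//= Monoid.mulmC; congr (op _ _).
rewrite (reindex_omap Some id)/=; last by case.
by apply: eq_bigl => j; rewrite eqxx.
Qed.

(** * The completed projective tensor product *)
Section Summation.
Variable R : realType.

Lemma summable_tail (a : nat -> R) (C : R) :
  (forall j, 0 <= a j) -> (forall m, \sum_(j < m) a j <= C) ->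
  forall eps : R, 0 < eps -> exists N, forall m, \sum_(N <= j < m) a j <= eps.
Proof.
move=> a0 aC eps e0.
pose S := [set \sum_(j < m) a j | m in [set: nat]].
have Ssup : has_sup S.
  by split; [exists (\sum_(j < 0) a j), 0%N|exists C => _ [m _ <-]].
have [_ [N _ <-] SN] := sup_adherent e0 Ssup.
exists N => m; have [mN|Nm] := leqP m N.
  by rewrite big_geq// ltW.
have : \sum_(j < m) a j <= sup S by apply: (ub_le_sup Ssup.2); exists m.
rewrite -!(big_mkord xpredT) in SN *.
rewrite (big_cat_nat (n := N) (leq0n N) (ltnW Nm))/=; lra.
Qed.

Variable k : ground.

Lemma summable_rcauchy (V : normedModType (scalars R k)) (v : nat -> V) (C : R) :
  (forall m, \sum_(j < m) rnorm (v j) <= C) -> rcauchy (fun m => \sum_(j < m) v j).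
Proof.
move=> vC eps e0; have e2 := divr_gt0 e0 (ltr0Sn R 1).
have [N Ne] := summable_tail (fun j => rnorm_ge0 (v j)) vC e2.
have main i : (N <= i)%N -> rnorm (\sum_(j < i) v j - \sum_(j < N) v j) <= eps / 2.
  move=> Ni; rewrite -!(big_mkord xpredT) (big_cat_nat (n := N) (leq0n N) Ni)/=.
  by rewrite addrAC subrr add0r (le_trans (rnorm_sum _ _ _)).
exists N => i j /main mi /main mj.
have := rnorm_dist (\sum_(j < i) v j) (\sum_(j < N) v j) (\sum_(i < j) v i).
by rewrite (rnormBC (\sum_(j < N) v j) (\sum_(i < j) v i)); lra.
Qed.

(** Nonempty blocks [l 0], [l 1], ... are read as the single sequence [x], the first [i] of
    them ending at place [N i]. *)
Lemma flatten_blocks (T : Type) (x0 : T) (l : nat -> seq T) :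
  (forall i, 0 < size (l i))%N ->
  exists (x : nat -> T) (N : nat -> nat), (forall i, i <= N i)%N /\
    forall (S : nmodType) (g : T -> S) i,
      \sum_(j < N i) g (x j) = \sum_(h < i) \sum_(y <- l h) g y.
Proof.
move=> l0; pose c i := flatten [seq l h | h <- iota 0 i].
have cS i : c i.+1 = c i ++ l i.
  by rewrite /c -addn1 iotaD map_cat flatten_cat/= cats0.
have sc i : (i <= size (c i))%N.
  by elim: i => // i IH; rewrite cS size_cat -addn1 leq_add.
have nthc i j d : (j < size (c i))%N -> nth x0 (c (i + d)%N) j = nth x0 (c i) j.
  move=> ji; elim: d => [|d IH]; first by rewrite addn0.
  rewrite addnS cS nth_cat (_ : (j < size (c (i + d)))%N = true) ?IH//.
  elim: {IH} d => [|d IH]; first by rewrite addn0.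
  by rewrite addnS cS size_cat ltn_addr.
exists (fun j => nth x0 (c j.+1) j), (fun i => size (c i)); split=> // S g i.
have -> : \sum_(h < i) \sum_(y <- l h) g y = \sum_(y <- c i) g y.
  elim: i => [|i IH]; first by rewrite big_ord0 big_nil.
  by rewrite big_ord_recr/= IH cS big_cat.
rewrite (big_nth x0) big_mkord; apply: eq_bigr => -[j jc] _ /=; congr g.
have [ij|ji] := leqP i j.+1.
  by rewrite -(subnKC ij) nthc.
by rewrite -(subnKC (ltnW ji)) nthc//; exact: (sc j.+1).
Qed.
End Summation.

Section ProjectiveCompletion.
Variables (R : realType) (k : ground).
Local Notation K := (scalars R k).
Variables (I : finType) (G : I -> normedModType K) (i0 : I).
Variables (X : completeNormedModType K) (t : (forall i, G i) -> X).
Hypothesis Xt : projective_completion t.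
Local Notation T := (forall i, G i).
Local Notation multilin W B := (@multilinear R k I (fun i => G i) W B).

Let tm : multilin X t. Proof. by have [] := Xt. Qed.

Let scale_first (a : K) (x : T) : T := dfwith x i0 (a *: x i0).

(** Scaling the first factor of each term: the scalar multiple of a formal sum of
    elementary tensors. *)
Definition scale_formal (a : K) (s : seq T) : seq T := map (scale_first a) s.

Lemma sum_scale_formal (W : lmodType K) (B : T -> W) a s : multilin W B ->
  \sum_(x <- scale_formal a s) B x = a *: \sum_(x <- s) B x.
Proof.
move=> Bm; rewrite big_map scaler_sumr; apply: eq_bigr => x _.
exact: (multilinear_scale1 i0 Bm).
Qed.

Lemma rnorm_tensor_le x : rnorm (t x) <= \prod_i rnorm (x i).
Proof.
have [_ /(_ [:: x]) + _] := Xt; rewrite big_seq1 => ->.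
apply: le_trans (@projective_norm_le _ _ _ _ _ [:: x] _) _ => //.
by rewrite big_seq1.
Qed.

Lemma tensor_dense u (eps : R) : 0 < eps ->
  exists s, rnorm (u - \sum_(x <- s) t x) <= eps.
Proof.
move=> e0; have [_ _ /seteqP[_ /(_ u Logic.I)]] := Xt.
move=> /(_ [set v | rnorm (u - v) <= eps])[].
  apply/nbhs_normP; exists (of_real k eps); first by rewrite /= -(of_real0 R k) of_real_lt.
  by move=> v /=; rewrite -rnormE of_real_lt => /ltW.
by move=> _ [[s _ <-] us]; exists s.
Qed.

Section Bound.
Variables (W : normedModType K) (B : T -> W) (c : R).
Hypotheses (Bm : multilin W B) (c0 : 0 <= c).
Hypothesis Bc : forall x, rnorm (B x) <= c * \prod_i rnorm (x i).

(** The left side is the same for all representations of the tensor, and [c * \prod_i rnorm (x i)],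
    summed over a representation, can be brought close to the right side. *)
Lemma formal_sum_le s : rnorm (\sum_(x <- s) B x) <= c * rnorm (\sum_(x <- s) t x).
Proof.
have [_ -> _] := Xt.
have main s' : same_tensor s s' ->
    rnorm (\sum_(x <- s) B x) <= c * \sum_(x <- s') \prod_i rnorm (x i).
  move=> /(_ W B Bm) ->; rewrite (le_trans (rnorm_sum _ _ _))// mulr_sumr.
  exact: ler_sum.
have [c00|cn0] := eqVneq c 0.
  by have := main s (fun _ _ _ => erefl); rewrite c00 !mul0r.
have c_gt0 : 0 < c by rewrite lt_neqAle eq_sym cn0.
rewrite mulrC -ler_pdivrMr//; apply: le_projective_norm => s' /main.
by rewrite ler_pdivrMr// mulrC.
Qed.

(** The difference of two formal sums is again a formal sum. *)
Lemma formal_dist_le s s' :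
  rnorm (\sum_(x <- s) B x - \sum_(x <- s') B x) <=
  c * rnorm (\sum_(x <- s) t x - \sum_(x <- s') t x).
Proof.
have := formal_sum_le (s ++ scale_formal (-1) s').
by rewrite !big_cat/= !sum_scale_formal// !scaleN1r.
Qed.

Lemma formal_tends (p q : nat -> seq T) u w :
  tends (fun m => \sum_(x <- p m) t x) u -> tends (fun m => \sum_(x <- q m) t x) u ->
  tends (fun m => \sum_(x <- p m) B x) w -> tends (fun m => \sum_(x <- q m) B x) w.
Proof.
move=> pu qu pw eps e0; have c1 : 0 < 4 * (c + 1) by rewrite mulr_gt0// ltr_wpDl.
have e1 := divr_gt0 e0 c1.
have [N pN] := pu _ e1; have [M qM] := qu _ e1.
have [L pL] := pw _ (divr_gt0 e0 (ltr0Sn R 1)).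
exists (maxn N (maxn M L)) => m; rewrite !geq_max => /and3P[/pN pm /qM qm /pL Lm].
apply: le_trans (rnorm_dist _ (\sum_(x <- p m) B x) _) _.
rewrite [leRHS]splitr lerD//.
apply: le_trans (formal_dist_le _ _) _.
have pq : rnorm (\sum_(x <- q m) t x - \sum_(x <- p m) t x) <= eps / (4 * (c + 1)) * 2.
  have := rnorm_dist (\sum_(x <- q m) t x) u (\sum_(x <- p m) t x).
  by rewrite (rnormBC u); lra.
apply: (@le_trans _ _ ((c + 1) * (eps / (4 * (c + 1)) * 2))).
  by rewrite ler_pM ?rnorm_ge0// lerDl.
by rewrite le_eqVlt; apply/orP; left; apply/eqP; field; rewrite gt_eqF// ltr_wpDl.
Qed.

(** The universal property of the completion.  [L u] is the limit of the values of [B] on any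
    formal sums approximating [u]; by [formal_dist_le] it exists and does not depend on
    them. *)
Theorem projective_extension : rcomplete W ->
  exists L : {linear X -> W},
    (forall x, L (t x) = B x) /\ forall u, rnorm (L u) <= c * rnorm u.
Proof.
move=> Wc.
have inv0 m : 0 < m.+1%:R^-1 :> R by rewrite invr_gt0.
have /choice[s sP] : forall u, exists s : nat -> seq T,
    forall m, rnorm (u - \sum_(x <- s m) t x) <= m.+1%:R^-1.
  move=> u; have /choice[s sP] := fun m => tensor_dense u (inv0 m).
  by exists s.
have st u : tends (fun m => \sum_(x <- s u m) t x) u.
  move=> eps /inv_succ_le[N Ne]; exists N => m Nm.
  by rewrite rnormBC (le_trans (sP _ _))// Ne.
have /choice[L LP] : forall u, exists w, tends (fun m => \sum_(x <- s u m) B x) w.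
  move=> u; apply: Wc => eps e0.
  have c1 : 0 < c + 1 by rewrite ltr_wpDl.
  have [N sN] := tends_rcauchy (st u) (divr_gt0 e0 c1).
  exists N => i j Ni Nj; apply: le_trans (formal_dist_le _ _) _.
  have := sN i j Ni Nj; rewrite ler_pdivlMr// => /(le_trans _); apply.
  by rewrite mulrC ler_wpM2l ?rnorm_ge0// lerDl.
have Lq u q : tends (fun m => \sum_(x <- q m) t x) u ->
    tends (fun m => \sum_(x <- q m) B x) (L u).
  by move=> qu; exact: formal_tends (st u) qu (LP u).
have Ll : linear L.
  move=> a u v; pose q m := scale_formal a (s u m) ++ s v m.
  apply: (@tends_unique _ _ _ (fun m => \sum_(x <- q m) B x)).
    apply: Lq; have := tendsD (tendsZ a (st u)) (st v); congr tends.
    by apply/funext => m; rewrite big_cat/= sum_scale_formal.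
  have := tendsD (tendsZ a (LP u)) (LP v); congr tends.
  by apply/funext => m; rewrite big_cat/= sum_scale_formal.
pose Lin : {linear X -> W} := HB.pack L (GRing.isLinear.Build K X W *:%R L Ll).
exists Lin; split=> [x|u] /=.
  apply: (@tends_unique _ _ _ (fun m => \sum_(x <- [:: x]) B x)).
    by apply: Lq; rewrite big_seq1; exact: tends_cst.
  by rewrite big_seq1; exact: tends_cst.
apply/ler_addgt0Pr => eps e0; have c1 : 0 < c + 1 by rewrite ltr_wpDl.
have [N sN] := st u _ (divr_gt0 e0 c1).
apply: (tends_le (N := N) _ (LP u)) => m /sN; rewrite ler_pdivlMr// => sm.
apply: le_trans (formal_sum_le _) _.
apply: (@le_trans _ _ (c * (rnorm u + rnorm (\sum_(x <- s u m) t x - u)))).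
  by rewrite ler_wpM2l// rnorm_leD.
rewrite mulrDr lerD2l; apply: le_trans sm; rewrite mulrC.
by rewrite ler_wpM2l ?rnorm_ge0// lerDl.
Qed.
End Bound.

Lemma tensor_linear_eq (W : normedModType K) (L1 L2 : {linear X -> W}) (c1 c2 : R) :
  (forall u, rnorm (L1 u) <= c1 * rnorm u) -> (forall u, rnorm (L2 u) <= c2 * rnorm u) ->
  (forall x, L1 (t x) = L2 (t x)) -> forall u, L1 u = L2 u.
Proof.
move=> L1c L2c L12 u; have inv0 m : 0 < m.+1%:R^-1 :> R by rewrite invr_gt0.
have /choice[s sP] : forall m, exists s, rnorm (u - \sum_(x <- s) t x) <= m.+1%:R^-1.
  by move=> m; exact: tensor_dense.
have st : tends (fun m => \sum_(x <- s m) t x) u.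
  move=> eps /inv_succ_le[N Ne]; exists N => m Nm.
  by rewrite rnormBC (le_trans (sP _))// Ne.
apply: (tends_unique (tends_linear L1c st)).
have := tends_linear L2c st; congr tends; apply/funext => m /=.
by rewrite !linear_sum; apply: eq_bigr => x _.
Qed.

(** An operator that is only known to be bounded has the norm that it has on elementary
    tensors.  The crude constant [c1] serves for the passage to the completion alone. *)
Lemma tensor_linear_le (W : normedModType K) (L : {linear X -> W}) (c c1 : R) :
  0 <= c -> (forall u, rnorm (L u) <= c1 * rnorm u) ->
  (forall x, rnorm (L (t x)) <= c * \prod_i rnorm (x i)) ->
  forall u, rnorm (L u) <= c * rnorm u.
Proof.
move=> c0 Lc1 Lc u.
have Lm : multilin W (fun x => L (t x)).
  by move=> x i a v w; rewrite tm linearP.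
apply/ler_addgt0Pr => eps e0; pose d := eps / (c + `|c1| + 1).
have D0 : 0 < c + `|c1| + 1 by rewrite ltr_wpDl// addr_ge0.
have [s us] := tensor_dense u (divr_gt0 e0 D0).
have := formal_sum_le Lm c0 Lc s; rewrite -linear_sum => Ls.
have := rnorm_leD (L u) (L (\sum_(x <- s) t x)); rewrite -linearB.
have := Lc1 (u - \sum_(x <- s) t x).
have := rnorm_leD (\sum_(x <- s) t x) u; rewrite (rnormBC _ u).
move: us; rewrite ler_pdivlMr//.
have := ler_wpM2r (rnorm_ge0 (u - \sum_(x <- s) t x)) (ler_norm c1).
move: Ls; set a := rnorm (u - _); set b := rnorm (\sum_(x <- s) _).
move=> Ls h1 h2 h3 h4 h5; apply: le_trans h5 _.
have := ler_wpM2l c0 h3; have := rnorm_ge0 (u - \sum_(x <- s) t x); rewrite -/a.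
by move: h1 h2 h3 h4 Ls; lra.
Qed.

Lemma tensor_strong_cvg (L : nat -> {linear X -> X}) (c : R) :
  (forall m u, rnorm (L m u) <= c * rnorm u) ->
  (forall x, tends (fun m => L m (t x)) (t x)) -> forall u, tends (fun m => L m u) u.
Proof.
move=> Lc Lt u eps e0; have c1 : 0 < 2 * (`|c| + 1) by rewrite mulr_gt0// ltr_wpDl.
have [s us] := tensor_dense u (divr_gt0 e0 c1).
have /(_ _ (divr_gt0 e0 (ltr0Sn R 1)))[N sN] :
    tends (fun m => L m (\sum_(x <- s) t x)) (\sum_(x <- s) t x).
  have := tends_sum s Lt; congr tends.
  by apply/funext => m; rewrite linear_sum.
exists N => m /sN; move: us; rewrite ler_pdivlMr//.
set v := \sum_(x <- s) t x => us Lv.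
have := Lc m (u - v); have := ler_wpM2r (rnorm_ge0 (u - v)) (ler_norm c).
have := rnorm_dist (L m u) (L m v) u; have := rnorm_dist (L m v) v u.
by rewrite (rnormBC v) -(linearB (L m)); move: us Lv; lra.
Qed.

Lemma projective_norm_attained s (eps : R) : 0 < eps -> exists2 s', same_tensor s s' &
  \sum_(x <- s') \prod_i rnorm (x i) <= rnorm (\sum_(x <- s) t x) + eps.
Proof.
move=> e0; have [_ -> _] := Xt.
have hinf : has_inf [set \sum_(x <- s') \prod_i rnorm (x i) | s' in same_tensor s].
  split; first by eexists; exists s.
  by exists 0 => _ [s' _ <-]; exact: cost_ge0.
by have [_ [s' ss' <-] /ltW h] := inf_adherent e0 hinf; exists s'.
Qed.

(** Approximations s_h of [u] with fast decreasing errors make [u] a telescoping series;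
    writing s_0 and each difference s_(h+1) - s_h as a formal sum of almost minimal cost and
    concatenating these gives the series. *)
Theorem projective_series u (eps : R) : 0 < eps ->
  exists x : nat -> T,
    (forall m, \sum_(j < m) \prod_i rnorm (x j i) <= rnorm u + eps) /\
    tends (fun m => \sum_(j < m) t (x j)) u.
Proof.
move=> e0; pose d h : R := eps / 8 / 2 ^+ h.
have d0 h : 0 < d h by rewrite !divr_gt0// exprn_gt0.
have d00 : d 0%N = eps / 8 by rewrite /d expr0 divr1.
have dS h : d h.+1 = d h / 2 by rewrite /d exprS invfM mulrA mulrAC.
have /choice[s sP] : forall h, exists s, rnorm (u - \sum_(x <- s) t x) <= d h.
  by move=> h; exact: tensor_dense.
pose diff h : seq T := if h is i.+1 then s i.+1 ++ scale_formal (-1) (s i) else s 0%N.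
have /choice[q qP] : forall h, exists s', same_tensor (diff h) s' /\
    \sum_(x <- s') \prod_i rnorm (x i) <= rnorm (\sum_(x <- diff h) t x) + d h.
  by move=> h; have [s'] := projective_norm_attained (diff h) (d0 h); exists s'.
(* The zero tensor is prepended to each block because blocks have to be nonempty. *)
pose z : T := fun=> 0; pose l h := z :: q h.
have tz : t z = 0 by have := multilinear0 tm z i0; rewrite dfwith_eta.
have lz h (S : nmodType) (g : T -> S) : g z = 0 ->
    \sum_(x <- l h) g x = \sum_(x <- q h) g x.
  by move=> gz; rewrite big_cons gz add0r.
have [x [N [Ni xN]]] := flatten_blocks z (l := l) (fun=> isT).
have tl h : \sum_(i < h.+1) \sum_(y <- l i) t y = \sum_(x <- s h) t x.
  elim: h => [|h IH].
    by rewrite big_ord1 lz// -((qP 0%N).1 X t tm).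
  rewrite big_ord_recr/= IH lz// -((qP h.+1).1 X t tm) big_cat/=.
  by rewrite sum_scale_formal// scaleN1r addrC subrK.
have cz : \prod_i rnorm (z i) = 0 by rewrite (bigD1 i0)//= rnorm0 mul0r.
have cl h : \sum_(i < h) \sum_(y <- l i) \prod_i rnorm (y i) <= rnorm u + eps - 8 * d h.
  elim: h => [|h IH].
    by rewrite big_ord0 d00; have := rnorm_ge0 u; move: e0; lra.
  rewrite big_ord_recr/= lz//.
  have := (qP h).2; case: h IH => [|h] IH /=.
    rewrite big_ord0 dS; have := sP 0%N; rewrite rnormBC.
    have := rnorm_leD (\sum_(x <- s 0%N) t x) u.
    by rewrite d00; move: e0; lra.
  rewrite big_cat/= sum_scale_formal// scaleN1r !dS.
  have := sP h; have := sP h.+1; rewrite dS (rnormBC u (\sum_(x <- s h.+1) _)).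
  have := rnorm_dist (\sum_(x <- s h.+1) t x) u (\sum_(x <- s h) t x).
  by move: IH; rewrite dS; have := d0 h; lra.
have xC m : \sum_(j < m) \prod_i rnorm (x j i) <= rnorm u + eps.
  apply: (@le_trans _ _ (\sum_(j < N m) \prod_i rnorm (x j i))).
    rewrite -!(big_mkord xpredT (fun j => \prod_i rnorm (x j i))).
    rewrite (big_cat_nat (n := m) (leq0n m) (Ni m))/= lerDl sumr_ge0// => j _.
    by apply: prodr_ge0 => i _; exact: rnorm_ge0.
  rewrite (xN _ (fun y => \prod_i rnorm (y i))) (le_trans (cl m))//.
  by rewrite lerBlDr lerDl mulr_ge0// ltW.
exists x; split=> //.
have [m|w tw] := complete_rcomplete (@summable_rcauchy _ _ X (t \o x) (rnorm u + eps) _).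
  by apply: le_trans (xC m); apply: ler_sum => j _; exact: rnorm_tensor_le.
suff -> : u = w by [].
have sub : tends (fun h => \sum_(x <- s h) t x) w.
  have := tends_sub (g := fun h => N h.+1) (fun h => ltnW (Ni h.+1)) tw; congr tends.
  by apply/funext => h /=; rewrite (xN _ t) tl.
apply: tends_unique sub => eps' e0'.
have e8 : 0 < eps / 8 by rewrite divr_gt0.
have [M Me] := inv_succ_le (divr_gt0 e0' e8); exists M => m Mm.
rewrite rnormBC (le_trans (sP m))// (@le_trans _ _ (eps / 8 * m.+1%:R^-1))//.
  rewrite ler_wpM2l ?(ltW e8)// lef_pV2 ?posrE ?exprn_gt0 ?ltr0n// -natrX ler_nat.
  exact: ltn_expl.
by rewrite mulrC -ler_pdivlMr// Me.
Qed.

End ProjectiveCompletion.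

(** * Vector measures and Riemann sums *)
Section BorelSets.
Variable Omega : topologicalType.
Implicit Types A B : set Omega.

Let bsigma : sigma_algebra setT (@borel Omega).
Proof. exact: smallest_sigma_algebra. Qed.

Lemma borel0 : borel (set0 : set Omega).
Proof. by case: bsigma. Qed.

Lemma borelC A : borel A -> borel (~` A).
Proof. by move=> Ab; rewrite -setTD; case: bsigma => _ + _; apply. Qed.

Lemma borelT : borel (setT : set Omega).
Proof. by rewrite -setC0; apply: borelC; exact: borel0. Qed.

Lemma borel_bigcup (A : nat -> set Omega) :
  (forall i, borel (A i)) -> borel (\bigcup_i A i).
Proof. by move=> Ab; case: bsigma => _ _; apply. Qed.

Lemma borelU A B : borel A -> borel B -> borel (A `|` B).
Proof.
move=> Ab Bb; rewrite -bigcup2E; apply: borel_bigcup => -[|[|i]] //=.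
exact: borel0.
Qed.

Lemma borelI A B : borel A -> borel B -> borel (A `&` B).
Proof.
by move=> Ab Bb; rewrite -[A]setCK -[B]setCK -setCU; do 2?apply: borelC;
  apply: borelU; exact: borelC.
Qed.

Lemma borelD A B : borel A -> borel B -> borel (A `\` B).
Proof. by move=> Ab Bb; rewrite setDE; apply: borelI => //; exact: borelC. Qed.

Lemma borel_open A : open A -> borel A.
Proof. by move=> Ao; exact: sub_sigma_algebra. Qed.

Lemma borel_closed A : closed A -> borel A.
Proof.
move=> Ac; rewrite -[A]setCK; apply: borelC; apply: borel_open.
by rewrite openC.
Qed.

Lemma borel_bigsetU (J : Type) (r : seq J) (A : J -> set Omega) :
  (forall j, borel (A j)) -> borel (\big[setU/set0]_(j <- r) A j).
Proof.
by move=> Ab; elim/big_ind: _ => //; [exact: borel0|exact: borelU].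
Qed.

Lemma borel_forall (J : finType) (A : J -> set Omega) :
  (forall j, borel (A j)) -> borel [set w | forall j, A j w].
Proof.
move=> Ab; have -> : [set w | forall j, A j w] = ~` \big[setU/set0]_j ~` A j.
  rewrite -bigcup_seq; apply/seteqP; split=> [w Aw [j _]|w Aw j]; first by apply; exact: Aw.
  by apply: contrapT => Ajw; apply: Aw; exists j => //=; rewrite mem_index_enum.
by apply: borelC; apply: borel_bigsetU => j; exact: borelC.
Qed.
End BorelSets.

Section VectorMeasure.
Variables (R : realType) (k : ground).
Local Notation K := (scalars R k).
Variables (Omega : topologicalType) (V : normedModType K) (mu : set Omega -> V).
Implicit Types A B : set Omega.
Hypothesis mum : vector_measure mu.

Lemma vector_measure_tends (A : nat -> set Omega) :
  (forall j, borel (A j)) -> trivIset setT A ->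
  tends (fun m => \sum_(j < m) mu (A j)) (mu (\bigcup_j A j)).
Proof.
move=> Ab At; have /tendsP := mum Ab At; congr tends.
by apply/funext => m; rewrite /series/= big_mkord.
Qed.

Lemma vector_measure0 : mu set0 = 0.
Proof.
have h := vector_measure_tends (fun=> @borel0 Omega) (@trivIset_set0 _ _ setT).
have hS := tends_sub (g := S) (fun m => leqnSn m) h.
have := tendsB hS h; rewrite subrr => /(tends_unique _); apply.
rewrite (_ : (fun m => _) = fun=> mu set0); first exact: tends_cst.
by apply/funext => m /=; rewrite big_ord_recr/= addrAC subrr add0r.
Qed.

Lemma vector_measureU A B : borel A -> borel B -> A `&` B = set0 ->
  mu (A `|` B) = mu A + mu B.
Proof.
move=> Ab Bb AB0; rewrite -bigcup2E.
have bb i : borel (bigcup2 A B i).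
  by case: i => [|[|i]] //; exact: borel0.
have bt : trivIset setT (bigcup2 A B).
  move=> [|[|i]] [|[|j]] _ _ //=; rewrite ?setI0 ?set0I ?(setIC B) ?AB0;
    by move=> /set0P; rewrite eqxx.
apply: tends_unique (vector_measure_tends bb bt) _.
apply: (@tends_eventually _ _ _ (fun=> mu A + mu B) _ _ 2); last exact: tends_cst.
move=> [|[|m]] // _; rewrite big_ord_recl/= big_ord_recl/= big1 ?addr0//.
by move=> i _; rewrite /bigcup2/= vector_measure0.
Qed.

Lemma vector_measure_partition (J : finType) (B : J -> set Omega) A :
  borel A -> (forall j, borel (B j)) -> trivIset setT B -> \bigcup_j B j = setT ->
  mu A = \sum_j mu (A `&` B j).
Proof.
move=> Ab Bb Bt BT.
have AE : A = A `&` \big[setU/set0]_j B j.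
  rewrite -bigcup_seq (_ : \bigcup_(j in _) _ = setT) ?setIT//.
  apply/seteqP; split=> // w _.
  have [j _ Bjw] : (\bigcup_j B j) w by rewrite BT.
  by exists j => //=; rewrite mem_index_enum.
rewrite [in LHS]AE; have := index_enum_uniq J.
elim: (index_enum J) => [|j r IH /= /andP[jr ru]].
  by rewrite !big_nil setI0 vector_measure0.
rewrite !big_cons setIUr vector_measureU ?IH//.
- exact: borelI.
- by apply: borelI => //; exact: borel_bigsetU.
- apply/seteqP; split=> // w [[_ Bjw] [_]]; rewrite -bigcup_seq => -[i /= ir Biw].
  have ij : i = j by apply: Bt => //; exists w.
  by move: jr; rewrite -ij ir.
Qed.

Lemma vector_measure_cvg (B : nat -> set Omega) A :
  borel A -> (forall i, borel (B i)) -> (forall i, B i `<=` B i.+1) ->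
  \bigcup_i B i = setT -> tends (fun m => mu (A `&` B m)) (mu A).
Proof.
move=> Ab Bb Binc BT.
have Bmono : {homo B : i j / (i <= j)%N >-> (i <= j)%O}.
  by apply/nondecreasing_seqP => i; apply/subsetPset; exact: Binc.
pose D i := A `&` seqD B i.
have Db i : borel (D i).
  by apply: borelI => //; case: i => [|i] /=; [|apply: borelD].
have Dt : trivIset setT D.
  by apply: trivIset_setIl; exact: trivIset_seqD.
have DA : \bigcup_i D i = A.
  by rewrite -setI_bigcupr eq_bigcup_seqD BT setIT.
have h := tends_sub (g := S) (fun m => leqnSn m) (vector_measure_tends Db Dt).
rewrite DA in h; move: h; congr tends; apply/funext => m /=.
elim: m => [|m IH]; first by rewrite big_ord1.
rewrite big_ord_recr/= IH -vector_measureU//.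
- congr mu; apply/seteqP; split=> w; first by move=> [[Aw /Binc]|[Aw []]].
  by move=> [Aw Bw]; have [Bmw|Bmw] := pselect (B m w); [left|right].
- exact: borelI.
- by apply/seteqP; split=> // w [[_ Bw] [_ /= [_]]].
Qed.

End VectorMeasure.

Section Variation.
Variables (R : realType) (k : ground).
Local Notation K := (scalars R k).
Variables (Omega : topologicalType) (V : normedModType K) (mu : set Omega -> V).
Implicit Types A B : set Omega.

Lemma variation_finsum (J : finType) (B : J -> set Omega) A :
  (forall j, borel (B j)) -> trivIset setT B -> \bigcup_j B j = A ->
  ((\sum_j rnorm (mu (B j)))%:E <= Defs.variation mu A)%E.
Proof.
move=> Bb Bt BA; apply: ereal_sup_ubound.
exists #|J|, (fun i => B (enum_val i)); split=> //.
- by move=> i j _ _ ij; apply: enum_val_inj; exact: Bt.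
- rewrite -BA; apply/seteqP; split=> w [j _ Bw]; first by exists (enum_val j).
  by exists (enum_rank j) => //; rewrite enum_rankK.
- by congr EFin; rewrite [LHS](reindex_onto enum_val enum_rank) => [|i _];
    rewrite ?enum_rankK//; apply: eq_bigl => i; rewrite enum_valK eqxx.
Qed.

Hypothesis muV : Defs.bounded_variation mu.

Lemma variation_fin : Defs.variation mu setT \is a fin_num.
Proof.
rewrite fin_real//; apply/andP; split=> //.
have := @variation_finsum 'I_1 (fun=> setT) setT (fun=> @borelT _).
move=> /(_ _ _)/(lt_le_trans (ltNyr _)); apply; first by move=> i j _ _ _; rewrite !ord1.
by apply/seteqP; split=> // w _; exists ord0.
Qed.

Lemma variation_sum (J : finType) (B : J -> set Omega) :
  (forall j, borel (B j)) -> trivIset setT B -> \bigcup_j B j = setT ->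
  \sum_j rnorm (mu (B j)) <= Defs.total_variation mu.
Proof.
by move=> Bb Bt BT; rewrite -lee_fin fineK ?variation_fin//; exact: variation_finsum.
Qed.

Lemma total_variation_ge0 : 0 <= Defs.total_variation mu.
Proof.
apply: le_trans (variation_sum (J := 'I_1) (B := fun=> setT) _ _ _).
- by apply: sumr_ge0 => i _; exact: rnorm_ge0.
- by move=> j; exact: borelT.
- by move=> i j _ _ _; rewrite !ord1.
- by apply/seteqP; split=> // w _; exists ord0.
Qed.

Lemma variation_approx (eps : R) : 0 < eps -> exists (m : nat) (B : 'I_m -> set Omega),
  [/\ forall j, borel (B j), trivIset setT B, \bigcup_j B j = setT &
      Defs.total_variation mu - eps <= \sum_j rnorm (mu (B j))].
Proof.
move=> e0; have [_ [m [B [Bb Bt BT ->]]]] := ub_ereal_sup_adherent e0 variation_fin.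
rewrite -/(Defs.variation mu setT) -(fineK variation_fin) -EFinB lte_fin => /ltW h.
by exists m, B.
Qed.

Hypothesis mum : vector_measure mu.

(** The pieces of a partition that nearly attains the variation, cut down to [B M], lose
    little for large [M] by countable additivity.  Together with the given pieces outside of
    [B M] they form another partition, so that little variation is left for the latter. *)
Lemma variation_tail (B : nat -> set Omega) (eps : R) :
  (forall i, borel (B i)) -> (forall i, B i `<=` B i.+1) -> \bigcup_i B i = setT ->
  0 < eps -> exists M, forall (J : finType) (A : J -> set Omega) (P : pred J),
    (forall j, borel (A j)) -> trivIset setT A -> \bigcup_j A j = setT ->
    (forall j, P j -> A j `<=` B M) -> (forall j, ~~ P j -> A j `<=` ~` B M) ->
    \sum_(j | ~~ P j) rnorm (mu (A j)) <= eps.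
Proof.
move=> Bb Binc BT e0; have e2 := divr_gt0 e0 (ltr0Sn R 1).
have [m [D [Db Dt DT Dmu]]] := variation_approx e2.
have [N DN] : exists N, forall M, (N <= M)%N -> forall j,
    rnorm (mu (D j `&` B M) - mu (D j)) <= eps / 2 / m.+1%:R.
  have e3 : 0 < eps / 2 / m.+1%:R by rewrite divr_gt0.
  have /choice[N NP] : forall j, exists N, forall M, (N <= M)%N ->
      rnorm (mu (D j `&` B M) - mu (D j)) <= eps / 2 / m.+1%:R.
    by move=> j; exact: (vector_measure_cvg mum (Db j) Bb Binc BT e3).
  exists (\max_j N j)%N => M NM j; apply: NP; apply: leq_trans NM.
  exact: leq_bigmax.
exists N => J A P Ab At AT AP AnP.
pose C (j : 'I_m + J) : set Omega :=
  match j with inl i => D i `&` B N | inr j => if P j then set0 else A j end.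
have Cb j : borel (C j).
  case: j => [i|j] /=; first exact: borelI.
  by case: (P j) => //; exact: borel0.
have Ct : trivIset setT C.
  move=> [i|i] [j|j] _ _ /=.
  - by move=> [w [[Diw _] [Djw _]]]; congr inl; apply: Dt => //; exists w.
  - case: (boolP (P j)) => Pj [w []]// [_ Bw] /(AnP _ Pj)//.
  - case: (boolP (P i)) => Pi [w []]// /(AnP _ Pi) nB [_ Bw]; case: (nB Bw).
  - case: (P i) => [[w []]|]//; case: (P j) => [[w []]|]// [w [Aiw Ajw]].
    by congr inr; apply: At => //; exists w.
have CT : \bigcup_j C j = setT.
  apply/seteqP; split=> // w _; have [Bw|nBw] := pselect (B N w).
    have [i _ Diw] : (\bigcup_j D j) w by rewrite DT.
    by exists (inl i).
  have [j _ Ajw] : (\bigcup_j A j) w by rewrite AT.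
  exists (inr j) => //=; case: (boolP (P j)) => // /AP/(_ w Ajw).
  exact: nBw.
have := variation_sum Cb Ct CT; rewrite big_sumType/=.
have -> : \sum_(j : J) rnorm (mu (if P j then set0 else A j)) =
    \sum_(j | ~~ P j) rnorm (mu (A j)).
  rewrite [RHS]big_mkcond; apply: eq_bigr => j _.
  by case: (P j) => //; rewrite vector_measure0// rnorm0.
have : \sum_j rnorm (mu (D j)) <= \sum_j rnorm (mu (D j `&` B N)) + eps / 2.
  apply: (@le_trans _ _ (\sum_(j < m) (rnorm (mu (D j `&` B N)) + eps / 2 / m.+1%:R))).
    apply: ler_sum => j _; have := DN N (leqnn N) j.
    move: (eps / 2 / _) => d; rewrite rnormBC => h.
    by apply: le_trans (rnorm_leD _ (mu (D j `&` B N))) _; rewrite lerD2l.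
  rewrite big_split/= lerD2l sumr_const card_ord -[_ *+ m]mulr_natr.
  rewrite [_ / m.+1%:R * _]mulrAC ler_pdivrMr//.
  by rewrite ler_wpM2l ?(ltW e2)// ler_nat.
move: Dmu; lra.
Qed.

(** The partition consists of the nonempty atoms generated by [B] and by the sets of simple
    functions close to the integrands: on each atom all these simple functions are constant. *)
Lemma riemann_sums (J : finType) (phi : J -> Omega -> K) (y : J -> V) B (eps : R) :
  borel B -> (forall j, is_integral mu (phi j) (y j)) -> 0 < eps ->
  exists (I : finType) (A : I -> set Omega) (w : I -> Omega),
    [/\ forall i, borel (A i), trivIset setT A, \bigcup_i A i = setT,
        forall i v, A i v -> (B v <-> B (w i)) &
        forall j, rnorm (y j - \sum_i phi j (w i) *: mu (A i)) <= eps].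
Proof.
move=> Bb phiy e0; pose tv := Defs.total_variation mu.
have tv0 : 0 < tv + 1 by rewrite ltr_wpDl// total_variation_ge0.
have d0 : 0 < eps / 2 / (tv + 1) by rewrite !divr_gt0.
have /choice[s sP] : forall j, exists s : simple_function R k Omega,
    (forall w, rnorm (phi j w - simple_eval s w : K^o) <= eps / 2 / (tv + 1)) /\
    rnorm (simple_integral mu s - y j) <= eps / 2.
  move=> j; have [s [/(_ _ d0)[N _ sN] /tendsP/(_ _ (divr_gt0 e0 (ltr0Sn R 1)))[M sM]]] := phiy j.
  exists (s (maxn N M)); split; last by apply: sM; exact: leq_maxr.
  by apply: sN; exact: leq_maxl.
pose L := option {j : J & 'I_(simple_size (s j))}.
pose D (l : L) : set Omega := if l is Some l then simple_set (tagged l) else B.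
have Db l : borel (D l) by case: l => [l|] //=; exact: simple_borel.
pose At (f : {ffun L -> bool}) := [set w | forall l, D l w <-> f l].
have Atb f : borel (At f).
  apply: borel_forall => l; case: (f l).
    suff -> : (fun w => D l w <-> true) = D l by [].
    by apply/seteqP; split=> w //= [_]; apply.
  suff -> : (fun w => D l w <-> false) = ~` D l by exact: borelC.
  by apply/seteqP; split=> w /=; [move=> [h _ /h]|move=> nD; split=> // /nD].
pose I := {f : {ffun L -> bool} | `[< At f !=set0 >]}.
have /choice[w wP] : forall i : I, exists w, At (val i) w.
  by move=> [f /= /asboolP].
exists I, (fun i => At (val i)), w.
have At_triv : trivIset setT (fun i : I => At (val i)).
  move=> i j _ _ [v [iv jv]]; apply/val_inj/ffunP => l.
  by apply/idP/idP => /[dup] h; [move/iv/jv|move/jv/iv].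
have AT : \bigcup_(i in [set: I]) At (val i) = setT.
  apply/seteqP; split=> // v _; pose f : {ffun L -> bool} := [ffun l => `[< D l v >]].
  have fv : At f v by move=> l; rewrite ffunE; split=> /asboolP.
  have fP : `[< At f !=set0 >] by apply/asboolP; exists v.
  by exists (Sub f fP).
have Dw i v l : At (val i) v -> D l v <-> D l (w i).
  by move=> iv; split=> [/iv/(wP i)|/(wP i)/iv].
split=> //; first by move=> i v /(Dw _ _ None).
move=> j; have sE : simple_integral mu (s j) =
    \sum_(i : I) simple_eval (s j) (w i) *: mu (At (val i)).
  rewrite /simple_integral.
  under [RHS]eq_bigr do rewrite /simple_eval scaler_suml.
  rewrite exchange_big/=; apply: eq_bigr => l _.
  rewrite (vector_measure_partition mum (simple_borel l) (fun i : I => Atb (val i)) At_triv AT).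
  rewrite scaler_sumr; apply: eq_bigr => i _; rewrite -scalerA; congr (_ *: _).
  pose l' : L := Some (Tagged (fun j => 'I_(simple_size (s j))) l).
  have [wl|wl] := pselect (simple_set l (w i)).
    rewrite mem_set// scale1r; congr mu; apply/seteqP; split=> [v []//|v iv].
    by split=> //; exact/(Dw _ _ l' iv).
  rewrite memNset// scale0r (_ : _ `&` _ = set0) ?vector_measure0//.
  by apply/seteqP; split=> // v [lv iv]; apply: wl; exact/(Dw _ _ l' iv).
have [s1 s2] := sP j.
have h : rnorm (simple_integral mu (s j) - \sum_(i : I) phi j (w i) *: mu (At (val i))) <= eps / 2.
  rewrite sE -sumrB (le_trans (rnorm_sum _ _ _))//.
  apply: (@le_trans _ _ (eps / 2 / (tv + 1) * \sum_(i : I) rnorm (mu (At (val i))))).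
    rewrite mulr_sumr; apply: ler_sum => i _; rewrite -scalerBl rnormZ.
    by rewrite ler_wpM2r ?rnorm_ge0// (rnormBC (_ : K^o)).
  rewrite -mulrA ler_piMr ?divr_ge0 ?(ltW e0)// mulrC ler_pdivrMr// mul1r.
  apply: le_trans (_ : tv <= _); last by rewrite lerDl.
  by apply: variation_sum => // i; exact: Atb.
have := rnorm_dist (y j) (simple_integral mu (s j)) (\sum_(i : I) phi j (w i) *: mu (At (val i))).
by rewrite (rnormBC (y j) (simple_integral _ _)); move: h s2; lra.
Qed.
End Variation.

(** * The discrete measure of an absolutely convergent series *)
Section ScalarNet.
Variable R : realType.

Lemma real_net (M eps : R) : 0 < eps -> exists (N : nat) (g : nat -> R),
  forall c, `|c| <= M -> exists2 j, (j < N)%N & `|c - g j| <= eps.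
Proof.
move=> e0; exists (Num.truncn ((M + M) / eps)).+1, (fun j => j%:R * eps - M) => c cM.
have cM0 : 0 <= (c + M) / eps.
  apply: divr_ge0; last exact: ltW.
  by move: cM; rewrite ler_norml => /andP[]; lra.
exists (Num.truncn ((c + M) / eps)).
  rewrite ltnS le_truncn// ler_pM2r ?invr_gt0// lerD2r.
  by rewrite (le_trans (ler_norm c)).
have /andP[h1 h2] := truncn_itv cM0.
move: h1 h2; rewrite ler_pdivlMr// ltr_pdivrMr// -natr1 => h1 h2.
by rewrite ler_norml; move: h1 h2; lra.
Qed.

Variable k : ground.

Lemma scalar_net (M eps : R) : 0 < eps -> exists (N : nat) (g : nat -> scalars R k),
  forall c, rnorm (c : (scalars R k)^o) <= M ->
    exists2 j, (j < N)%N & rnorm (c - g j : (scalars R k)^o) <= eps.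
Proof.
case: k => e0; first exact: real_net.
have [N [g gP]] := real_net M (divr_gt0 e0 (ltr0Sn R 1)).
exists (N * N)%N, (fun j => Complex (g (j %/ N)%N) (g (j %% N)%N)) => -[a b] cM.
have [ha hb _] := normc_le (a +i* b)%C.
have [i iN ai] := gP a (le_trans ha cM).
have [j jN bj] := gP b (le_trans hb cM).
have N0 : (0 < N)%N by apply: leq_ltn_trans iN.
exists (i * N + j)%N.
  by rewrite (@leq_trans (i.+1 * N)%N) ?leq_mul2r ?iN ?orbT// mulSn addnC ltn_add2r.
rewrite divnMDl// divn_small// addn0 modnMDl modn_small//.
have [_ _ h] := normc_le ((a +i* b)%C - (g i +i* g j)%C).
by apply: le_trans h _; move: ai bj => /=; lra.
Qed.
End ScalarNet.

Lemma closed_rnorm_le (R : realType) (k : ground) (Omega : topologicalType)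
    (V : normedModType (scalars R k)) (f : Omega -> V) (c : V) (r : R) :
  continuous f -> closed [set x | rnorm (f x - c) <= r].
Proof.
move=> fc x xA; apply/ler_addgt0Pr => eps e0.
have /cvgrPdist_le/(_ (of_real k eps)) := fc x.
rewrite -(of_real0 R k) of_real_lt => /(_ e0)/xA[y [/= yA xy]].
move: xy; rewrite -rnormE of_real_le => xy.
by have := rnorm_dist (f x) (f y) c; lra.
Qed.

Section DiscreteMeasure.
Variables (R : realType) (k : ground).
Local Notation K := (scalars R k).
Variables (Omega : topologicalType) (V : normedModType K).
Variables (w : nat -> Omega) (v : nat -> V) (C : R).
Hypotheses (Vc : rcomplete V) (vC : forall m, \sum_(j < m) rnorm (v j) <= C).
Implicit Types A B : set Omega.

Lemma weighted_series (c : nat -> K) (M : R) : (forall j, rnorm (c j : K^o) <= M) ->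
  exists l, tends (fun m => \sum_(j < m) c j *: v j) l.
Proof.
move=> cM; have M0 : 0 <= M by apply: le_trans (cM 0%N); exact: rnorm_ge0.
apply: Vc; apply: (@summable_rcauchy R k V (fun j => c j *: v j) (M * C)) => m.
apply: (@le_trans _ _ (M * \sum_(j < m) rnorm (v j))); last by rewrite ler_wpM2l.
by rewrite mulr_sumr; apply: ler_sum => j _; rewrite rnormZ ler_wpM2r ?rnorm_ge0.
Qed.

Lemma rnorm_bool (b : bool) : rnorm (b%:R : K^o) <= 1.
Proof. by case: b; rewrite ?rnorm1// (@rnorm0 _ _ K^o). Qed.

Lemma discrete_measure_subproof : exists mu : set Omega -> V,
  forall A, tends (fun m => \sum_(j < m) (w j \in A)%:R *: v j) (mu A).
Proof.
have /choice[mu muP] : forall A, exists l, tends (fun m => \sum_(j < m) (w j \in A)%:R *: v j) l.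
  move=> A; apply: (@weighted_series (fun j => (w j \in A)%:R) 1) => j.
  exact: rnorm_bool.
by exists mu.
Qed.

(** The sum of the point masses [v j] at [w j].  Every subset of the space gets a value. *)
Definition discrete_measure := projT1 (cid discrete_measure_subproof).
Local Notation mu := discrete_measure.

Lemma discrete_measureP A :
  tends (fun m => \sum_(j < m) (w j \in A)%:R *: v j) (mu A).
Proof. exact: (projT2 (cid discrete_measure_subproof)). Qed.

Lemma mem_bigsetU_sum (A : nat -> set Omega) n x : trivIset setT A ->
  \sum_(i < n) (x \in A i)%:R = (x \in \big[setU/set0]_(i < n) A i)%:R :> K.
Proof.
move=> At; elim: n => [|n IH]; first by rewrite !big_ord0 in_set0.
rewrite !big_ord_recr/= IH in_setU; case: (boolP (x \in A n)) => xn; last by rewrite orbF addr0.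
rewrite (_ : (x \in _) = false) ?add0r//; apply/negP; rewrite inE => xU.
move: xU xn; rewrite -bigcup_mkord inE => -[i /= i_n xi] xn.
have : i = n by apply: At => //; exists x.
by move=> ie; rewrite ie ltnn in i_n.
Qed.

Lemma discrete_vector_measure : vector_measure mu.
Proof.
move=> A Ab At; apply/tendsP => eps e0.
have [N Ne] := summable_tail (fun j => rnorm_ge0 (v j)) vC e0.
have /choice[f fP] : forall j, exists i, (\bigcup_i A i) (w j) -> A i (w j).
  move=> j; have [[i _ Ai]|n] := pselect ((\bigcup_i A i) (w j)); first by exists i.
  by exists 0%N => /n.
exists (\max_(j < N) (f j).+1)%N => n Nn; rewrite rnormBC.
pose U n := \big[setU/set0]_(i < n) A i.
have sumU : tends (fun m => \sum_(j < m) (w j \in U n)%:R *: v j) (series (mu \o A) n).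
  rewrite /series/= big_mkord.
  have := tends_sum (index_enum 'I_n) (fun i : 'I_n => discrete_measureP (A i)).
  congr tends; apply/funext => m; rewrite exchange_big/=; apply: eq_bigr => j _.
  by rewrite -scaler_suml mem_bigsetU_sum.
apply: (tends_dist (N := N) _ (discrete_measureP _) sumU) => m Nm.
rewrite -sumrB -(big_mkord xpredT
  (fun j => (w j \in \bigcup_i A i)%:R *: v j - (w j \in U n)%:R *: v j)).
rewrite (big_cat_nat (n := N) (leq0n N) Nm)/= big_nat big1 ?add0r => [|j /= jN].
  apply: le_trans (rnorm_sum _ _ _) _; apply: le_trans (Ne m).
  apply: ler_sum => j _; rewrite -scalerBl rnormZ ler_piMl ?rnorm_ge0//.
  case: (boolP (w j \in U n)) => wU; last by rewrite subr0 rnorm_bool.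
  rewrite mem_set ?subrr ?(@rnorm0 _ _ K^o)//.
  by move: wU; rewrite inE /U -bigcup_mkord => -[i _ Ai]; exists i.
rewrite -scalerBl; case: (boolP (w j \in \bigcup_i A i)) => wA.
  rewrite mem_set ?subrr ?scale0r// /U -bigcup_mkord.
  exists (f j); last by apply: fP; move: wA; rewrite inE.
  by apply: leq_trans Nn; exact: (leq_bigmax (Ordinal jN)).
rewrite memNset ?subrr ?scale0r// /U -bigcup_mkord => -[i _ Ai].
by move/negP: wA; apply; rewrite inE; exists i.
Qed.

Lemma sum_mem_le (J : finType) (B : J -> set Omega) A x : trivIset setT B ->
  (forall j, B j `<=` A) -> \sum_j (x \in B j)%:R <= (x \in A)%:R :> R.
Proof.
move=> Bt BA; have [[j Bjx]|nB] := pselect (exists j, B j x).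
  rewrite (bigD1 j)//= big1 ?addr0; last first.
    move=> i ij; rewrite memNset// => Bix; move/eqP: ij; apply.
    by apply: Bt => //; exists x.
  by rewrite mem_set//= mem_set//; exact: BA Bjx.
rewrite big1; first by rewrite ler0n.
by move=> j _; rewrite memNset// => Bjx; apply: nB; exists j.
Qed.

Lemma discrete_variation_le A (c : R) :
  (forall m, \sum_(j < m) (w j \in A)%:R * rnorm (v j) <= c) ->
  (Defs.variation mu A <= c%:E)%E.
Proof.
move=> Ac; apply: ge_ereal_sup => _ [m [B [Bb Bt BA ->]]]; rewrite lee_fin.
apply/ler_addgt0Pr => eps e0; have e1 : 0 < eps / m.+1%:R by rewrite divr_gt0.
have /choice[N NP] := fun i => discrete_measureP (B i) e1.
pose M := (\max_i N i)%N.
have BM i : rnorm (mu (B i)) <=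
    \sum_(j < M) (w j \in B i)%:R * rnorm (v j) + eps / m.+1%:R.
  apply: le_trans (rnorm_leD _ (\sum_(j < M) (w j \in B i)%:R *: v j)) _.
  rewrite rnormBC lerD//; last by apply: NP; exact: leq_bigmax.
  apply: le_trans (rnorm_sum _ _ _) _; apply: ler_sum => j _; rewrite rnormZ.
  rewrite ler_wpM2r ?rnorm_ge0//.
  by case: (_ \in _); rewrite ?rnorm1// (@rnorm0 _ _ K^o).
apply: le_trans (ler_sum _ (fun i _ => BM i)) _; rewrite big_split/= lerD//.
  rewrite exchange_big/=; apply: le_trans (Ac M); apply: ler_sum => j _.
  rewrite -mulr_suml ler_wpM2r ?rnorm_ge0//; apply: sum_mem_le => // i x Bx.
  by rewrite -BA; exists i.
rewrite sumr_const card_ord -[_ *+ m]mulr_natr [_ / _ * _]mulrAC ler_pdivrMr//.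
by rewrite ler_wpM2l ?(ltW e0)// ler_nat.
Qed.

Lemma discrete_variation_leC : (Defs.variation mu setT <= C%:E)%E.
Proof.
apply: discrete_variation_le => m; apply: le_trans (vC m); apply: ler_sum => j _.
by rewrite in_setT mul1r.
Qed.

Lemma discrete_bounded_variation : Defs.bounded_variation mu.
Proof. exact: le_lt_trans discrete_variation_leC (ltry _). Qed.

Lemma discrete_total_variation : Defs.total_variation mu <= C.
Proof.
rewrite -lee_fin fineK ?variation_fin//; first exact: discrete_variation_leC.
exact: discrete_bounded_variation.
Qed.

(** Up to [eps], the measure lives on finitely many of the points [w j], and finite sets are
    compact and closed. *)
Lemma discrete_regular : hausdorff_space Omega -> regular mu.
Proof.
move=> Oh A eps Ab e0; have e2 := divr_gt0 e0 (ltr0Sn R 1).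
have [N Ne] := summable_tail (fun j => rnorm_ge0 (v j)) vC e2.
pose head (P : set Omega) := (w @` [set j | (j < N)%N]) `&` P.
have head_fin P : finite_set (head P).
  by apply: finite_setIl; apply: finite_image; exact: finite_II.
exists (head A), (~` head (~` A)); split.
- exact: finite_compact.
- rewrite openC; have /accessible_finite_set_closed := hausdorff_accessible Oh.
  exact.
- by move=> x [].
- by move=> x Ax [_].
apply: (@le_lt_trans _ _ (eps / 2)%:E); last by rewrite lte_fin; move: e0; lra.
apply: discrete_variation_le => m; apply: le_trans (Ne m).
have out j : (j < N)%N -> (w j \in ~` head (~` A) `\` head A) = false.
  move=> jN; apply/negP; rewrite inE => -[nA' nA].
  have [Aw|nAw] := pselect (A (w j)); first by apply: nA; split=> //; exists j.
  by apply: nA'; split=> //; exists j.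
rewrite -(big_mkord xpredT (fun j => (w j \in ~` head (~` A) `\` head A)%:R * rnorm (v j))).
have [mN|Nm] := leqP m N.
  rewrite big_nat big1 ?sumr_ge0// => [j _|j /= jm]; first exact: rnorm_ge0.
  by rewrite out ?mul0r//; exact: leq_trans mN.
rewrite (big_cat_nat (n := N) (leq0n N) (ltnW Nm))/= big_nat big1 ?add0r.
  apply: ler_sum => j _; rewrite ler_piMl ?rnorm_ge0//; by case: (_ \in _).
by move=> j /= jN; rewrite out ?mul0r.
Qed.

Lemma discrete_simple_integral (s : simple_function R k Omega) :
  tends (fun m => \sum_(j < m) simple_eval s (w j) *: v j) (simple_integral mu s).
Proof.
have := tends_sum (index_enum 'I_(simple_size s))
  (fun l => tendsZ (simple_coef l) (discrete_measureP (simple_set l))).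
congr tends; apply/funext => m.
under [LHS]eq_bigr do rewrite scaler_sumr.
rewrite exchange_big/=; apply: eq_bigr => j _.
by rewrite /simple_eval scaler_suml; apply: eq_bigr => l _; rewrite scalerA.
Qed.

(** The values of [phi] lie in a bounded set of scalars, which a finite net covers; a point is
    assigned the first element of the net that is close to its value. *)
Lemma simple_approximation (phi : Omega -> K) (M eps : R) :
  (forall x, rnorm (phi x : K^o) <= M) -> continuous (phi : Omega -> K^o) -> 0 < eps ->
  exists s : simple_function R k Omega,
    forall x, rnorm (phi x - simple_eval s x : K^o) <= eps.
Proof.
move=> phiM phic e0; have [N [g gP]] := scalar_net k M e0.
pose A j := [set x | rnorm (phi x - g j : K^o) <= eps].
have Ab j : borel (A j).
  by apply: borel_closed; exact: closed_rnorm_le.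
pose B j := A j `\` \big[setU/set0]_(i < j) A i.
have Bb j : borel (B j) by apply: borelD => //; apply: borel_bigsetU.
exists (@SimpleFunction R k Omega N (fun j => g j) (fun j => B j) (fun j => Bb j)) => x.
have xA : exists j, `[< A j x >].
  by have [j jN xj] := gP _ (phiM x); exists j; apply/asboolP.
case: (ex_minnP xA) => i /asboolP Ai imin.
have iN : (i < N)%N.
  by have [j jN xj] := gP _ (phiM x); rewrite (leq_ltn_trans (imin j _))//; apply/asboolP.
have Bi : B i x.
  split=> //; rewrite -bigcup_mkord => -[j /= ji Aj].
  by have /imin := asboolT Aj; rewrite leqNgt ji.
rewrite /simple_eval (bigD1 (Ordinal iN))//= mem_set// mulr1 big1 ?addr0// => j ji.
rewrite memNset ?mulr0// => -[Aj]; rewrite -bigcup_mkord; apply.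
exists i => //=; rewrite ltn_neqAle imin ?andbT; last exact/asboolP.
by apply: contra ji => /eqP ij; apply/eqP/val_inj.
Qed.

Lemma discrete_is_integral (phi : Omega -> K) (M : R) (y : V) :
  (forall x, rnorm (phi x : K^o) <= M) -> continuous (phi : Omega -> K^o) ->
  tends (fun m => \sum_(j < m) phi (w j) *: v j) y -> is_integral mu phi y.
Proof.
move=> phiM phic phiy.
have inv0 m : 0 < m.+1%:R^-1 :> R by rewrite invr_gt0.
have /choice[s sP] := fun m => simple_approximation phiM phic (inv0 m).
exists s; split=> [eps /inv_succ_le[N Ne]|].
  exists N => // m /= Nm x; exact: le_trans (sP m x) (Ne m Nm).
have C0 : 0 <= C by have := vC 0; rewrite big_ord0.
have C1 : 0 < C + 1 by rewrite ltr_wpDl.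
apply/tendsP => eps e0; have [N Ne] := inv_succ_le (divr_gt0 e0 C1).
exists N => m /Ne me.
apply: (tends_dist (N := 0%N) _ (discrete_simple_integral (s m)) phiy) => l _.
rewrite -sumrB; apply: (@le_trans _ _ (m.+1%:R^-1 * \sum_(j < l) rnorm (v j))).
  rewrite (le_trans (rnorm_sum _ _ _))// mulr_sumr; apply: ler_sum => j _.
  by rewrite -scalerBl rnormZ ler_wpM2r ?rnorm_ge0// (@rnormBC _ _ K^o).
move: me; rewrite ler_pdivlMr//; apply: le_trans; rewrite ler_wpM2l ?(ltW (inv0 m))//.
by apply: le_trans (vC l) _; rewrite lerDl.
Qed.
End DiscreteMeasure.

Lemma rnorm_dual_ball (R : realType) (k : ground) (V : normedModType (scalars R k))
    (f : dual V) (c : R) :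
  (forall x, rnorm x <= 1 -> rnorm (f x) <= c) -> rnorm f <= c.
Proof. by move=> fc; rewrite rnorm_dualE; exact: dual_rnorm_le. Qed.

(** * Sections of an integral operator along the dual bases *)
Section BallProduct.
Variables (R : realType) (k : ground).
Local Notation K := (scalars R k).
Variables (n : nat) (E : 'I_n -> normedModType K).

Definition ball_point (w : ball_product E) (i : 'I_n) : dual (E i) := val (w i).

Lemma ball_point_le w i : rnorm (ball_point w i) <= 1.
Proof. by have := set_valP (w i). Qed.

Lemma ball_point_continuous i (x : E i) :
  continuous (fun w : ball_product E => ball_point w i x : K^o).
Proof.
move=> w.
have h1 := @proj_continuous _ (fun i => weak_star_ball (E i)) i w.
have h2 := @initial_continuous _ _ (@eval_ball R k (E i)) (w i).
have h3 := @proj_continuous (E i) (fun=> K^o) x (eval_ball (w i)).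
exact: (continuous_comp (continuous_comp h1 h2) h3).
Qed.

Lemma eval_product_continuous (x : forall i, E i) :
  continuous (eval_product x : ball_product E -> K^o).
Proof.
apply: (@continuous_big _ _ (@GRing.mul K^o)) => [[a b]|i _].
  exact: mul_continuous.
exact: ball_point_continuous.
Qed.

Lemma rnorm_eval_product (x : forall i, E i) (w : ball_product E) :
  rnorm (eval_product x w : K^o) <= \prod_i rnorm (x i).
Proof.
rewrite rnorm_prod; apply: ler_prod => i _; rewrite rnorm_ge0/=.
apply: le_trans (rnorm_dual_apply (ball_point w i) (x i)) _.
by rewrite ler_piMl ?rnorm_ge0 ?ball_point_le.
Qed.

Lemma ball_product_hausdorff : hausdorff_space (ball_product E).
Proof.
move=> p q pq; apply: functional_extensionality_dep => i.
apply/val_inj/val_inj/funext => x; apply/eqP; rewrite -subr_eq0.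
apply/eqP/(@rnorm_eps0 R k K^o) => eps e0.
pose f w : K^o := ball_point w i x.
have near_f (u : ball_product E) : nbhs u [set w | rnorm (f u - f w) <= eps / 2].
  have /cvgrPdist_le/(_ (of_real k (eps / 2))) := @ball_point_continuous i x u.
  rewrite -(of_real0 R k) of_real_lt => /(_ (divr_gt0 e0 (ltr0Sn R 1))).
  by apply: filterS => w; rewrite -rnormE of_real_le.
have [w [/= pw qw]] := pq _ _ (near_f p) (near_f q).
have := rnorm_dist (f p) (f w) (f q); rewrite (rnormBC (f w)).
by move=> h; apply: le_trans h _; move: pw qw; lra.
Qed.
End BallProduct.

Section SectionEstimate.
Variables (R : realType) (k : ground).
Local Notation K := (scalars R k).
Variables (n : nat) (E : 'I_n -> normedModType K).
Variables (e : forall i, nat -> E i) (e' : forall i, nat -> dual (E i)).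

Definition dual_section (m : nat) (i : 'I_n) (x' : dual (E i)) : dual (E i) :=
  \sum_(j < m) x' (e i j) *: e' i j.

Variable C : R.
Hypothesis C1 : 1 <= C.
Hypothesis sectionC : forall i x' m, rnorm (@dual_section m i x') <= C * rnorm x'.
Hypothesis section_tends : forall i x', tends (fun m => @dual_section m i x') x'.

(** In Egorov's theorem, the set of uniform convergence with bound [d] from the index [M] on.
    The distance in the dual norm is spelled out on the unit ball of [E i] because each of
    the resulting conditions is weak-star closed. *)
Definition uniform_set (d : R) (M : nat) : set (ball_product E) :=
  [set w | forall i l (x : E i), (M <= l)%N -> rnorm x <= 1 ->
    rnorm (\sum_(j < l) ball_point w i (e i j) *: e' i j x - ball_point w i x : K^o) <= d].

Lemma uniform_set_closed d M : closed (uniform_set d M).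
Proof.
have -> : uniform_set d M =
    \bigcap_i \bigcap_l \bigcap_(x in [set x : E i | (M <= l)%N /\ rnorm x <= 1])
    [set w | rnorm (\sum_(j < l) ball_point w i (e i j) *: e' i j x
                    - ball_point w i x - 0 : K^o) <= d].
  apply/seteqP; split=> w h i; first by move=> _ l _ x [Ml x1] /=; rewrite subr0; exact: h.
  by move=> l x Ml x1; rewrite -(subr0 (_ - _)); exact: (h i Logic.I l Logic.I x).
apply: closed_bigI => i _; apply: closed_bigI => l _; apply: closed_bigI => x _.
apply: closed_rnorm_le => w; have FF := @nbhs_filter (ball_product E) w.
apply: cvgB; last exact: ball_point_continuous.
move: w {FF}; apply: (@continuous_big _ _ (@GRing.add K^o)) => [[a b]|j _ w].
  exact: add_continuous.
have FF := @nbhs_filter (ball_product E) w.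
by apply: (@cvgZr_tmp K K^o); exact: ball_point_continuous.
Qed.

Lemma uniform_set_le d M w i l : uniform_set d M w -> (M <= l)%N ->
  rnorm (dual_section l (ball_point w i) - ball_point w i) <= d.
Proof.
move=> wM Ml; apply: rnorm_dual_ball => x x1.
have := wM i l x Ml x1; rewrite dualBE /dual_section dual_sumE.
by under [X in _ -> rnorm (X - _) <= _]eq_bigr do rewrite dualZE.
Qed.

Lemma uniform_set_cover d : 0 < d -> \bigcup_M uniform_set d M = setT.
Proof.
move=> d0; apply/seteqP; split=> // w _.
have /choice[M MP] i := section_tends (ball_point w i) d0.
exists (\max_i M i)%N => // i l x Ml x1.
have := MP i l (leq_trans (leq_bigmax i) Ml).
move=> h; apply: le_trans h.
rewrite -[X in rnorm (X - _)](_ : dual_section l (ball_point w i) x = _).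
  rewrite -dualBE; apply: le_trans (rnorm_dual_apply _ _) _.
  by rewrite ler_piMr ?rnorm_ge0.
by rewrite /dual_section dual_sumE; apply: eq_bigr => j _; rewrite dualZE.
Qed.

Section Form.
Variables (V W : normedModType K) (B : (forall o, dual_factors E V o) -> W).
Hypothesis Bm : @multilinear R k _ (fun o => dual_factors E V o) W B.
Hypothesis B1 : forall x, rnorm (B x) <= \prod_o rnorm (x o).

Lemma form_multilinear (v : V) :
  @multilinear R k _ (fun i => dual (E i)) W (fun x' => B (dual_tuple x' v)).
Proof. by move=> x' i a y z; rewrite !dual_tuple_dfwith Bm. Qed.

Lemma form_le x' (v : V) : rnorm (B (dual_tuple x' v)) <= rnorm v * \prod_i rnorm (x' i).
Proof. by have := B1 (dual_tuple x' v); rewrite big_option/= mulrC. Qed.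

Let form_dfwith x' (v : V) :
  B (dual_tuple x' v) = B (dfwith (dual_tuple x' 0 : forall o, dual_factors E V o)
    None (v : dual_factors E V None)).
Proof. by rewrite -dual_tuple_dfwithN. Qed.

Lemma form_sum x' (J : Type) (r : seq J) (c : J -> K) (v : J -> V) :
  B (dual_tuple x' (\sum_(j <- r) c j *: v j)) = \sum_(j <- r) c j *: B (dual_tuple x' (v j)).
Proof.
rewrite form_dfwith (multilinear_sum Bm).
by apply: eq_bigr => j _; rewrite form_dfwith.
Qed.

Lemma formB x' (v v' : V) :
  B (dual_tuple x' (v - v')) = B (dual_tuple x' v) - B (dual_tuple x' v').
Proof. by rewrite !form_dfwith (multilinearB Bm). Qed.

Lemma form_sections m (x' : forall i, dual (E i)) (v : V) :
  B (dual_tuple (fun i => dual_section m (x' i)) v) =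
  \sum_(a : {ffun 'I_n -> 'I_m})
    (\prod_i x' i (e i (a i))) *: B (dual_tuple (fun i => e' i (a i)) v).
Proof.
have h := multilinear_expand (form_multilinear v) m (fun i j => x' i (e i j)) e'.
exact: h.
Qed.

Lemma form_section_dist m (x' : forall i, dual (E i)) (v : V) (d : R) :
  (forall i, rnorm (x' i) <= 1) -> 0 <= d ->
  (forall i, rnorm (dual_section m (x' i) - x' i) <= d) ->
  rnorm (B (dual_tuple (fun i => dual_section m (x' i)) v) - B (dual_tuple x' v)) <=
  n%:R * C ^+ n * d * rnorm v.
Proof.
move=> x1 d0 xd.
have := multilinear_lipschitz (form_multilinear v) (rnorm_ge0 v) C1 d0 (form_le ^~ v).
rewrite card_ord => /(_ (fun i => dual_section m (x' i)) x') h.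
apply: le_trans (h _ _ _) _ => //.
- by move=> i; rewrite (le_trans (sectionC _ _))// ler_piMr ?(le_trans ler01).
- by move=> i; rewrite (le_trans (x1 i)).
- by rewrite -!mulrA mulrC -!mulrA.
Qed.

Lemma form_section_le m (x' : forall i, dual (E i)) (v : V) :
  (forall i, rnorm (x' i) <= 1) ->
  rnorm (B (dual_tuple (fun i => dual_section m (x' i)) v) - B (dual_tuple x' v)) <=
  2 * C ^+ n * rnorm v.
Proof.
move=> x1; have Cn : 1 <= C ^+ n by rewrite exprn_ege1.
apply: le_trans (rnormD _ _) _; rewrite rnormN.
rewrite (_ : 2 * C ^+ n * rnorm v = C ^+ n * rnorm v + C ^+ n * rnorm v); last by ring.
apply: lerD; apply: le_trans (form_le _ _) _; rewrite mulrC ler_wpM2r ?rnorm_ge0//.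
  rewrite -[n in C ^+ n]card_ord -prodr_const; apply: ler_prod => i _.
  by rewrite rnorm_ge0 (le_trans (sectionC _ _))// ler_piMr ?(le_trans ler01).
by apply: le_trans Cn; apply: prodr_ile1 => i _; rewrite rnorm_ge0 x1.
Qed.
End Form.

(** The tensor product of the [m]-th partial sum operators applied to [S], as a sum of
    elementary tensors, followed by [B]. *)
Definition section_sum (V W : normedModType K) (B : (forall o, dual_factors E V o) -> W)
    (S : (forall i, E i) -> V) (m : nat) : W :=
  \sum_(a : {ffun 'I_n -> 'I_m})
    B (dual_tuple (fun i => e' i (a i)) (S (fun i => e i (a i)))).

(** The operator enters only through the finitely many values that occur in [section_sum],
    which are replaced by Riemann sums over one partition that refines [uniform_set d M].
    Summed over the multi-indices, these give at each sample point [w i] the sections of its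
    coordinates; on pieces inside [uniform_set d M] the sections are close to the
    coordinates, and the other pieces have small variation.  What remains is [r].  The same
    [r] serves for [m] and [l] because the partition handles both families of
    multi-indices, and [M] does not depend on [B]. *)
Theorem section_sum_estimate (V : normedModType K) (mu : set (ball_product E) -> V)
    (S : (forall i, E i) -> V) (eta : R) :
  represents mu S -> 0 < eta ->
  exists M, forall m l, (M <= m)%N -> (M <= l)%N ->
    forall (W : normedModType K) (B : (forall o, dual_factors E V o) -> W),
      @multilinear R k _ (fun o => dual_factors E V o) W B ->
      (forall x, rnorm (B x) <= \prod_o rnorm (x o)) ->
      exists r : W, [/\ rnorm r <= Defs.total_variation mu,
        rnorm (section_sum B S m - r) <= eta & rnorm (section_sum B S l - r) <= eta].
Proof.
move=> [mum muV mur muS] eta0; set tv := Defs.total_variation mu.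
have tv0 : 0 <= tv by exact: total_variation_ge0.
have C0 : 0 <= C by apply: le_trans C1.
pose D := n%:R * C ^+ n * tv + 1; have D0 : 0 < D.
  by rewrite ltr_wpDl// !mulr_ge0// exprn_ge0.
pose d := eta / 3 / D; have d0 : 0 < d by rewrite !divr_gt0.
pose D' := 2 * C ^+ n; have D'0 : 0 < D'.
  by rewrite mulr_gt0// exprn_gt0// (lt_le_trans ltr01).
have U_borel M : borel (uniform_set d M) by apply: borel_closed; exact: uniform_set_closed.
have U_inc M : uniform_set d M `<=` uniform_set d M.+1.
  by move=> w wM i l x Ml; apply: wM; exact: ltnW.
have [|M tailM] := variation_tail muV mum U_borel U_inc (uniform_set_cover d0)
  (_ : 0 < eta / 3 / D'); first by rewrite !divr_gt0.
exists M => m l Mm Ml W B Bm B1.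
(* The multi-indices below [m] and those below [l] are treated together. *)
pose J : finType := ({ffun 'I_n -> 'I_m} + {ffun 'I_n -> 'I_l})%type.
pose ep (a : J) : forall i, E i :=
  match a with inl a => fun i => e i (a i) | inr a => fun i => e i (a i) end.
pose ep' (a : J) : forall i, dual (E i) :=
  match a with inl a => fun i => e' i (a i) | inr a => fun i => e' i (a i) end.
pose N := \sum_a \prod_i rnorm (ep' a i) + 1.
have N0 : 0 < N.
  by rewrite ltr_wpDl// sumr_ge0// => a _; apply: prodr_ge0 => i _; exact: rnorm_ge0.
have e0 : 0 < eta / 3 / N by rewrite !divr_gt0.
have [I [A [w [Ab At AT AU Aeps]]]] := riemann_sums muV mum (U_borel M)
  (fun a => muS (ep a)) e0.
pose P i := `[< uniform_set d M (w i) >].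
have := tailM I A P Ab At AT _ _.
have AP i : P i -> A i `<=` uniform_set d M.
  by move=> /asboolP wi v Aiv; exact/(AU i v Aiv).
have AnP i : ~~ P i -> A i `<=` ~` uniform_set d M.
  by move=> /asboolP wi v Aiv vU; apply: wi; exact/(AU i v Aiv).
move=> /(_ AP AnP) tail.
have sumA : \sum_i rnorm (mu (A i)) <= tv by exact: variation_sum.
pose r := \sum_i B (dual_tuple (ball_point (w i)) (mu (A i))).
have main q (h : {ffun 'I_n -> 'I_q} -> J) :
    (M <= q)%N -> \sum_a \prod_i rnorm (ep' (h a) i) <= N ->
    (forall a, ep (h a) = fun i => e i (a i)) ->
    (forall a, ep' (h a) = fun i => e' i (a i)) ->
    rnorm (section_sum B S q - r) <= eta.
  move=> Mq hN hep hep'.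
  pose y a := \sum_i eval_product (ep a) (w i) *: mu (A i).
  pose Y := \sum_(a : {ffun 'I_n -> 'I_q}) B (dual_tuple (fun i => e' i (a i)) (y (h a))).
  have SY : rnorm (section_sum B S q - Y) <= eta / 3.
    rewrite -sumrB (le_trans (rnorm_sum _ _ _))//.
    apply: (@le_trans _ _
      (\sum_(a : {ffun 'I_n -> 'I_q}) eta / 3 / N * \prod_i rnorm (ep' (h a) i))).
      apply: ler_sum => a _; rewrite -(formB Bm) (le_trans (form_le B1 _ _))//.
      rewrite hep' ler_wpM2r//; first by apply: prodr_ge0 => i _; exact: rnorm_ge0.
      by rewrite -hep; exact: Aeps.
    rewrite -mulr_sumr -mulrA ler_piMr ?divr_ge0 ?(ltW eta0)//.
    by rewrite mulrC ler_pdivrMr// mul1r.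
  have YE : Y = \sum_i B (dual_tuple (fun j => dual_section q (ball_point (w i) j)) (mu (A i))).
    under [RHS]eq_bigr do rewrite (form_sections Bm).
    rewrite exchange_big/=; apply: eq_bigr => a _.
    rewrite (form_sum Bm); apply: eq_bigr => i _; congr (_ *: _).
    by rewrite /eval_product hep.
  have Yr : rnorm (Y - r) <= eta / 3 + eta / 3.
    rewrite YE -sumrB (le_trans (rnorm_sum _ _ _))// (bigID P)/=; apply: lerD.
      apply: (@le_trans _ _ (\sum_(i | P i) n%:R * C ^+ n * d * rnorm (mu (A i)))).
        apply: ler_sum => i /asboolP Pi; apply: (form_section_dist Bm B1) => //.
        - by move=> j; exact: ball_point_le.
        - exact: ltW.
        - by move=> j; apply: uniform_set_le Mq.
      rewrite -mulr_sumr; apply: (@le_trans _ _ (n%:R * C ^+ n * d * tv)).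
        apply: ler_wpM2l; first by rewrite mulr_ge0 ?(ltW d0)// mulr_ge0// exprn_ge0.
        apply: le_trans sumA; rewrite [leRHS](bigID P)/= lerDl sumr_ge0// => i _.
        exact: rnorm_ge0.
      rewrite mulrAC /d mulrA ler_pdivrMr// mulrC ler_wpM2l ?divr_ge0 ?(ltW eta0)//.
      by rewrite /D lerDl.
    apply: (@le_trans _ _ (\sum_(i | ~~ P i) D' * rnorm (mu (A i)))).
      apply: ler_sum => i _; apply: (form_section_le B1) => j; exact: ball_point_le.
    by rewrite -mulr_sumr mulrC -ler_pdivlMr.
  by have := rnorm_dist (section_sum B S q) Y r; move: SY Yr; lra.
exists r; split.
- rewrite (le_trans (rnorm_sum _ _ _))// (le_trans _ sumA)//; apply: ler_sum => i _.
  apply: le_trans (form_le B1 _ _) _; rewrite ler_piMr ?rnorm_ge0//.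
  by apply: prodr_ile1 => j; rewrite rnorm_ge0 ball_point_le.
- apply: (main m inl) => //; rewrite /N big_sumType/= -addrA lerDl addr_ge0//.
  by apply: sumr_ge0 => a _; apply: prodr_ge0 => i _; exact: rnorm_ge0.
- apply: (main l inr) => //; rewrite /N big_sumType/= addrAC -[leLHS]add0r lerD//.
  by rewrite addr_ge0// sumr_ge0// => a _; apply: prodr_ge0 => i _; exact: rnorm_ge0.
Qed.
End SectionEstimate.

(** * The canonical map from the tensor product to the operators *)
Section MultilinearConstructions.
Variables (R : realType) (k : ground).
Local Notation K := (scalars R k).

Lemma multilinear_comp (I : finType) (G H : I -> lmodType K) (W : lmodType K)
    (A : forall i, G i -> H i) (B : (forall i, H i) -> W) :
  (forall i, linear (A i)) -> @multilinear R k I H W B ->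
  @multilinear R k I G W (fun x => B (fun i => A i (x i))).
Proof.
move=> Al Bm x i a u v.
have dfw z : (fun j => A j (dfwith x i z j)) = dfwith (fun j => A j (x j)) i (A i z).
  by apply/functional_extensionality_dep => j; case: dfwithP => [|j' ij];
    rewrite ?dfwithin// dfwithout.
by rewrite !dfw Al Bm.
Qed.

Lemma prod_multilinear (I : finType) :
  @multilinear R k I (fun=> K^o) K^o (fun c => \prod_i c i).
Proof.
move=> c i a u v.
have key z : \prod_j dfwith c i z j = z * \prod_(j | j != i) c j :> K.
  rewrite (bigD1 i)//= dfwithin; congr (_ * _).
  by apply: eq_bigr => j ji; rewrite dfwithout// eq_sym.
by rewrite !key mulrDl -[a *: u]/(a * u) -[RHS]/(a * (_ * _) + _) mulrA.
Qed.

Lemma dual_tuple_multilinear (n : nat) (E : 'I_n -> normedModType K)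
    (V : normedModType K) (W : lmodType K) (B : (forall o, dual_factors E V o) -> W) :
  (forall v, @multilinear R k _ (fun i => dual (E i)) W (fun x' => B (dual_tuple x' v))) ->
  (forall x', linear (fun v => B (dual_tuple x' v))) ->
  @multilinear R k _ (fun o => dual_factors E V o) W B.
Proof.
move=> Bd Bv y o a u v; rewrite -(dual_tuple_eta y).
case: o u v => [i|] u v; first by rewrite -!dual_tuple_dfwith Bd.
by rewrite -!dual_tuple_dfwithN Bv.
Qed.

Lemma dual_tuple_linear (n : nat) (E : 'I_n -> normedModType K)
    (V : normedModType K) (W : lmodType K) (B : (forall o, dual_factors E V o) -> W) x' :
  @multilinear R k _ (fun o => dual_factors E V o) W B ->
  linear (fun v => B (dual_tuple x' v)).
Proof.
move=> Bm a u v.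
have D (z : V) : B (dual_tuple x' z) = B (dfwith
    (dual_tuple x' 0 : forall o, dual_factors E V o) None (z : dual_factors E V None)).
  by rewrite -dual_tuple_dfwithN.
by rewrite !D Bm.
Qed.

Lemma dual_tupleZ (n : nat) (E : 'I_n -> normedModType K)
    (V : normedModType K) (W : lmodType K) (B : (forall o, dual_factors E V o) -> W) x'
    (a : K) v :
  @multilinear R k _ (fun o => dual_factors E V o) W B ->
  B (dual_tuple x' (a *: v)) = a *: B (dual_tuple x' v).
Proof.
move=> Bm; have h := dual_tuple_linear x' Bm.
have B0 : B (dual_tuple x' 0) = 0.
  by have := h (-1) 0 0; rewrite scaler0 addr0 scaleN1r addNr.
by have := h a v 0; rewrite B0 !addr0.
Qed.

Lemma rank_one_multilinear (n : nat) (E : 'I_n -> normedModType K)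
    (F : normedModType K) (x' : forall i, dual (E i)) (f : F) :
  @multilinear R k _ (fun i => E i) F (rank_one x' f).
Proof.
have Pm := multilinear_comp (G := fun i => E i) (H := fun=> K^o)
  (fun i => dual_linear (x' i)) (@prod_multilinear 'I_n).
by move=> x i a u v; rewrite /rank_one Pm scalerDl scalerA.
Qed.

Lemma rank_one_form_multilinear (n : nat) (E : 'I_n -> normedModType K)
    (F : normedModType K) (x : forall i, E i) :
  @multilinear R k _ (fun o => dual_factors E F o) F
    (fun y => rank_one (fun i => y (Some i) : dual (E i)) (y None : F) x).
Proof.
apply: dual_tuple_multilinear => [f|x'] /=.
  have evl i : linear (fun x' : dual (E i) => x' (x i) : K^o) by [].
  have Pm := multilinear_comp (G := fun i => dual (E i)) (H := fun=> K^o)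
    evl (@prod_multilinear 'I_n).
  by move=> x' i a u v; rewrite /rank_one Pm scalerDl scalerA.
by move=> a u v; rewrite /rank_one scalerDr !scalerA mulrC.
Qed.
End MultilinearConstructions.

Section TensorOperator.
Variables (R : realType) (k : ground).
Local Notation K := (scalars R k).
Variables (n : nat) (E : 'I_n -> normedModType K) (F : completeNormedModType K).
Variables (X : completeNormedModType K) (t : (forall o, dual_factors E F o) -> X).
Hypothesis Xt : projective_completion t.
Local Notation T := (forall o, dual_factors E F o).

Lemma rnorm_rank_one (x' : forall i, dual (E i)) (f : F) (x : forall i, E i) :
  rnorm (rank_one x' f x) <= (\prod_i rnorm (x i)) * ((\prod_i rnorm (x' i)) * rnorm f).
Proof.
rewrite rnormZ rnorm_prod mulrA ler_wpM2r ?rnorm_ge0// -big_split/=.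
by apply: ler_prod => i _; rewrite rnorm_ge0/= mulrC rnorm_dual_apply.
Qed.

(** For each [x], evaluation at [x] of the rank one operators is a bounded multilinear map,
    hence extends to [X]; linearity of the extensions makes them a single linear map. *)
Lemma tensor_operator_exists : exists J : {linear X -> ((forall i, E i) -> F)},
  (forall x' f, J (t (dual_tuple x' f)) = rank_one x' f) /\
  forall u x, rnorm (J u x) <= (\prod_i rnorm (x i)) * rnorm u.
Proof.
have /choice[L LP] : forall x : forall i, E i, exists L : {linear X -> F},
    (forall y, L (t y) = rank_one (fun i => y (Some i) : dual (E i)) (y None : F) x) /\
    forall u, rnorm (L u) <= (\prod_i rnorm (x i)) * rnorm u.
  move=> x; apply: (projective_extension None Xt (rank_one_form_multilinear x)).
  - by apply: prodr_ge0 => i _; exact: rnorm_ge0.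
  - move=> y; rewrite big_option.
    exact: (rnorm_rank_one (fun i => y (Some i) : dual (E i)) (y None : F)).
  - exact: complete_rcomplete.
pose J u : (forall i, E i) -> F := fun x => L x u.
have Jl : linear J by move=> a u v; apply/funext => x; rewrite /J linearP.
pose Jlin : {linear X -> ((forall i, E i) -> F)} :=
  HB.pack J (GRing.isLinear.Build K X ((forall i, E i) -> F) *:%R J Jl).
exists Jlin; split=> [x' f|u x]; last exact: (LP x).2.
by apply/funext => x; exact: (LP x).1.
Qed.
End TensorOperator.

Section Identification.
Variables (R : realType) (k : ground).
Local Notation K := (scalars R k).
Variables (n : nat) (E : 'I_n -> normedModType K) (F : completeNormedModType K).
Variables (X : completeNormedModType K) (t : (forall o, dual_factors E F o) -> X).
Hypothesis Xt : projective_completion t.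
Local Notation T := (forall o, dual_factors E F o).
Variable J : {linear X -> ((forall i, E i) -> F)}.
Hypothesis Jt : forall x' f, J (t (dual_tuple x' f)) = rank_one x' f.
Hypothesis J_le : forall u x, rnorm (J u x) <= (\prod_i rnorm (x i)) * rnorm u.

Let tm : @multilinear R k _ (fun o => dual_factors E F o) X t.
Proof. by have [] := Xt. Qed.

Let t_le y : rnorm (t y) <= \prod_o rnorm (y o).
Proof. exact: (rnorm_tensor_le Xt). Qed.

Let Jy y : J (t y) = rank_one (fun i => y (Some i) : dual (E i)) (y None : F).
Proof. by rewrite -[in LHS](dual_tuple_eta y) Jt. Qed.

Let eval_linear x : linear (fun u => J u x).
Proof. by move=> a u v; rewrite linearP. Qed.

Let Jx x : {linear X -> F} :=
  HB.pack (fun u => J u x) (GRing.isLinear.Build K X F *:%R _ (eval_linear x)).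

Lemma tensor_operator_multilinear u : @multilinear R k _ (fun i => E i) F (J u).
Proof.
move=> x i a v w.
have eq_t y : Jx (dfwith x i (a *: v + w)) (t y) =
    (a \*: Jx (dfwith x i v) \+ Jx (dfwith x i w)) (t y).
  by rewrite /= Jy rank_one_multilinear.
pose L2 : {linear X -> F} := a \*: Jx (dfwith x i v) \+ Jx (dfwith x i w).
apply: (tensor_linear_eq (L1 := Jx (dfwith x i (a *: v + w))) (L2 := L2) Xt
  (fun u => J_le u (dfwith x i (a *: v + w))) _ eq_t u) => u'.
apply: le_trans (rnormD _ _) _; rewrite rnormZ.
apply: le_trans (lerD (ler_wpM2l (rnorm_ge0 _) (J_le u' _)) (J_le u' _)) _.
by rewrite mulrA -mulrDl.
Qed.

Lemma tensor_operator_operators u : multilinear_operators (J u).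
Proof.
split; first exact: tensor_operator_multilinear.
apply: (multilinear_bounded_continuous (tensor_operator_multilinear u) (rnorm_ge0 u)).
by move=> x; rewrite mulrC.
Qed.

Lemma tensor_operator_nuclear u (eps : R) : 0 < eps ->
  exists lambda x' f s, nuclear_representation (J u) lambda x' f s /\ s <= rnorm u + eps.
Proof.
move=> e0; have [y [yC yu]] := projective_series None Xt u e0.
pose c j := \prod_o rnorm (y j o).
have c0 j : 0 <= c j by apply: prodr_ge0 => o _; exact: rnorm_ge0.
pose a := fun j => rnorm (1 : K^o) * (\prod_i rnorm (y j (Some i))) * rnorm (y j None).
have aE : a = c by apply/funext => j; rewrite /a /c rnorm1 mul1r big_option.
have ac : cvgn (series a).
  apply: nondecreasing_is_cvgn.
    by apply/nondecreasing_seqP => m; rewrite aE /series/= big_nat_recr//= lerDl.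
  by exists (rnorm u + eps) => _ [m _ <-]; rewrite aE /series/= big_mkord.
exists (fun=> 1), (fun j i => y j (Some i) : dual (E i)), (fun j => y j None : F).
exists (limn (series a)).
split; first split => [|x].
- exact: ac.
- apply/tendsP; have := tends_linear (L := Jx x) (J_le ^~ x) yu; congr tends.
  apply/funext => m /=; rewrite /series/= big_mkord.
  rewrite -[RHS]/(_) (_ : J _ x = Jx x (\sum_(j < m) t (y j)))// linear_sum.
  by apply: eq_bigr => j _; rewrite scale1r -[LHS]/(J _ x) Jy.
- by apply: limr_le => //; apply: nearW => m; rewrite aE /series/= big_mkord.
Qed.

Section Bases.
Variables (e : forall i, nat -> E i) (e' : forall i, nat -> dual (E i)).
Variable C : R.
Hypothesis C1 : 1 <= C.
Hypothesis sectionC : forall i x' m, rnorm (dual_section e e' m x' : dual (E i)) <= C * rnorm x'.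
Hypothesis section_tends : forall i x', tends (fun m => dual_section e e' m x' : dual (E i)) x'.
Hypothesis coord : forall i, coordinate_functionals (e i) (e' i).

Let C0 : 0 <= C. Proof. exact: le_trans C1. Qed.

Lemma dual_section_linear i m : linear (@dual_section _ _ _ _ e e' m i).
Proof.
move=> a x y; rewrite /dual_section scaler_sumr -big_split/=.
apply: eq_bigr => j _; rewrite scalerA -scalerDl; congr (_ *: _).
Qed.

(** The tensor product of the [m]-th partial sum operators of the dual bases with the
    identity of [F].  It depends on [u] only through the operator [J u]: this is what makes
    [J] injective, since these operators converge to the identity. *)
Lemma section_tensor_exists m : exists L : {linear X -> X},
  [/\ forall y, L (t y) =
        t (dual_tuple (fun i => dual_section e e' m (y (Some i) : dual (E i))) (y None)),
      forall u, rnorm (L u) <= C ^+ n * rnorm u &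
      forall u, L u = section_sum e e' t (J u) m].
Proof.
pose B (y : T) := t (dual_tuple (fun i => dual_section e e' m (y (Some i) : dual (E i))) (y None)).
have Bm : @multilinear R k _ (fun o => dual_factors E F o) X B.
  apply: dual_tuple_multilinear => [f|x'].
    apply: (multilinear_comp (B := fun x' => t (dual_tuple x' f))) => [i|].
      exact: dual_section_linear.
    exact: form_multilinear.
  exact: (dual_tuple_linear (fun i => dual_section e e' m (x' i)) tm).
have B_le y : rnorm (B y) <= C ^+ n * \prod_o rnorm (y o).
  apply: le_trans (t_le _) _; rewrite !big_option/= mulrA ler_wpM2r ?rnorm_ge0//.
  rewrite -[n in C ^+ n]card_ord -prodr_const -big_split/=; apply: ler_prod => i _.
  by rewrite rnorm_ge0 sectionC.
have [L [LB L_le]] :=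
  projective_extension None Xt Bm (exprn_ge0 n C0) B_le (@complete_rcomplete _ _ X).
exists L; split=> // u.
have Sl : linear (fun u => section_sum e e' t (J u) m).
  move=> a v w; rewrite /section_sum scaler_sumr -big_split/=; apply: eq_bigr => b _.
  by rewrite linearP (dual_tuple_linear _ tm).
pose S : {linear X -> X} := HB.pack (fun u => section_sum e e' t (J u) m)
  (GRing.isLinear.Build K X X *:%R _ Sl).
pose D := \sum_(b : {ffun 'I_n -> 'I_m})
  (\prod_i rnorm (e' i (b i))) * \prod_i rnorm (e i (b i)).
have S_le v : rnorm (S v) <= D * rnorm v.
  apply: le_trans (rnorm_sum _ _ _) _; rewrite mulr_suml; apply: ler_sum => b _.
  apply: le_trans (t_le _) _; rewrite big_option/= -mulrA ler_wpM2l//.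
  by apply: prodr_ge0 => i _; exact: rnorm_ge0.
apply: (tensor_linear_eq (L2 := S) Xt L_le S_le) => y.
rewrite LB /B (form_sections e e' tm) /= /section_sum Jy; apply: eq_bigr => b _.
by rewrite /rank_one (dual_tupleZ _ _ _ tm).
Qed.

Lemma section_sum_tends u : tends (section_sum e e' t (J u)) u.
Proof.
have /choice[L LP] := section_tensor_exists.
suff : tends (fun m => L m u) u.
  by congr tends; apply/funext => m; have [_ _ ->] := LP m.
apply: (tensor_strong_cvg Xt (c := C ^+ n)) => [m v|y].
  by have [_ + _] := LP m; exact.
have -> : (fun m => L m (t y)) = fun m =>
    t (dual_tuple (fun i => dual_section e e' m (y (Some i) : dual (E i))) (y None)).
  by apply/funext => m; have [-> _ _] := LP m.
rewrite -[X in tends _ (t X)](dual_tuple_eta y).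
apply: (multilinear_continuous_tends (B := fun x' => t (dual_tuple x' (y None)))) => [|i].
  exact: (multilinear_bounded_continuous (form_multilinear tm (y None)) (rnorm_ge0 _)
    (form_le t_le ^~ (y None))).
exact: section_tends.
Qed.

Lemma tensor_operator_inj u v : J u = J v -> u = v.
Proof.
by move=> uv; apply: tends_unique (section_sum_tends u) _; rewrite uv; exact: section_sum_tends.
Qed.

(** At [x], the operators of the sums [section_sum e e' t S] take the values of [S] at the
    partial sums of the expansions of the [x i]; continuity of [S] is enough to conclude. *)
Lemma tensor_operator_limit (S : (forall i, E i) -> F) u :
  multilinear_operators S -> tends (section_sum e e' t S) u -> J u = S.
Proof.
move=> [Sm Sc] Su; apply/funext => x.
have JS : tends (fun m => J (section_sum e e' t S m) x) (J u x).
  exact: (tends_linear (L := Jx x) (J_le ^~ x) Su).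
apply: tends_unique JS _.
have xS : tends (fun m => S (fun i => \sum_(j < m) e' i j (x i) *: e i j)) (S x).
  by apply: (multilinear_continuous_tends Sc) => i; apply/tends_rnorm; exact: coord.
move: xS; congr tends; apply/funext => m.
rewrite (multilinear_expand Sm m (fun i j => e' i j (x i)) e).
rewrite -[RHS]/(Jx x _) linear_sum; apply: eq_bigr => b _.
by rewrite -[RHS]/(J _ x) Jt.
Qed.

Section BidualExtension.
Variable phi : dual X.
Hypothesis phi1 : rnorm phi <= 1.

Let slice_le x' (f : F) : rnorm (phi (t (dual_tuple x' f))) <= (\prod_i rnorm (x' i)) * rnorm f.
Proof.
apply: le_trans (rnorm_dual_apply phi _) _.
apply: le_trans (_ : rnorm (t (dual_tuple x' f)) <= _).
  by rewrite ler_piMl ?rnorm_ge0.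
by apply: le_trans (t_le _) _; rewrite big_option.
Qed.

Let slice_linear x' : linear (fun f : F => phi (t (dual_tuple x' f)) : K^o).
Proof. by move=> a f g; rewrite (dual_tuple_linear x' tm) linearP. Qed.

Let slice x' : dual F := Dual (bounded_dual_pred (slice_linear x') (slice_le x')).

Let slice_multilinear : @multilinear R k _ (fun i => dual (E i)) (dual F) slice.
Proof.
move=> x' i a y z; apply/val_inj/funext => f.
rewrite -[RHS]/(a *: (slice (dfwith x' i y) f : K^o) + slice (dfwith x' i z) f).
by rewrite /= (form_multilinear tm f) linearP.
Qed.

(** For fixed x', the form f |-> phi(t(x', f)) is an element of F', so that y'' in F'' can
    be applied to it; multilinearity in x' is inherited. *)
Lemma bidual_form : exists B : (forall o, dual_factors E (bidual F) o) -> K^o,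
  [/\ @multilinear R k _ (fun o => dual_factors E (bidual F) o) K^o B,
      forall y, rnorm (B y) <= \prod_o rnorm (y o) &
      forall x' f, B (dual_tuple x' (bidual_emb f)) = phi (t (dual_tuple x' f))].
Proof.
exists (fun y : (forall o, dual_factors E (bidual F) o) =>
  (y None : bidual F) (slice (fun i => y (Some i) : dual (E i)))); split=> //.
  apply: dual_tuple_multilinear => [v|x'] /=; last by move=> a v w.
  by move=> x' i a y z; rewrite slice_multilinear linearP.
move=> y; rewrite big_option/= mulrC.
apply: le_trans (rnorm_dual_apply (y None : bidual F) _) _; apply: ler_wpM2l; first exact: rnorm_ge0.
apply: rnorm_dual_le => [|f]; last exact: slice_le.
by apply: prodr_ge0 => i _; exact: rnorm_ge0.
Qed.
End BidualExtension.

(** The sums [section_sum e e' t S] form a Cauchy sequence in [X]: their differences are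
    normed by functionals of norm one, and for a form extending such a functional to the
    bidual [section_sum_estimate] applies with an index [M] common to all functionals. *)
Theorem grothendieck_tensor (S : (forall i, E i) -> F) (mu : set (ball_product E) -> bidual F) :
  multilinear_operators S -> represents mu (@bidual_emb R k F \o S) ->
  exists u, J u = S /\ rnorm u <= Defs.total_variation mu.
Proof.
move=> So muS; set tv := Defs.total_variation mu.
have est eta : 0 < eta -> exists M, forall m l, (M <= m)%N -> (M <= l)%N ->
    rnorm (section_sum e e' t S m - section_sum e e' t S l) <= eta + eta /\
    rnorm (section_sum e e' t S m) <= tv + eta.
  move=> eta0.
  have [M MP] := section_sum_estimate C1 sectionC section_tends muS eta0.
  exists M => m l Mm Ml.
  have phi_sum (phi : dual X) : rnorm phi <= 1 -> exists r : K^o,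
      [/\ rnorm r <= tv, rnorm (phi (section_sum e e' t S m) - r) <= eta &
          rnorm (phi (section_sum e e' t S l) - r) <= eta].
    move=> phi1; have [B [Bm B1 BE]] := bidual_form phi1.
    have [r rP] := MP m l Mm Ml K^o B Bm B1; exists r.
    suff phiE q : phi (section_sum e e' t S q) = section_sum e e' B (@bidual_emb R k F \o S) q.
      by rewrite !phiE.
    by rewrite linear_sum; apply: eq_bigr => a _; rewrite BE.
  split.
    have [phi [phi1 h]] := norming_functional (section_sum e e' t S m - section_sum e e' t S l).
    have [r [_ rm rl]] := phi_sum phi phi1; apply: le_trans h _; rewrite linearB.
    have := rnorm_dist (phi (section_sum e e' t S m)) r (phi (section_sum e e' t S l)).
    rewrite (rnormBC r) => h; apply: le_trans h _; exact: lerD.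
  have [phi [phi1 h]] := norming_functional (section_sum e e' t S m).
  have [r [r_tv rm _]] := phi_sum phi phi1; apply: le_trans h _.
  apply: le_trans (rnorm_leD _ r) _; exact: lerD.
have [|u Su] := @complete_rcomplete _ _ X (section_sum e e' t S).
  move=> eps e0; have [M MP] := est _ (divr_gt0 e0 (ltr0Sn R 1)).
  by exists M => i j Mi Mj; have [h _] := MP i j Mi Mj; move: h; lra.
exists u; split; first exact: tensor_operator_limit.
apply/ler_addgt0Pr => eps e0; have [M MP] := est _ e0.
by apply: (tends_le (N := M) _ Su) => m Mm; have [] := MP m m Mm Mm.
Qed.
End Bases.
End Identification.

(** * Nuclear operators are integral *)
Section NuclearIntegral.
Variables (R : realType) (k : ground).
Local Notation K := (scalars R k).
Variables (n : nat) (E : 'I_n -> normedModType K).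

(** Zero when [x] is zero, since the inverse of zero is zero. *)
Definition unit_vector (V : normedModType K) (x : V) : V := of_real k (rnorm x)^-1 *: x.

Lemma unit_vector_le (V : normedModType K) (x : V) : rnorm (unit_vector x) <= 1.
Proof.
rewrite rnormZ rnorm_of_real ?invr_ge0 ?rnorm_ge0//.
have [->|x0] := eqVneq x 0; first by rewrite rnorm0 mulr0.
by rewrite mulVf// gt_eqF// rnorm_gt0.
Qed.

Lemma unit_vectorE (V : normedModType K) (x : V) :
  of_real k (rnorm x) *: unit_vector x = x.
Proof.
have [->|x0] := eqVneq x 0; first by rewrite /unit_vector !scaler0.
rewrite scalerA -of_realM divff; last by rewrite gt_eqF// rnorm_gt0.
by rewrite rscale1.
Qed.

Lemma ball_point_exists (x' : forall i, dual (E i)) :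
  exists w : ball_product E, forall i, ball_point w i = unit_vector (x' i).
Proof.
have h i : unit_vector (x' i) \in @dual_ball R k (E i).
  by rewrite inE; exact: unit_vector_le.
by exists (fun i => SigSub (h i) : weak_star_ball (E i)).
Qed.

(** The [j]-th term of the representation is the point mass at the normalised functionals
    [x' j i], with the norms moved into the vector. *)
Theorem nuclear_measure (F : completeNormedModType K) (S : (forall i, E i) -> F)
    lambda x' f (s : R) : nuclear_representation S lambda x' f s ->
  exists mu : set (ball_product E) -> F,
    represents mu S /\ Defs.total_variation mu <= s.
Proof.
move=> [cs SE]; have /choice[w wP] := fun j => ball_point_exists (x' j).
pose v j : F := (lambda j * \prod_i of_real k (rnorm (x' j i))) *: f j.
have vE j : rnorm (v j) = rnorm (lambda j : K^o) * (\prod_i rnorm (x' j i)) * rnorm (f j).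
  rewrite rnormZ rnormM rnorm_prod; congr (_ * _ * _).
  by apply: eq_bigr => i _; rewrite rnorm_of_real ?rnorm_ge0.
have vs m : \sum_(j < m) rnorm (v j) <= s.
  under eq_bigr do rewrite vE.
  set a := fun j => rnorm (lambda j : K^o) * (\prod_i rnorm (x' j i)) * rnorm (f j).
  have a0 j : 0 <= a j by rewrite /a -vE rnorm_ge0.
  rewrite -(big_mkord xpredT a) -(cvg_lim (@Rhausdorff R) cs).
  apply: (@nondecreasing_cvgn_le _ (series a)); last by apply/cvg_ex; exists s.
  by apply/nondecreasing_seqP => i; rewrite /series/= big_nat_recr//= lerDl.
have Fc := @complete_rcomplete _ _ F.
exists (discrete_measure w Fc vs); split; last exact: discrete_total_variation.
split.
- exact: discrete_vector_measure.
- exact: discrete_bounded_variation.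
- by apply: discrete_regular; exact: ball_product_hausdorff.
move=> x; apply: (discrete_is_integral Fc vs (rnorm_eval_product x)).
  exact: eval_product_continuous.
have /tendsP := SE x; congr tends; apply/funext => m.
rewrite /series/= big_mkord; apply: eq_bigr => j _.
rewrite /rank_one /v !scalerA; congr (_ *: _).
rewrite mulrCA; congr (_ * _); rewrite /eval_product -big_split/=.
apply: eq_bigr => i _; rewrite -{1}[x' j i]unit_vectorE dualZE -(wP j i).
by rewrite -[LHS]/(_ * ball_point (w j) i (x i)) mulrC.
Qed.

Section Contraction.
Variables (V W : normedModType K) (L : {linear V -> W}).
Hypothesis L1 : forall v, rnorm (L v) <= rnorm v.
Variable mu : set (ball_product E) -> V.

Let L1' v : rnorm (L v) <= 1 * rnorm v. Proof. by rewrite mul1r. Qed.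

Lemma variation_contraction A : (Defs.variation (L \o mu) A <= Defs.variation mu A)%E.
Proof.
apply: ge_ereal_sup => _ [m [B [Bb Bt BA ->]]].
apply: le_trans (ereal_sup_ubound _); last by exists m, B; split.
by rewrite lee_fin; apply: ler_sum => j _; exact: L1.
Qed.

Lemma represents_contraction (S : (forall i, E i) -> V) : represents mu S ->
  represents (L \o mu) (L \o S) /\
  Defs.total_variation (L \o mu) <= Defs.total_variation mu.
Proof.
move=> [mum muV mur muS].
have LV : Defs.bounded_variation (L \o mu).
  exact: le_lt_trans (variation_contraction _) muV.
split; last first.
  rewrite -lee_fin fineK ?variation_fin// fineK ?variation_fin//.
  exact: variation_contraction.
split=> //.
- move=> A Ab At; apply/tendsP.
  have /tendsP/(tends_linear L1') := mum A Ab At; congr tends.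
  by apply/funext => m; rewrite /series/= linear_sum.
- move=> A eps Ab e0; have [C0 [U [Cc Uo CA AU UC]]] := mur A eps Ab e0.
  exists C0, U; split=> //; exact: le_lt_trans (variation_contraction _) UC.
- move=> x; have [s [sP /tendsP sc]] := muS x; exists s; split=> //.
  apply/tendsP; have := tends_linear L1' sc; congr tends.
  apply/funext => m; rewrite /simple_integral/= linear_sum.
  by apply: eq_bigr => j _; rewrite linearZ.
Qed.
End Contraction.

Theorem pietsch_grothendieck (F : normedModType K) (S : (forall i, E i) -> F)
    (mu : set (ball_product E) -> F) : represents mu S ->
  exists nu : set (ball_product E) -> bidual F,
    represents nu (@bidual_emb R k F \o S) /\
    Defs.total_variation nu <= Defs.total_variation mu.
Proof.
have embl : linear (@bidual_emb R k F).
  by move=> a x y; apply/val_inj/funext => g /=; rewrite linearP.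
pose emb : {linear F -> bidual F} :=
  HB.pack (@bidual_emb R k F) (GRing.isLinear.Build K F (bidual F) *:%R _ embl).
have emb1 y : rnorm (emb y) <= rnorm y.
  apply: rnorm_dual_le => [|g]; first exact: rnorm_ge0.
  by rewrite mulrC; exact: (rnorm_dual_apply g y).
move=> /(represents_contraction emb1)[h1 h2].
by exists (emb \o mu).
Qed.
End NuclearIntegral.

(** * Boxes and the square ordering *)
Section SquareOrdering.

(** The place of [(p, q)] in the square ordering.  With k the larger entry, the k * k pairs
    of entries below k come first; then come (0, k), ..., (k, k) and (k, k - 1), ..., (k, 0). *)
Definition pair_rank (p q : nat) : nat :=
  (if p <= q then q * q + p else p * p + p + (p - q))%N.

Lemma pair_rank_next z : pair_rank (square_next z).1 (square_next z).2 = (pair_rank z.1 z.2).+1.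
Proof.
case: z => p q; rewrite /square_next /pair_rank /=.
case: (ltnP p q) => pq /=; first by rewrite pq (ltnW pq) addnS.
case: q pq => [|q] pq /=.
  by case: (leqP p 0) => h; nia.
by case: ifP; case: ifP; nia.
Qed.

Lemma square_pairK i : pair_rank (square_pair i).1 (square_pair i).2 = i.
Proof. by elim: i => // i IH; rewrite /square_pair iterS pair_rank_next IH. Qed.

Lemma pair_rank_max p q :
  (maxn p q * maxn p q <= pair_rank p q < (maxn p q).+1 * (maxn p q).+1)%N.
Proof. by rewrite /pair_rank; case: (leqP p q) => pq; nia. Qed.

Lemma pair_rank_inj p q p' q' : pair_rank p q = pair_rank p' q' -> (p, q) = (p', q').
Proof.
move=> h; have mE : maxn p q = maxn p' q'.
  have := pair_rank_max p q; have := pair_rank_max p' q'; rewrite -h.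
  by move: (maxn p q) (maxn p' q') => k k'; nia.
have : p = p' /\ q = q'.
  move: h mE; rewrite /pair_rank; case: (leqP p q) => pq; case: (leqP p' q') => pq'; nia.
by move=> [-> ->].
Qed.

Lemma pair_rankK p q : square_pair (pair_rank p q) = (p, q).
Proof.
by have := square_pairK (pair_rank p q); case: square_pair => p' q' /pair_rank_inj.
Qed.

(** With k^2 <= m <= k^2 + 2k, the first [m] pairs are the square of side k together with a
    piece of the column of index k, or the square of side k + 1 without a piece of its last
    row; either piece is a difference of two boxes. *)
Lemma pair_rank_boxes m : exists a b c d a' b' : nat, forall p q : nat,
  ((pair_rank p q < m) + (p < c) * (q < d) = (p < a) * (q < b) + (p < a') * (q < b'))%N.
Proof.
have [k [r [mE rk]]] : exists k r, (m = k * k + r /\ r <= k + k)%N.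
  elim: m => [|m [k [r [-> rk]]]]; first by exists 0%N, 0%N.
  have [h|h] := leqP r.+1 (k + k)%N; first by exists k, r.+1; split; lia.
  by exists k.+1, 0%N; split; nia.
have rank_lt p q : (pair_rank p q < m)%N =
    (if p <= q then (q < k) || ((q == k) && (p < r))
     else (p < k) || ((p == k) && (k + (k - q) < r)))%N.
  rewrite mE /pair_rank; case: (leqP p q) => pq.
    have [qk|qk|->] := ltngtP q k; apply/idP/idP => //=; nia.
  by have [qk|qk|->] := ltngtP p k; apply/idP/idP => //=; nia.
have [rk1|rk1] := leqP r k.+1.
  exists k, k, r, k, r, k.+1 => p q; rewrite rank_lt; case: (leqP p q) => pq; lia.
exists k.+1, k.+1, k.+1, (k + k + 1 - r)%N, k, (k + k + 1 - r)%N => p q.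
by rewrite rank_lt; case: (leqP p q) => pq; lia.
Qed.

Definition seq_rank (s : seq nat) : nat := if s is p :: r then foldl pair_rank p r else 0%N.

Lemma seq_rank_rcons s q : (0 < size s)%N -> seq_rank (rcons s q) = pair_rank (seq_rank s) q.
Proof. by case: s => // p s _; rewrite /= foldl_rcons. Qed.

Lemma square_enumS d i :
  square_enum d.+2 i = rcons (square_enum d.+1 (square_pair i).1) (square_pair i).2.
Proof. by []. Qed.

Lemma size_square_enum d i : size (square_enum d.+1 i) = d.+1.
Proof. by elim: d i => // d IH i; rewrite square_enumS size_rcons IH. Qed.

Lemma square_enumK d i : seq_rank (square_enum d.+1 i) = i.
Proof.
elim: d i => // d IH i; rewrite square_enumS seq_rank_rcons ?size_square_enum//.
by rewrite IH square_pairK.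
Qed.

Lemma seq_rankK d s : size s = d.+1 -> square_enum d.+1 (seq_rank s) = s.
Proof.
elim: d s => [|d IH] s; first by case: s => // x [].
case/lastP: s => // s q; rewrite size_rcons => -[sd].
by rewrite seq_rank_rcons ?sd// square_enumS pair_rankK IH.
Qed.

Variable K : comRingType.

Definition box_indicator (a s : seq nat) : K := \prod_(i < size s) (nth 0%N s i < nth 0%N a i)%N%:R.

Lemma box_indicator_rcons a s p q : size a = size s ->
  box_indicator (rcons a p) (rcons s q) = box_indicator a s * (q < p)%N%:R.
Proof.
move=> as_; rewrite /box_indicator size_rcons big_ord_recr/=.
rewrite !nth_rcons as_ ltnn eqxx; congr (_ * _); apply: eq_bigr => i _.
by rewrite !nth_rcons as_ ltn_ord.
Qed.

(** Induction on the dimension: the first [m] pairs of (rank of the first coordinates, last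
    coordinate) are a signed sum of three boxes, and the condition that a rank lies below a
    bound is expanded by induction. *)
Lemma seq_rank_boxes d m : exists L : seq (bool * seq nat),
  [/\ size L = (3 ^ d)%N, forall x, x \in L -> size x.2 = d.+1 &
      forall s, size s = d.+1 ->
        (seq_rank s < m)%N%:R = \sum_(x <- L) (-1) ^+ x.1 * box_indicator x.2 s].
Proof.
elim: d m => [|d IH] m.
  exists [:: (false, [:: m])]; split=> // [x|s]; first by rewrite inE => /eqP ->.
  by case: s => // x [] // _; rewrite big_seq1 /box_indicator big_ord1 mul1r.
have [a [b [c [d' [a' [b' abE]]]]]] := pair_rank_boxes m.
have [L1 [s1 L1s L1E]] := IH a; have [L2 [s2 L2s L2E]] := IH c.
have [L3 [s3 L3s L3E]] := IH a'.
pose ext (neg : bool) (q : nat) (x : bool * seq nat) := (neg (+) x.1, rcons x.2 q).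
exists (map (ext false b) L1 ++ map (ext true d') L2 ++ map (ext false b') L3); split.
- by rewrite !size_cat !size_map s1 s2 s3 expnS mulSn mulSn mul1n.
- move=> x; rewrite !mem_cat => /or3P[] /mapP[y yL ->] /=; rewrite size_rcons.
  + by rewrite L1s.
  + by rewrite L2s.
  + by rewrite L3s.
- move=> s; case/lastP: s => // s q; rewrite size_rcons => -[sd].
  have extE neg q' (L : seq (bool * seq nat)) r : (forall x, x \in L -> size x.2 = d.+1) ->
      (seq_rank s < r)%N%:R = \sum_(x <- L) (-1) ^+ x.1 * box_indicator x.2 s ->
      \sum_(x <- map (ext neg q') L) (-1) ^+ x.1 * box_indicator x.2 (rcons s q) =
      (-1) ^+ neg * ((seq_rank s < r)%N%:R * (q < q')%N%:R).
    move=> Ls ->; rewrite big_map mulr_suml mulr_sumr.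
    rewrite big_seq [RHS]big_seq; apply: eq_bigr => x xL /=.
    by rewrite box_indicator_rcons ?Ls ?sd// signr_addb !mulrA.
  rewrite !big_cat/= (extE _ _ _ a)//; last exact: L1E.
  rewrite (extE _ _ _ c)//; last exact: L2E.
  rewrite (extE _ _ _ a')//; last exact: L3E.
  rewrite seq_rank_rcons ?sd// expr0 expr1 !mul1r mulN1r.
  have := congr1 (fun x : nat => x%:R : K) (abE (seq_rank s) q).
  rewrite !natrD !natrM => h; rewrite addrCA addrC -h [X in X - _]addrC.
  by rewrite addrAC subrr add0r.
Qed.
End SquareOrdering.

Lemma nth_square_enum_le d j l : (nth 0 (square_enum d.+1 j) l <= j)%N.
Proof.
elim: d j l => [|d IH] j l; first by case: l => [|[]].
rewrite square_enumS nth_rcons size_square_enum.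
have := square_pairK j; have := pair_rank_max (square_pair j).1 (square_pair j).2.
case: (square_pair j) => p q /= /andP[mr _] rj.
have pqm : (maxn p q <= maxn p q * maxn p q)%N by case: maxn => // h; rewrite leq_pmulr.
have {mr pqm} := leq_trans pqm mr; rewrite rj geq_max => /andP[pj qj].
case: ifP => _; first exact: leq_trans (IH _ _) pj.
by case: ifP.
Qed.

(** * The basis of a projective tensor product *)
Section TensorBasis.
Variables (R : realType) (k : ground).
Local Notation K := (scalars R k).
Variables (I : finType) (G : I -> normedModType K).
Variables (X : completeNormedModType K) (t : (forall i, G i) -> X).
Hypothesis Xt : projective_completion t.
Local Notation T := (forall i, G i).
Variables (d : nat) (pos : I -> 'I_d.+1) (factor : 'I_d.+1 -> I).
Hypotheses (posK : cancel pos factor) (factorK : cancel factor pos).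
Variables (b : forall i, nat -> G i) (a : forall i, nat -> G i -> K) (C : R).
Arguments a : clear implicits.
Hypothesis ba : forall i, expansion (b i) (a i).
Hypothesis C1 : 1 <= C.
Hypothesis aC : forall i v m, rnorm (\sum_(j < m) a i j v *: b i j) <= C * rnorm v.

Let C0 : 0 <= C. Proof. exact: le_trans C1. Qed.

Let tm : @multilinear R k I (fun i => G i) X t. Proof. by have [] := Xt. Qed.

Let t_le y : rnorm (t y) <= \prod_i rnorm (y i). Proof. exact: rnorm_tensor_le Xt y. Qed.

Let index (j : nat) (i : I) : nat := nth 0%N (square_enum d.+1 j) (pos i).

Definition tensor_monomial (j : nat) : X := t (fun i => b i (index j i)).

Let coef_le i l v : rnorm (a i l v : K^o) <= (2 * C / rnorm (b i l)) * rnorm v.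
Proof.
have b0 := rnorm_gt0 (expansion_neq0 (ba i) l).
rewrite mulrAC ler_pdivlMr// -rnormZ.
have -> : a i l v *: b i l = \sum_(j < l.+1) a i j v *: b i j - \sum_(j < l) a i j v *: b i j.
  by rewrite big_ord_recr/= addrAC subrr add0r.
apply: le_trans (rnormD _ _) _; rewrite rnormN.
by have := aC v l; have := aC v l.+1; lra.
Qed.

(** The product of the coordinate functionals is bounded because a coordinate is, up to the
    norm of the basis vector, a difference of two partial sums. *)
Lemma tensor_coefficient_exists j : exists L : {linear X -> K^o},
  (forall y, L (t y) = \prod_i a i (index j i) (y i)) /\
  exists c : R, forall u, rnorm (L u) <= c * rnorm u.
Proof.
pose c := \prod_i (2 * C / rnorm (b i (index j i))).
have c_ge0 i : 0 <= 2 * C / rnorm (b i (index j i)).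
  by rewrite divr_ge0 ?rnorm_ge0// mulr_ge0.
have Bm := multilinear_comp (G := fun i => G i) (H := fun=> K^o)
  (fun i => expansion_linear (ba i) (index j i)) (@prod_multilinear R k I).
have B_le y : rnorm (\prod_i a i (index j i) (y i) : K^o) <= c * \prod_i rnorm (y i).
  rewrite rnorm_prod -big_split/=; apply: ler_prod => i _.
  by rewrite rnorm_ge0 coef_le.
have c0 : 0 <= c by apply: prodr_ge0.
have [L [LE L_le]] := projective_extension (factor ord0) Xt Bm c0 B_le (@scalars_rcomplete R k).
by exists L; split=> //; exists c.
Qed.

Section Sections.
Variable kappa : nat -> {linear X -> K^o}.
Hypothesis kappaE : forall j y, kappa j (t y) = \prod_i a i (index j i) (y i).
Hypothesis kappa_le : forall j, exists c : R, forall u, rnorm (kappa j u) <= c * rnorm u.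

Let S (m : nat) (u : X) : X := \sum_(j < m) kappa j u *: tensor_monomial j.

Let S_linear m : linear (S m).
Proof.
move=> c u v; rewrite /S scaler_sumr -big_split/=; apply: eq_bigr => j _.
by rewrite linearP scalerDl scalerA.
Qed.

Let Slin m : {linear X -> X} := HB.pack (S m) (GRing.isLinear.Build K X X *:%R _ (S_linear m)).

Let rank (alpha : I -> nat) : nat := seq_rank (mkseq (fun l => alpha (factor (inord l))) d.+1).

Let index_rank alpha i : index (rank alpha) i = alpha i.
Proof.
rewrite /index /rank seq_rankK ?size_mkseq// nth_mkseq// inord_val posK //.
Qed.

Let rank_index alpha j : (forall i, index j i = alpha i) -> rank alpha = j.
Proof.
move=> ja; rewrite -[RHS](square_enumK d) /rank; congr seq_rank.
apply: (@eq_from_nth _ 0%N) => [|l]; rewrite size_mkseq ?size_square_enum// => ld.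
by rewrite nth_mkseq// -ja /index factorK inordK.
Qed.

Let kappa_delta j alpha : kappa j (t (fun i => b i (alpha i))) = (rank alpha == j)%:R.
Proof.
rewrite kappaE; case: eqVneq => [<-|ja].
  by rewrite big1// => i _; rewrite index_rank expansion_delta// eqxx.
have [i ji] : exists i, index j i != alpha i.
  apply: contrapT => /forallNP h; move/eqP: ja; apply; apply: rank_index => i.
  by apply/eqP; apply: contrapT => /negP; exact: h.
by rewrite (bigD1 i)//= expansion_delta// (negbTE ji) mul0r.
Qed.

Lemma kappa_monomial j l : kappa j (tensor_monomial l) = (j == l)%:R.
Proof. by rewrite kappa_delta (rank_index (j := l))// eq_sym. Qed.

(** The partial sum of [t y] runs over the multi-indices whose place in the square ordering
    is below [m].  On each box the sum factors into partial sums of the expansions of the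
    [y i].  Cutting the boxes at [m] keeps the sums finite and loses nothing, as entries do
    not exceed the place. *)
Lemma tensor_section_boxes m y : exists L : seq (bool * seq nat), size L = (3 ^ d)%N /\
  S m (t y) = \sum_(x <- L) (-1) ^+ x.1 *:
    t (fun i => \sum_(j < minn (nth 0%N x.2 (pos i)) m) a i j (y i) *: b i j).
Proof.
have [L [sL Ls LE]] := seq_rank_boxes K d m; exists L; split=> //.
pose f (alpha : {ffun I -> 'I_m}) : X :=
  (\prod_i a i (alpha i) (y i)) *: t (fun i => b i (alpha i)).
have SE : S m (t y) = \sum_(alpha : {ffun I -> 'I_m}) (rank (fun i => alpha i) < m)%N%:R *: f alpha.
  transitivity (\sum_(alpha : {ffun I -> 'I_m}) \sum_(j < m)
      (rank (fun i => alpha i) == j)%:R *: f alpha).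
    rewrite exchange_big/=; apply: eq_bigr => j _.
    have jm i : (index j i < m)%N.
      exact: leq_ltn_trans (nth_square_enum_le _ _ _) (ltn_ord j).
    pose beta : {ffun I -> 'I_m} := [ffun i => Ordinal (jm i)].
    have betaE i : index j i = beta i by rewrite ffunE.
    rewrite (bigD1 beta)//= (rank_index betaE) eqxx scale1r big1 ?addr0 => [|alpha].
      rewrite kappaE /f /tensor_monomial; congr (_ *: t _).
        by apply: eq_bigr => i _; rewrite betaE.
      by apply/functional_extensionality_dep => i; rewrite betaE.
    move=> ab; case: eqP => [ra|_]; last by rewrite scale0r.
    case/negP: ab; apply/eqP/ffunP => i; apply/val_inj => /=.
    by rewrite -(index_rank (fun i => alpha i)) ra betaE.
  apply: eq_bigr => alpha _; rewrite -scaler_suml; congr (_ *: _).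
  case: (ltnP (rank (fun i => alpha i)) m) => [rm|mr].
    rewrite (bigD1 (Ordinal rm))//= eqxx big1 ?addr0// => j.
    by rewrite -val_eqE/= eq_sym => /negbTE ->.
  by rewrite big1// => j _; rewrite gtn_eqF// (leq_trans (ltn_ord j)).
have indE (x : bool * seq nat) alpha :
    box_indicator K x.2 (mkseq (fun l => alpha (factor (inord l))) d.+1) =
    \prod_i (alpha i < nth 0%N x.2 (pos i))%N%:R.
  rewrite /box_indicator size_mkseq (reindex pos)/=; last first.
    by exists factor => i _; rewrite ?posK ?factorK.
  by apply: eq_bigr => i _; rewrite nth_mkseq// inord_val posK.
rewrite SE.
under eq_bigr => alpha _.
  rewrite LE ?size_mkseq// scaler_suml.
  under eq_bigr => x _ do
    rewrite (indE _ (fun i => alpha i)) -scalerA [_ *: f alpha]scalerA -big_split/=.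
  over.
rewrite exchange_big/=; apply: eq_bigr => x _; rewrite -scaler_sumr; congr (_ *: _).
rewrite -(multilinear_expand tm m (fun i j => (j < nth 0%N x.2 (pos i))%N%:R * a i j (y i)) b).
congr t; apply/functional_extensionality_dep => i.
rewrite -[RHS](big_mkord xpredT (fun j => a i j (y i) *: b i j)).
rewrite -(big_mkord xpredT
  (fun j => ((j < nth 0%N x.2 (pos i))%N%:R * a i j (y i)) *: b i j)).
rewrite (big_cat_nat (n := minn (nth 0%N x.2 (pos i)) m) (leq0n _) (geq_minr _ _))/=.
rewrite [X in _ + X]big_nat_cond [X in _ + X]big1 ?addr0 => [|j].
  apply: eq_big_nat => j; rewrite leq_min => /andP[_ /andP[-> _]].
  by rewrite mul1r.
rewrite andbT geq_min => /andP[/orP[h|h] jm]; last by rewrite ltnNge h in jm.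
by rewrite ltnNge h mul0r scale0r.
Qed.

Let c : R := (3 ^ d)%:R * C ^+ #|I|.

(** The bound does not depend on [m] because the number of boxes does not. *)
Lemma tensor_section_le m u : rnorm (S m u) <= c * rnorm u.
Proof.
have [c1 S_le] : exists c1 : R, forall u, rnorm (Slin m u) <= c1 * rnorm u.
  have /choice[g gP] := kappa_le.
  exists (\sum_(j < m) g j * rnorm (tensor_monomial j)) => v.
  apply: le_trans (rnorm_sum _ _ _) _; rewrite mulr_suml; apply: ler_sum => j _.
  by rewrite rnormZ mulrAC ler_wpM2r ?rnorm_ge0.
apply: (tensor_linear_le Xt _ S_le) => [|y]; first by rewrite mulr_ge0// exprn_ge0.
have [L [sL LE]] := tensor_section_boxes m y; rewrite -[Slin m _]/(S m _) LE.
apply: le_trans (rnorm_sum _ _ _) _.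
apply: (@le_trans _ _ (\sum_(x <- L) C ^+ #|I| * \prod_i rnorm (y i))).
  apply: ler_sum => x _; rewrite rnormZ.
  have -> : rnorm ((-1) ^+ x.1 : K^o) = 1.
    by case: x.1; rewrite ?expr1 ?expr0 ?(@rnormN _ _ K^o) rnorm1.
  rewrite mul1r (le_trans (t_le _))// -prodr_const -big_split/=.
  by apply: ler_prod => i _; rewrite rnorm_ge0 aC.
by rewrite big_const_seq count_predT sL iter_addr_0 /c -mulrA mulr_natl.
Qed.

(** By the uniform bound it is enough to take [u] in the span of the monomials, which the
    partial sums fix eventually. *)
Lemma tensor_section_tends u : tends (fun m => S m u) u.
Proof.
apply: (tensor_strong_cvg Xt (L := Slin) tensor_section_le) => y eps e0.
have c0 : 0 < 2 * (c + 1) by rewrite mulr_gt0// ltr_wpDl// mulr_ge0// exprn_ge0.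
have t_le1 x : rnorm (t x) <= 1 * \prod_i rnorm (x i) by rewrite mul1r.
have ty : tends (fun N => t (fun i => \sum_(j < N) a i j (y i) *: b i j)) (t y).
  apply: (multilinear_continuous_tends (multilinear_bounded_continuous tm ler01 t_le1)) => i.
  exact: (ba i).1.
have [N /(_ N (leqnn N))] := ty _ (divr_gt0 e0 c0).
set v := t _; rewrite ler_pdivlMr// => vy.
(* Any bound for the places of the finitely many monomials in [v] would do. *)
pose M := (\sum_(alpha : {ffun I -> 'I_N}) rank (fun i => alpha i)).+1.
exists M => m Mm; rewrite -[Slin m _]/(S m _).
have Sv : S m v = v.
  rewrite /v (multilinear_expand tm N (fun i j => a i j (y i)) b) -[S m _]/(Slin m _) linear_sum.
  apply: eq_bigr => alpha _; rewrite linearZ -[Slin m _]/(S m _) /=; congr (_ *: _).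
  have rm : (rank (fun i => alpha i) < m)%N.
    apply: leq_trans Mm; rewrite ltnS (bigD1 alpha)//= leq_addr //.
  rewrite /S (bigD1 (Ordinal rm))//= kappa_delta eqxx scale1r big1 ?addr0 => [|j].
    by congr t; apply/functional_extensionality_dep => i; rewrite index_rank.
  by rewrite -val_eqE/= eq_sym kappa_delta => /negbTE ->; rewrite scale0r.
have := tensor_section_le m (t y - v); rewrite -[S m _]/(Slin m _) linearB -[Slin m v]/(S m v) Sv.
have := rnorm_dist (Slin m (t y)) v (t y); move: vy; rewrite (rnormBC (t y)).
by lra.
Qed.

Lemma tensor_monomial_expansion : expansion tensor_monomial (fun j u => kappa j u).
Proof.
split=> [u|u g gu j]; first exact: tensor_section_tends.
have [c1 kc] := kappa_le j.
apply: (tends_unique _ (tends_linear (W := K^o) kc gu)).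
apply: (tends_eventually (N := j.+1) _ (tends_cst (g j : K^o))) => m jm /=.
rewrite linear_sum (bigD1 (Ordinal jm))//= linearZ/= kappa_monomial eqxx.
rewrite [_ *: _]mulr1 big1 ?addr0// => l.
by rewrite -val_eqE/= linearZ/= kappa_monomial eq_sym => /negbTE ->; rewrite scaler0.
Qed.
End Sections.

Theorem tensor_monomial_basis : schauder_basis tensor_monomial.
Proof.
apply/schauder_basis_expansion.
have /choice[kappa kP] := tensor_coefficient_exists.
exists (fun j u => kappa j u); apply: tensor_monomial_expansion => j => [y|].
  exact: (kP j).1.
exact: (kP j).2.
Qed.
End TensorBasis.

(** * The three ideals and the basis of monomials *)
Section CoordinateFunctionals.
Variables (R : realType) (k : ground).
Local Notation K := (scalars R k).
Variables (V : normedModType K) (e : nat -> V).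
Hypothesis eb : schauder_basis e.

Lemma coordinate_expansion e' : coordinate_functionals e e' -> expansion e (fun j v => e' j v).
Proof.
have [a [aP aU]] := (schauder_basis_expansion e).1 eb.
move=> ee'; have e'E v : tends (fun m => \sum_(j < m) e' j v *: e j) v.
  by apply/tends_rnorm; exact: ee'.
split=> // v c cv j; rewrite (aU _ _ cv).
exact/esym/(aU v (fun j => e' j v) (e'E v) j).
Qed.

Lemma coordinate_unique e' e'' :
  coordinate_functionals e e' -> coordinate_functionals e e'' -> e' = e''.
Proof.
move=> /coordinate_expansion[e'P _] /coordinate_expansion[_ e''U].
apply/funext => j; apply/val_inj/funext => v.
exact: (e''U v (fun j => e' j v) (e'P v) j).
Qed.

(** Evaluating the expansion of [x'] at [e j] leaves the single coefficient of [e' j], by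
    biorthogonality. *)
Lemma shrinking_expansion e' : coordinate_functionals e e' -> shrinking e ->
  expansion e' (fun j x' => x' (e j)).
Proof.
move=> ee' [e'' [ee'' /schauder_basis_expansion[a aP]]].
rewrite -(coordinate_unique ee' ee'') in aP.
have aE j (x' : dual V) : x' (e j) = a j x'.
  pose ev : {linear dual V -> K^o} := HB.pack (fun x' : dual V => x' (e j) : K^o)
    (GRing.isLinear.Build K (dual V) K^o *:%R (fun x' : dual V => x' (e j) : K^o)
      (fun _ _ _ => erefl)).
  have ev_le y' : rnorm (ev y') <= rnorm (e j) * rnorm y' by rewrite mulrC; exact: rnorm_dual_apply.
  apply: (tends_unique (tends_linear ev_le (aP.1 x'))).
  apply: (tends_eventually (N := j.+1) _ (tends_cst (a j x' : K^o))) => m jm /=.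
  have dE l : (a l x' *: e' l) (e j) = a l x' * (l == j)%:R.
    rewrite -(expansion_delta (coordinate_expansion ee') l j); exact: dualZE.
  have -> : (\sum_(l < m) a l x' *: e' l) (e j) = \sum_(l < m) a l x' * (l == j :> nat)%:R.
    by rewrite dual_sumE; apply: eq_bigr => l _; exact: dE.
  rewrite (bigD1 (Ordinal jm))//= eqxx mulr1 big1 ?addr0// => l.
  by rewrite -val_eqE/= => /negbTE ->; rewrite mulr0.
suff -> : (fun j (x' : dual V) => x' (e j)) = a by [].
by apply/funext => j; apply/funext => x'; exact: aE.
Qed.
End CoordinateFunctionals.

Lemma inf_eq (R : realType) (A : set R) (r : R) : (forall x, A x -> r <= x) ->
  (forall eps : R, 0 < eps -> exists2 x, A x & x <= r + eps) -> inf A = r.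
Proof.
move=> rA Ar; have [x0 Ax0 _] := Ar 1 ltr01.
apply/eqP; rewrite eq_le; apply/andP; split; last first.
  by apply: lb_le_inf => [|x /rA//]; exists x0.
apply/ler_addgt0Pr => eps /Ar[x Ax]; apply: le_trans.
by apply: ge_inf => //; exists r => y /rA.
Qed.

Section Identities.
Variables (R : realType) (k : ground).
Local Notation K := (scalars R k).
Variables (n : nat) (E : 'I_n -> normedModType K) (F : completeNormedModType K).
Variables (X : completeNormedModType K) (t : (forall o, dual_factors E F o) -> X).
Hypothesis Xt : projective_completion t.
Variable J : {linear X -> ((forall i, E i) -> F)}.
Hypothesis Jt : forall x' f, J (t (dual_tuple x' f)) = rank_one x' f.
Hypothesis J_le : forall u x, rnorm (J u x) <= (\prod_i rnorm (x i)) * rnorm u.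
Variables (e : forall i, nat -> E i) (e' : forall i, nat -> dual (E i)).
Variable C : R.
Hypothesis C1 : 1 <= C.
Hypothesis sectionC : forall i x' m, rnorm (dual_section e e' m x' : dual (E i)) <= C * rnorm x'.
Hypothesis dual_expansion : forall i, expansion (e' i) (fun j x' => x' (e i j)).
Hypothesis coord : forall i, coordinate_functionals (e i) (e' i).

Let section_tends i x' : tends (fun m => dual_section e e' m x' : dual (E i)) x'.
Proof. exact: (dual_expansion i).1. Qed.

Let J_inj u v : J u = J v -> u = v.
Proof. exact: (tensor_operator_inj Xt Jt J_le C1 sectionC section_tends). Qed.

Let tensor (S : (forall i, E i) -> F) mu : multilinear_operators S ->
  represents mu (@bidual_emb R k F \o S) ->
  exists u, J u = S /\ rnorm u <= Defs.total_variation mu.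
Proof. exact: (grothendieck_tensor Xt Jt J_le C1 sectionC section_tends coord). Qed.

Let operators u : multilinear_operators (J u).
Proof. exact: (tensor_operator_operators Xt Jt J_le). Qed.

Lemma nuclear_pietsch : nuclear E F `<=` pietsch_integral E F.
Proof.
move=> S [So [lambda [x' [f [s /nuclear_measure[mu [muS _]]]]]]].
by split=> //; exists mu.
Qed.

Lemma pietsch_grothendieck_integral : pietsch_integral E F `<=` grothendieck_integral E F.
Proof.
by move=> S [So [mu /pietsch_grothendieck[nu [nuS _]]]]; split=> //; exists nu.
Qed.

Lemma grothendieck_range : grothendieck_integral E F `<=` range J.
Proof. by move=> S [So [mu muS]]; have [u [<- _]] := tensor So muS; exists u. Qed.

Lemma range_nuclear : range J `<=` nuclear E F.
Proof.
move=> _ [u _ <-]; split; first exact: operators.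
have [lambda [x' [f [s [h _]]]]] := tensor_operator_nuclear Xt Jt J_le u ltr01.
by exists lambda, x', f, s.
Qed.

Lemma grothendieck_lower u mu : represents mu (@bidual_emb R k F \o J u) ->
  rnorm u <= Defs.total_variation mu.
Proof. by move=> /(tensor (operators u))[v [/J_inj ->]]. Qed.

Lemma pietsch_lower u mu : represents mu (J u) -> rnorm u <= Defs.total_variation mu.
Proof.
move=> /pietsch_grothendieck[nu [/grothendieck_lower nuJ nu_le]].
exact: le_trans nuJ nu_le.
Qed.

Lemma nuclear_lower u lambda x' f s : nuclear_representation (J u) lambda x' f s ->
  rnorm u <= s.
Proof.
move=> /nuclear_measure[mu [/pietsch_lower muJ mu_le]]; exact: le_trans muJ mu_le.
Qed.

Lemma nuclear_norm_tensor u : nuclear_norm E F (J u) = rnorm u.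
Proof.
apply: inf_eq => [s [lambda [x' [f]]]|eps e0]; first exact: nuclear_lower.
have [lambda [x' [f [s [h s_le]]]]] := tensor_operator_nuclear Xt Jt J_le u e0.
by exists s => //; exists lambda, x', f.
Qed.

Lemma pietsch_norm_tensor u : pietsch_norm E F (J u) = rnorm u.
Proof.
apply: inf_eq => [_ [mu muJ <-]|eps e0]; first exact: pietsch_lower.
have [lambda [x' [f [s [h s_le]]]]] := tensor_operator_nuclear Xt Jt J_le u e0.
have [mu [muJ mu_le]] := nuclear_measure h.
exists (Defs.total_variation mu); first by exists mu.
exact: le_trans mu_le s_le.
Qed.

Lemma grothendieck_norm_tensor u : grothendieck_norm E F (J u) = rnorm u.
Proof.
apply: inf_eq => [_ [mu muJ <-]|eps e0]; first exact: grothendieck_lower.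
have [lambda [x' [f [s [h s_le]]]]] := tensor_operator_nuclear Xt Jt J_le u e0.
have [mu [/pietsch_grothendieck[nu [nuJ nu_le]] mu_le]] := nuclear_measure h.
exists (Defs.total_variation nu); first by exists nu.
exact: le_trans nu_le (le_trans mu_le s_le).
Qed.

Lemma nuclear_range : nuclear E F = range J.
Proof.
apply/seteqP; split; last exact: range_nuclear.
exact: subset_trans nuclear_pietsch (subset_trans pietsch_grothendieck_integral grothendieck_range).
Qed.

Lemma pietsch_range : pietsch_integral E F = range J.
Proof.
apply/seteqP; split; last exact: subset_trans range_nuclear nuclear_pietsch.
exact: subset_trans pietsch_grothendieck_integral grothendieck_range.
Qed.

Lemma grothendieck_integral_range : grothendieck_integral E F = range J.
Proof.
apply/seteqP; split; first exact: grothendieck_range.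
rewrite -pietsch_range; exact: pietsch_grothendieck_integral.
Qed.

(** [J] is an isometry for the Grothendieck norm and maps the tensor monomials of the bases
    [e' i] and [f], with the basis of [F] as last factor, to the monomials. *)
Theorem square_monomial_basis f : schauder_basis f ->
  schauder_basis_of (grothendieck_integral E F) (grothendieck_norm E F) (square_monomials e' f).
Proof.
move=> fb; have [a af] := (schauder_basis_expansion f).1 fb.
have [Cf [Cf1 aC]] := expansion_bounded af (@complete_rcomplete _ _ F).
pose b (o : option 'I_n) : nat -> dual_factors E F o :=
  match o with Some i => e' i | None => f end.
pose c (o : option 'I_n) : nat -> dual_factors E F o -> K :=
  match o with Some i => fun j x' => (x' : dual (E i)) (e i j) | None => a end.
pose pos (o : option 'I_n) : 'I_n.+1 :=
  if o is Some i then widen_ord (leqnSn n) i else ord_max.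
pose factor (l : 'I_n.+1) : option 'I_n := insub (l : nat).
have posK : cancel pos factor.
  case=> [i|]; rewrite /factor /pos /=; first by rewrite (valK i).
  by rewrite insubN// ltnn.
have factorK : cancel factor pos.
  move=> l; apply/val_inj; rewrite /factor /pos; case: insubP => //= nl.
  by move: nl; rewrite -leqNgt => nl; apply/eqP; rewrite eqn_leq nl -ltnS ltn_ord.
have bc o : expansion (b o) (c o).
  by case: o => [i|]; [exact: dual_expansion|exact: af].
have CC1 : 1 <= C + Cf by move: C1 Cf1; lra.
have bC o v m : rnorm (\sum_(j < m) c o j v *: b o j) <= (C + Cf) * rnorm v.
  case: o v => [i|] v.
    apply: le_trans (sectionC v m) _; rewrite ler_wpM2r ?rnorm_ge0// lerDl.
    exact: le_trans Cf1.
  apply: le_trans (aC v m) _; rewrite ler_wpM2r ?rnorm_ge0// lerDr.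
  exact: le_trans C1.
have tau := tensor_monomial_basis Xt posK factorK bc CC1 bC.
have tauE j : J (tensor_monomial t pos b j) = square_monomials e' f j.
  rewrite /square_monomials -Jt; congr (J (t _)).
  by apply/functional_extensionality_dep => -[i|].
have sumE (g : nat -> K) m : \sum_(j < m) g j *: square_monomials e' f j =
    J (\sum_(j < m) g j *: tensor_monomial t pos b j).
  by rewrite linear_sum; apply: eq_bigr => j _; rewrite linearZ tauE.
have normE u (g : nat -> K) m :
    grothendieck_norm E F (J u - \sum_(j < m) g j *: square_monomials e' f j) =
    rnorm (u - \sum_(j < m) g j *: tensor_monomial t pos b j).
  by rewrite sumE -linearB grothendieck_norm_tensor.
split=> [j|S].
  by rewrite grothendieck_integral_range -tauE; exists (tensor_monomial t pos b j).
rewrite grothendieck_integral_range => -[u _ <-].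
have [g [gu gU]] := tau.2 u Logic.I; exists g; split=> [|g'].
  by under eq_fun do rewrite normE.
by under eq_fun do rewrite normE; exact: gU.
Qed.
End Identities.

Lemma dual_basis_constant (R : realType) (k : ground) (n : nat)
    (E : 'I_n -> normedModType (scalars R k)) (e : forall i, nat -> E i)
    (e' : forall i, nat -> dual (E i)) :
  (forall i, expansion (e' i) (fun j x' => x' (e i j))) ->
  exists C : R, 1 <= C /\
    forall i x' m, rnorm (dual_section e e' m x' : dual (E i)) <= C * rnorm x'.
Proof.
move=> dexp; have /choice[C CP] : forall i, exists C : R, 1 <= C /\
    forall x' m, rnorm (dual_section e e' m x' : dual (E i)) <= C * rnorm x'.
  by move=> i; exact: expansion_bounded (dexp i) (@dual_rcomplete R k (E i)).
have C0 i : 0 <= C i by apply: le_trans (CP i).1.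
exists (1 + \sum_i C i); split=> [|i x' m]; first by rewrite lerDl sumr_ge0.
apply: le_trans ((CP i).2 x' m) _; rewrite ler_wpM2r ?rnorm_ge0// (bigD1 i)//= addrCA lerDl.
by rewrite addr_ge0// sumr_ge0.
Qed.

Theorem corollary3p8 (R : realType) (k : ground) (n : nat)
    (E : 'I_n -> completeNormedModType (scalars R k))
    (e : forall i, nat -> E i)
    (F : completeNormedModType (scalars R k)) :
  (0 < n)%N ->
  (forall i, schauder_basis (e i)) ->
  (forall i, shrinking (e i)) ->
  bounded_approximation_property (bidual F) ->
  let N := nuclear (fun i => E i) F in
  let PI := pietsch_integral (fun i => E i) F in
  let GI := grothendieck_integral (fun i => E i) F in
  let normN := nuclear_norm (fun i => E i) F in
  let normPI := pietsch_norm (fun i => E i) F in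
  let normGI := grothendieck_norm (fun i => E i) F in
  (forall (X : completeNormedModType (scalars R k))
      (t : (forall o, dual_factors (fun i => E i) F o) -> X),
    projective_completion t ->
    exists J : {linear X -> ((forall i, E i) -> F)},
      [/\ forall (x' : forall i, dual (E i)) (f : F),
            J (t (dual_tuple x' f)) = rank_one x' f,
          range J = N &
          forall u, normN (J u) = rnorm u]) /\
  (N = PI /\ forall T, N T -> normN T = normPI T) /\
  (PI = GI /\ forall T, PI T -> normPI T = normGI T) /\
  (forall (f : nat -> F) (e' : forall i, nat -> dual (E i)),
    schauder_basis f ->
    (forall i, coordinate_functionals (e i) (e' i)) ->
    schauder_basis_of GI normGI (square_monomials e' f)).
Proof.
move=> _ eb es _ N PI GI normN normPI normGI.
have dexp e' : (forall i, coordinate_functionals (e i) (e' i)) ->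
    forall i, expansion (e' i) (fun j x' => x' (e i j)).
  by move=> coord i; exact: (shrinking_expansion (eb i) (coord i) (es i)).
(* Some coordinate functionals are needed for the first three claims; any will do. *)
pose e0 i := projT1 (cid (es i)).
have e0P i : coordinate_functionals (e i) (e0 i) by have [] := projT2 (cid (es i)).
have [C [C1 CP]] := dual_basis_constant (dexp e0 e0P).
have [X0 [t0 Xt0]] := projective_completion_exists (dual_factors (fun i => E i) F) None.
have [J0 [Jt0 J0_le]] := tensor_operator_exists Xt0.
have NE : N = range J0 := nuclear_range Xt0 Jt0 J0_le C1 CP (dexp e0 e0P) e0P.
have PE : PI = range J0 := pietsch_range Xt0 Jt0 J0_le C1 CP (dexp e0 e0P) e0P.
have GE : GI = range J0 := grothendieck_integral_range Xt0 Jt0 J0_le C1 CP (dexp e0 e0P) e0P.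
have normNE u : normN (J0 u) = rnorm u :=
  nuclear_norm_tensor Xt0 Jt0 J0_le C1 CP (dexp e0 e0P) e0P u.
have normPE u : normPI (J0 u) = rnorm u :=
  pietsch_norm_tensor Xt0 Jt0 J0_le C1 CP (dexp e0 e0P) e0P u.
have normGE u : normGI (J0 u) = rnorm u :=
  grothendieck_norm_tensor Xt0 Jt0 J0_le C1 CP (dexp e0 e0P) e0P u.
split=> [X t Xt|].
  have [J [Jt J_le]] := tensor_operator_exists Xt; exists J; split=> // [|u].
    by rewrite -(nuclear_range Xt Jt J_le C1 CP (dexp e0 e0P) e0P).
  exact: (nuclear_norm_tensor Xt Jt J_le C1 CP (dexp e0 e0P) e0P).
split; first by split=> [|T]; rewrite NE ?PE// => -[u _ <-]; rewrite normNE normPE.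
split; first by split=> [|T]; rewrite PE ?GE// => -[u _ <-]; rewrite normPE normGE.
move=> f e' fb e'P; have [C' [C'1 C'P]] := dual_basis_constant (dexp e' e'P).
exact: (square_monomial_basis Xt0 Jt0 J0_le C'1 C'P (dexp e' e'P) e'P fb).
Qed.
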